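(* Let $q>1$ and let $m_1<m_2<\cdots$ be positive integers with $\frac{m_{k+1}}{m_k}\ge q$ for all $k\in\mathbb{N}$. Let $(a_{k,n})_{1\le k\le n}$ be a triangular array of real numbers, and put $$S_n^{\mathrm W}(x)=\sum_{k=1}^n a_{k,n}W_{m_k}(x),\quad 0\le x\le 1,\qquad A_n=\Big(\sum_{k=1}^n a_{k,n}^2\Big)^{1/2},\qquad d_n=\max_{1\le k\le n}|a_{k,n}|,$$ where $W_m$ denotes the $m$th Walsh function. Suppose $A_n\to\infty$ as $n\to\infty$, and moreover that, as $n\to\infty$, - if $q\ge 2$: $\sum_{k=1}^n a_{k,n}^4\to\kappa_4<\infty$ and $n\,d_n^5\to 0$; - if $1<q<2$: there exists $\varepsilon>0$ such that $n^{1+\varepsilon}d_n^3\to 0$. Let $\psi(y)=e^{-\frac{y^4}{12}\kappa_4}$ if $q\ge 2$ and $\psi(y)=1$ if $1<q<2$. Then, as $n\to\infty$, for every fixed $y>0$, $$\big|\{x\in[0,1]:\ S_n^{\mathrm W}(x)\ge A_n^2y\}\big|=\frac{e^{-A_n^2\frac{y^2}{2}}}{y\,A_n\sqrt{2\pi}}\,\psi(y)\,(1+o(1)),$$ and for every fixed $y<0$, $$\big|\{x\in[0,1]:\ S_n^{\mathrm W}(x)\le A_n^2y\}\big|=\frac{e^{-A_n^2\frac{y^2}{2}}}{|y|\,A_n\sqrt{2\pi}}\,\psi(y)\,(1+o(1)).$$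
   Context: Walsh functions: let $r_0(x)=1$ for $0\le x<\frac12$, $r_0(x)=-1$ for $\frac12\le x<1$, extended to $\mathbb{R}$ with period $1$, and let $r_n(x)=r_0(2^nx)$, $n\ge 0$, be the Rademacher functions. If $n=\sum_{i\ge 0}k_i2^i$ with $k_i\in\{0,1\}$ is the dyadic expansion of $n$ and $l_1,\dots,l_m$ are the indices $i$ with $k_i=1$, then $W_n(x)=\prod_{i=1}^m r_{l_i}(x)$. The notation $|\cdot|$ of a set denotes Lebesgue measure. *)

(* Defs.v *)
From mathcomp Require Import all_boot all_order all_algebra.
From mathcomp Require Import all_classical all_reals all_analysis.
Set Implicit Arguments.
Unset Strict Implicit.
Unset Printing Implicit Defensive.
Import Order.TTheory GRing.Theory Num.Theory.
Import numFieldNormedType.Exports.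
Local Open Scope classical_set_scope.
Local Open Scope ring_scope.

Section WalshSums.
Context {R : realType}.

(* 1-periodic extension, via the fractional part of [x]. *)
Definition rademacher0 (x : R) : R :=
  if x - (Num.floor x)%:~R < 2^-1 then 1 else -1.

Definition rademacher (n : nat) (x : R) : R := rademacher0 (2 ^+ n * x).

(* The [i]-th binary digit of [n] is the parity of [n %/ 2 ^ i]; it vanishes
   for [i >= n], so [i < n] covers the whole dyadic expansion. *)
Definition walsh (n : nat) (x : R) : R :=
  \prod_(i < n | odd (n %/ 2 ^ i)) rademacher i x.

(* Sequences [m] and arrays [a] are indexed from 1: [a k n] stands for
   a_{k,n} and only its values for 1 <= k <= n are used. *)
Implicit Types (m : nat -> nat) (a : nat -> nat -> R).

Definition walsh_sum m a (n : nat) (x : R) : R :=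
  \sum_(1 <= k < n.+1) a k n * walsh (m k) x.

Definition ell2_norm a (n : nat) : R :=
  Num.sqrt (\sum_(1 <= k < n.+1) a k n ^+ 2).

(* The base value 0 is harmless, the maximum being over absolute values. *)
Definition max_coef a (n : nat) : R :=
  \big[Num.max/0]_(1 <= k < n.+1) `|a k n|.

Definition psi (q kappa4 y : R) : R :=
  if 2 <= q then expR (- (y ^+ 4 / 12 * kappa4)) else 1.

Definition gauss_tail a (q kappa4 y : R) (n : nat) : R :=
  expR (- (ell2_norm a n ^+ 2 * (y ^+ 2 / 2)))
    / (`|y| * ell2_norm a n * Num.sqrt (2 * pi)) * psi q kappa4 y.

(* f n = g n * (1 + o(1)); only eventual equality is meaningful, since g may
   involve a division by 0 for small n. *)
Definition eq_mul_1o1 (f : nat -> \bar R) (g : nat -> R) : Prop :=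
  exists2 delta : nat -> R, delta n @[n --> \oo] --> (0 : R) &
    \forall n \near \oo, f n = (g n * (1 + delta n))%:E.

End WalshSums.

(* Main.v *)
Require Import Defs.
From mathcomp Require Import all_boot all_order all_algebra.
From mathcomp Require Import all_classical all_reals all_analysis.
From mathcomp Require Import measurable_realfun complex.
From mathcomp Require Import ring lra zify.

(** Let [N = m_n]. On [[0, 1[] the sum S_n only depends on the first [N] binary
    digits of x, under which Lebesgue measure becomes the uniform law on the cube
    {0,1}^N, and W_m becomes the character of the cube given by the binary digits
    of m ([walsh_cell], [measure_cube_mean]). The tail is thus a finite sum, which
    is evaluated by exponential tilting.

    Let Z be the product of the cosh (y a_k) and X = S_n - y A_n^2. Undoing the
    tilt ([measure_tail]), the measure of the tail is
    (Z e^{- y^2 A_n^2} / A_n) L, where L is the sum of 1_{X >= 0} e^{- y X} against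
    A_n times the tilted measure of density e^{y S_n} / Z. As
    ln (cosh x) = x^2/2 - x^4/12 + O(x^6), the product Z e^{- y^2 A_n^2 / 2} tends to
    e^{- y^4 kappa_4 / 12} ([tilt_const_cvg]), with kappa_4 = 0 if q < 2. What
    remains is that L tends to 1 / (y sqrt(2 pi)): under the tilt X should look like
    a centered normal variable of variance A_n^2, of density 1 / (A_n sqrt(2 pi))
    near 0, and the integral of e^{- y s} over s > 0 is 1 / y.

    The characteristic function of X under the tilt is computed as if the Walsh
    functions were independent signs: by e^{z c} = cosh z + c sinh z for c = 1, -1,
    it is a product of scalars, each Gaussian up to a relative error O(|u| a_k^4)
    ([tilted_cos_gauss]), times the mean of a Riesz product with coefficients of
    size O(d_n) ([tilted_charE]). If q >= 2 the frequencies have distinct highest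
    digits and this mean is 1 ([riesz_free]). If q < 2, a term of the expanded
    product can only survive if its highest digit is cancelled, and the leftover of
    that cancellation too; lacunarity leaves boundedly many choices for each, so the
    mean is 1 + O(n d_n^3) ([riesz_near1]).

    This controls the characteristic function with a relative error
    O(|u|) + o(1), but on bounded frequencies only. The function
    1_{x >= 0} e^{- y x} is therefore convolved with a Fejer kernel, whose transform
    has compact support. The Gaussian window concentrates at the scale
    |u| = 1 / A_n, where the error is negligible, so the smoothed sums converge
    ([smoothed_sum_cvg]); since the kernel is nonnegative, shifting by a small
    amount sandwiches L between smoothed sums ([local_limit]). For y < 0, the
    coefficients are replaced by their opposites. *)

Set Implicit Arguments.
Unset Strict Implicit.
Unset Printing Implicit Defensive.
Import Order.TTheory GRing.Theory Num.Theory.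
Import numFieldNormedType.Exports.
Local Open Scope classical_set_scope.
Local Open Scope ring_scope.

(** * Riesz products on the cube *)

Section RieszProducts.
Variables (K : numFieldType) (N : nat).
Implicit Types (f g : nat -> bool) (w : {ffun 'I_N -> bool}) (t : nat -> K)
  (b : nat -> nat -> bool).

Definition cube_mean (F : {ffun 'I_N -> bool} -> K) : K :=
  (\sum_w F w) / 2 ^+ N.

(** The Walsh functions, seen as the characters of the group {0,1}^N. *)
Definition character f w : K := \prod_(i < N) (-1) ^+ (f i && w i).

Definition xorb2 f g : nat -> bool := fun i => f i (+) g i.

Lemma characterD f g w :
  character (xorb2 f g) w = character f w * character g w.
Proof.
rewrite -big_split; apply: eq_bigr => i _ /=; rewrite /xorb2.
by case: (f i); case: (g i); case: (w i); rewrite /= ?expr0 ?expr1 ?mulr1 ?mul1r // mulrNN mulr1.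
Qed.

Lemma character_eq1 f w : (forall i, (i < N)%N -> f i = false) -> character f w = 1.
Proof. by move=> f0; apply: big1 => i _; rewrite f0. Qed.

Lemma characterV f w : character f w = 1 \/ character f w = -1.
Proof.
rewrite /character; apply: (big_ind (fun x : K => x = 1 \/ x = -1)).
- by left.
- by move=> x y [->|->] [->|->]; rewrite ?mulr1 ?mul1r ?mulrNN ?mulr1; [left|right|right|left].
- by move=> i _; case: (_ && _); [right|left].
Qed.

Lemma normr_character f w : `|character f w| = 1.
Proof. by case: (characterV f w) => ->; rewrite ?normrN normr1. Qed.

Lemma cube_mean_cst x : cube_mean (fun=> x) = x.
Proof.
rewrite /cube_mean sumr_const card_ffun card_bool card_ord -[x *+ _]mulr_natr natrX mulfK ?expf_neq0 //.
Qed.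

Definition flip (i : 'I_N) w : {ffun 'I_N -> bool} :=
  [ffun j => (j == i) (+) w j].

Lemma flipK i : involutive (flip i).
Proof. by move=> w; apply/ffunP => j; rewrite !ffunE addbA addbb. Qed.

Lemma character_flip f i w :
  character f (flip i w) = (-1) ^+ f i * character f w.
Proof.
rewrite /character (bigD1 i) //= [in RHS](bigD1 i) //= mulrA; congr (_ * _).
  by rewrite ffunE eqxx; case: (f i); case: (w i); rewrite /= ?expr0 ?expr1 ?mulr1 // mulrNN mulr1.
by apply: eq_bigr => j ji; rewrite ffunE (negbTE ji).
Qed.

Lemma cube_mean_odd F (i : 'I_N) :
  (forall w, F (flip i w) = - F w) -> cube_mean F = 0.
Proof.
move=> oddF; rewrite /cube_mean; set S := \sum_w _.
suff -> : S = 0 by rewrite mul0r.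
have : S = - S.
  rewrite {1}/S (reindex_inj (inv_inj (flipK i))) /= -sumrN.
  by apply: eq_bigr => w _; rewrite oddF.
move/eqP; rewrite -subr_eq0 opprK -mulr2n -mulr_natr mulf_eq0 pnatr_eq0 orbF.
by move/eqP.
Qed.

(** The Fourier coefficient at [f] of a Riesz product. Only [f = 0] matters in
    the end; the recursion on the number of factors produces the others. *)
Definition riesz t b l f : K :=
  cube_mean (fun w => character f w *
     \prod_(1 <= k < l.+1) (1 + t k * character (b k) w)).

Lemma riesz0 t b f : riesz t b 0 f = cube_mean (character f).
Proof.
rewrite /riesz/cube_mean; congr (_ / _); apply: eq_bigr => w _.
by rewrite big_nil mulr1.
Qed.

(** Flipping a digit that [f] contains and no factor contains changes the sign
    of the integrand. *)
Lemma riesz_vanish t b l f i : (i < N)%N -> f i ->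
  (forall k, (1 <= k <= l)%N -> b k i = false) -> riesz t b l f = 0.
Proof.
move=> iN fi bi; apply: (@cube_mean_odd _ (Ordinal iN)) => w.
rewrite character_flip /= fi expr1 mulN1r mulNr; congr (- (_ * _)).
apply: eq_big_nat => k kl; rewrite character_flip /= bi ?expr0 ?mul1r //.
Qed.

Lemma rieszS t b l f : riesz t b l.+1 f =
  riesz t b l f + t l.+1 * riesz t b l (xorb2 f (b l.+1)).
Proof.
rewrite /riesz /cube_mean mulrA mulr_sumr -mulrDl -big_split /=; congr (_ / _).
apply: eq_bigr => w _; rewrite big_nat_recr //= characterD; ring.
Qed.

(** The expanded product, sorted by the last factor that contributes its
    character. *)
Lemma riesz_sum t b l f : riesz t b l f = cube_mean (character f) +
  \sum_(1 <= j < l.+1) t j * riesz t b j.-1 (xorb2 f (b j)).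
Proof.
elim: l => [|l IH]; first by rewrite riesz0 big_nil addr0.
by rewrite rieszS IH [in RHS]big_nat_recr //= addrA.
Qed.

End RieszProducts.

(** If [l] satisfies [P], every index satisfying [P] is one of the last [C]. *)
Lemma window_count (P : pred nat) (C l : nat) :
  (forall i j, (i < j)%N -> P i -> P j -> (j < i + C)%N) ->
  (0 < C)%N ->
  (\sum_(1 <= j < l.+1 | P j) 1 <= C)%N.
Proof.
move=> PC C0; elim: l => [|l IH]; first by rewrite big_nil.
rewrite big_mkcond /= big_nat_recr //= -big_mkcond /=.
case: ifP => Pl; last by rewrite addn0.
rewrite addn1.
have [lC|Cl] := leqP l.+1 C.
  apply: leq_trans lC; rewrite ltnS.
  apply: (@leq_trans (\sum_(1 <= j < l.+1) 1)); last by rewrite sum_nat_const_nat; lia.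
  by rewrite big_mkcond /=; apply: leq_sum => j _; case: ifP.
rewrite (@big_cat_nat _ _ _ (l.+2 - C)%N) /=; [|lia|lia].
rewrite big_nat_cond big1 ?add0n; last first.
  move=> i /andP[/andP[i1 il] Pi].
  by have := PC _ _ (_ : i < l.+1)%N Pi Pl; lia.
apply: (@leq_ltn_trans (\sum_(l.+2 - C <= j < l.+1) 1)).
  by rewrite big_mkcond /=; apply: leq_sum => j _; case: ifP.
by rewrite sum_nat_const_nat; lia.
Qed.

Lemma window_sum (K : numDomainType) (P : pred nat) (C l : nat) (F : nat -> K) (x : K) :
  (forall i j, (i < j)%N -> P i -> P j -> (j < i + C)%N) ->
  (0 < C)%N -> 0 <= x ->
  (forall j, (1 <= j <= l)%N -> P j -> `|F j| <= x) ->
  `|\sum_(1 <= j < l.+1 | P j) F j| <= C%:R * x.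
Proof.
move=> PC C0 x0 Fx; apply: le_trans (ler_norm_sum _ _ _) _.
apply: (@le_trans _ _ (\sum_(1 <= j < l.+1 | P j) x)).
  by rewrite big_nat_cond [leRHS]big_nat_cond; apply: ler_sum => j /andP[jl Pj]; apply: Fx.
have -> : \sum_(1 <= j < l.+1 | P j) x = (\sum_(1 <= j < l.+1 | P j) 1)%N%:R * x.
  by rewrite natr_sum mulr_suml; apply: eq_bigr => j _; rewrite mul1r.
by rewrite ler_wpM2r // ler_nat window_count.
Qed.

Section RieszBounds.
Variables (K : numFieldType) (N : nat) (t : nat -> K) (b : nat -> nat -> bool).
Variables (top : nat -> nat) (n c C : nat) (tau : K).
(* The digit [top k] is the highest one of the character [b k]. *)
Hypothesis top_lt : forall k, (1 <= k <= n)%N -> (top k < N)%N.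
Hypothesis top_mono : forall i j, (1 <= i)%N -> (i <= j)%N -> (top i <= top j)%N.
Hypothesis b_top : forall k, (1 <= k)%N -> b k (top k).
Hypothesis b_above : forall k i, (1 <= k)%N -> (top k < i)%N -> b k i = false.
Hypothesis t_le : forall k, (1 <= k <= n)%N -> `|t k| <= tau.

Local Notation riesz := (@riesz K N t b).

Lemma riesz_above l (f : nat -> bool) p : (l <= n)%N -> (p < N)%N -> f p ->
  (forall k, (1 <= k <= l)%N -> (top k < p)%N) -> riesz l f = 0.
Proof.
by move=> ln pN fp tp; apply: (@riesz_vanish _ _ _ _ _ _ p) => // k kl;
  apply: b_above; [case/andP: kl|apply: tp].
Qed.

(** With strictly increasing highest digits, every non-constant term of the
    expanded product keeps the highest digit of its last factor. *)
Lemma riesz_free : (forall i j, (1 <= i < j)%N -> (top i < top j)%N) ->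
  riesz n (fun=> false) = 1.
Proof.
move=> tinc; rewrite riesz_sum [X in X + _](_ : _ = 1); last first.
  rewrite -[RHS](@cube_mean_cst K N); congr cube_mean.
  by apply/funext => w; rewrite character_eq1.
rewrite big_nat big1 ?addr0 // => j /andP[j1 jn].
rewrite (@riesz_above _ _ (top j)) ?mulr0 //; first lia.
- by apply: top_lt; rewrite j1.
- by rewrite /xorb2 /= b_top.
- by move=> k kj; apply: tinc; lia.
Qed.

(** The digit [p] of [f] has to be cancelled by some factor, so the last factor
    that contributes reaches up to [p], the highest digits being monotone. *)
Lemma riesz_sum_above l (f : nat -> bool) p : (l <= n)%N -> (p < N)%N -> f p ->
  riesz l f = \sum_(1 <= k < l.+1 | (0 < k)%N && (p <= top k)%N)
     t k * riesz k.-1 (xorb2 f (b k)).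
Proof.
move=> ln pN fp; rewrite riesz_sum -(@riesz0 _ _ t b) (@riesz_above _ _ p) ?add0r //; last first.
  by move=> k; lia.
rewrite big_nat_cond [RHS]big_nat_cond big_mkcond [RHS]big_mkcond /=.
apply: eq_bigr => k _; rewrite andbT.
case: (boolP (1 <= k < l.+1)%N) => //= /andP[k1 kl]; rewrite k1 /=.
case: leqP => // tkp.
rewrite (@riesz_above _ _ p) ?mulr0 //; first lia.
- by rewrite /xorb2 /= fp b_above.
- by move=> i ik; apply: leq_ltn_trans tkp; apply: top_mono; lia.
Qed.

(* These two conditions are how lacunarity enters: few characters have their
   highest digit in a given range of [c + 1] digits, and two characters with the
   same highest digit already differ at one of the [c] digits below it. *)
Hypothesis window : forall i j s, (1 <= i < j)%N -> (s <= top i)%N ->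
  (top j <= s + c)%N -> (j < i + C)%N.
Hypothesis separated : forall i j, (1 <= i < j)%N -> top i = top j ->
  exists p, [/\ (p < top j)%N, (top j <= p + c)%N & b i p != b j p].
Hypothesis C_gt0 : (0 < C)%N.
Hypothesis tau_ge0 : 0 <= tau.

(** When all factors stay below [p + c], those that can cancel the digit [p] of
    [f] form one window, and there are at most [C] of them. *)
Lemma riesz_bound_step l (f : nat -> bool) p (x : K) :
  (l <= n)%N -> (p < N)%N -> f p -> 0 <= x ->
  (forall k, (1 <= k <= l)%N -> (top k <= p + c)%N) ->
  (forall k, (1 <= k <= l)%N -> (p <= top k)%N ->
     `|riesz k.-1 (xorb2 f (b k))| <= x) ->
  `|riesz l f| <= C%:R * (tau * x).
Proof.
move=> ln pN fp x0 tc xk; rewrite (riesz_sum_above ln pN fp).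
rewrite big_nat_cond (eq_bigl (fun k => (1 <= k < l.+1)%N &&
  [&& (0 < k)%N, (k <= l)%N & (p <= top k)%N])); last first.
  by move=> k; rewrite ltnS; case: (0 < k)%N; case: (k <= l)%N.
rewrite -big_nat_cond; apply: window_sum => //.
- by move=> i j ij /and3P[i0 il pi] /and3P[j0 jl pj]; apply: (window _ pi); rewrite ?i0 //; apply: tc; lia.
- exact: mulr_ge0.
- move=> j jl /and3P[j0 _ pj]; rewrite normrM ler_pM //; first by apply: t_le; lia.
  exact: xk.
Qed.

(** If [f] lives far below [top j], cancelling the digit [top j] of [b j] takes
    an earlier factor [k] with the same highest digit. The product of the two
    characters still has a digit among the [c] below it, where [b k] and [b j]
    differ and [f] vanishes, and cancelling that one takes a third factor. Each
    of these two choices is made within a window, hence the factor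
    [(C tau)^2]. *)
Lemma riesz_free_step j (f : nat -> bool) : (1 <= j <= n)%N ->
  (forall p, (top j <= p + c)%N -> f p = false) ->
  (forall k (h : nat -> bool), (k < j)%N -> (forall i, (N <= i)%N -> h i = false) ->
     `|riesz k h| <= 2) ->
  `|riesz j.-1 (xorb2 f (b j))| <= C%:R * (tau * (C%:R * (tau * 2))).
Proof.
move=> jn f0 IH; have j1 : (1 <= j)%N by case/andP: jn.
apply: (@riesz_bound_step _ _ (top j)).
- lia.
- exact: top_lt.
- by rewrite /xorb2 /= f0 ?leq_addr // b_top.
- by rewrite !mulr_ge0.
- by move=> k kj; rewrite (leq_trans (top_mono _ (_ : k <= j)%N)) ?leq_addr //; lia.
move=> k kj tjk.
have tkj : top k = top j by apply/eqP; rewrite eqn_leq tjk top_mono //; lia.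
have [|p [pj jp bkj]] := @separated k j _ tkj; first lia.
have jN : (top j < N)%N by apply: top_lt.
apply: (@riesz_bound_step _ _ p) => //.
- lia.
- exact: ltn_trans jN.
- by rewrite /xorb2 /= f0 //=; move: bkj; case: (b k p); case: (b j p).
- by move=> i ik; apply: leq_trans jp; apply: top_mono; lia.
move=> i ik pi; apply: IH; first lia.
move=> r Nr; rewrite /xorb2 /= f0 ?b_above //; try lia.
- by apply: leq_trans Nr; apply: top_lt; lia.
Qed.

Hypothesis small1 : 4 * (C%:R * tau) <= 1.
Hypothesis small3 : 4 * (n%:R * (C%:R ^+ 2 * tau ^+ 3)) <= 1.

(** Strong induction on the number of factors. Let [p] be the highest digit of
    [f] and sort by the last contributing factor [j]. The term vanishes if
    [top j] is below [p]; the indices with [top j] between [p] and [p + c] form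
    a window and contribute at most [2 C tau <= 1/2]; for the others
    [riesz_free_step] applies, with a total of at most
    [2 n C^2 tau^3 <= 1/2]. The constant term is at most 1. *)
Lemma riesz_le2 l (f : nat -> bool) : (l <= n)%N ->
  (forall i, (N <= i)%N -> f i = false) -> `|riesz l f| <= 2.
Proof.
elim/ltn_ind: l f => l IH f ln fN.
have mean_le1 : `|cube_mean (@character K N f)| <= 1.
  rewrite /cube_mean normrM normfV normrX [`|2|]ger0_norm //.
  rewrite ler_pdivrMr ?exprn_gt0 // mul1r.
  apply: le_trans (ler_norm_sum _ _ _) _.
  under eq_bigr do rewrite normr_character.
  by rewrite sumr_const card_ffun card_bool card_ord natrX.
have l_le (x : K) : 0 <= x -> l%:R * x <= n%:R * x.
  by move=> x0; rewrite ler_wpM2r // ler_nat.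
pose y := tau * (C%:R * (tau * (C%:R * (tau * 2)))).
have y0 : 0 <= y by rewrite !mulr_ge0.
have y12 : 2 * (l%:R * y) <= 1.
  apply: le_trans small3; rewrite -subr_ge0.
  have -> : 4 * (n%:R * (C%:R ^+ 2 * tau ^+ 3)) - 2 * (l%:R * y) = 2 * (n%:R * y - l%:R * y).
    by rewrite /y; ring.
  by rewrite mulr_ge0 // subr_ge0 l_le.
have free j : (1 <= j <= l)%N -> (forall p, (top j <= p + c)%N -> f p = false) ->
    `|t j * riesz j.-1 (xorb2 f (b j))| <= y.
  move=> jl f0; rewrite normrM ler_pM //; first by apply: t_le; lia.
  by apply: riesz_free_step => //; [lia|move=> k h kj; apply: IH; lia].
have free_sum (P : pred nat) : (forall j, (1 <= j <= l)%N -> P j ->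
     `|t j * riesz j.-1 (xorb2 f (b j))| <= y) ->
   `|\sum_(1 <= j < l.+1 | P j) t j * riesz j.-1 (xorb2 f (b j))| <= l%:R * y.
  move=> Py; apply: le_trans (ler_norm_sum _ _ _) _.
  apply: (@le_trans _ _ (\sum_(1 <= j < l.+1) y)); last by rewrite sumr_const_nat subn1 /= mulr_natl.
  rewrite [leLHS]big_mkcond /= big_nat [leRHS]big_nat; apply: ler_sum => j jl.
  by case: ifP => Pj //; apply: Py.
have half (z : K) : 2 * z <= 1 -> z <= 2^-1 by rewrite -ler_pdivlMl // mulr1.
have total z1 z2 z3 : z1 <= 1 :> K -> 2 * z2 <= 1 -> 2 * z3 <= 1 -> z1 + (z2 + z3) <= 2.
  move=> h1 /half h2 /half h3.
  have -> : 2 = 1 + (2^-1 + 2^-1) :> K by field.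
  by rewrite !lerD.
(* Without digits, [f] falls under [riesz_free_step] for every [j]. *)
have [[p [fp pN]]|f0] := pselect (exists p, f p /\ forall i, (p < i)%N -> f i = false); last first.
  have {}f0 i : f i = false.
    apply/negP => fi; apply: f0.
    have ubf j : f j -> (j <= N)%N.
      by move=> fj; rewrite leqNgt; apply/negP => /ltnW/fN; rewrite fj.
    case: (@ex_maxnP f N (ex_intro _ i fi) ubf) => p fp pmax; exists p; split => // j pj.
    by apply/negP => /pmax; rewrite leqNgt pj.
  rewrite riesz_sum -[X in _ + X]addr0; apply: le_trans (ler_normD _ _) _.
  rewrite -[X in _ + X]addr0 -[X in `|X + 0|]addr0; apply: total; rewrite ?mulr0 //.
  rewrite !addr0; apply: le_trans y12; rewrite ler_wpM2l //; apply: free_sum => j jl _.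
  exact: free.
rewrite riesz_sum (bigID (fun j => (0 < j)%N && (p <= top j <= p + c)%N)) /=.
apply: le_trans (ler_normD _ _) _; apply: le_trans (lerD (lexx _) (ler_normD _ _)) _.
apply: total => //.
  apply: (@le_trans _ _ (2 * (C%:R * (tau * 2)))); last first.
    by apply: le_trans small1; rewrite le_eqVlt; apply/orP; left; apply/eqP; ring.
  rewrite ler_wpM2l //; apply: window_sum => //.
  - move=> i j ij /and3P[i0 pi ip] /and3P[j0 pj jp]; apply: (window _ pi) => //; lia.
  - by rewrite mulr_ge0.
  - move=> j jl _; rewrite normrM ler_pM //; first by apply: t_le; lia.
    apply: IH; try lia.
    move=> i Ni; rewrite /xorb2 fN // b_above //; first lia.
    by apply: leq_trans Ni; apply: top_lt; lia.
apply: le_trans y12; rewrite ler_wpM2l //; apply: free_sum => j jl.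
have -> : (0 < j)%N by lia.
rewrite /= negb_and -!ltnNge => /orP[tjp|tjp]; last by apply: free => // i ij; apply: pN; lia.
rewrite (@riesz_above _ _ p) ?mulr0 ?normr0 //.
- lia.
- by rewrite ltnNge; apply/negP => /fN; rewrite fp.
- by rewrite /xorb2 fp b_above //; lia.
- by move=> k kj; apply: leq_ltn_trans tjp; apply: top_mono; lia.
Qed.

(** Here [f = 0], so [riesz_free_step] applies to each of the [n] possible last
    factors. *)
Lemma riesz_near1 :
  `|riesz n (fun=> false) - 1| <= 2 * (n%:R * (C%:R ^+ 2 * tau ^+ 3)).
Proof.
have mean1 : cube_mean (@character K N (fun=> false)) = 1.
  rewrite -[RHS](@cube_mean_cst K N); congr cube_mean.
  by apply/funext => w; rewrite character_eq1.
rewrite riesz_sum mean1 [X in X - 1]addrC addrK.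
apply: le_trans (ler_norm_sum _ _ _) _.
apply: (@le_trans _ _ (\sum_(1 <= j < n.+1) (2 * (C%:R ^+ 2 * tau ^+ 3)))); last first.
  by rewrite sumr_const_nat subn1 /= -[_ *+ n]mulr_natl mulrCA.
rewrite big_nat [leRHS]big_nat; apply: ler_sum => j jn.
have -> : 2 * (C%:R ^+ 2 * tau ^+ 3) = tau * (C%:R * (tau * (C%:R * (tau * 2)))) by ring.
rewrite normrM ler_pM //; first by apply: t_le; lia.
apply: riesz_free_step => // k h kj hN; apply: riesz_le2 => //; lia.
Qed.

End RieszBounds.

(** * Walsh functions on dyadic cells *)

Definition bit (m i : nat) : bool := odd (m %/ 2 ^ i).

Lemma bit_div m i j : bit (m %/ 2 ^ j) i = bit m (i + j).
Proof. by rewrite /bit -divnMA -expnD addnC. Qed.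

Lemma bit_inj N m1 m2 : (m1 < 2 ^ N)%N -> (m2 < 2 ^ N)%N ->
  (forall i, (i < N)%N -> bit m1 i = bit m2 i) -> m1 = m2.
Proof.
elim: N m1 m2 => [|N IH] m1 m2; first by rewrite expn0 !ltnS !leqn0 => /eqP-> /eqP->.
move=> h1 h2 eq_bit.
have half : (m1 %/ 2 = m2 %/ 2)%N.
  apply: IH; try by rewrite ltn_divLR // -expnSr.
  by move=> i iN; have := eq_bit i.+1 iN; rewrite /bit expnS !divnMA.
have := eq_bit 0 isT; rewrite /bit expn0 !divn1 => o.
by rewrite (divn_eq m1 2) (divn_eq m2 2) half !modn2 o.
Qed.

Lemma bit_above m i : (m < 2 ^ i)%N -> bit m i = false.
Proof. by move=> mi; rewrite /bit divn_small. Qed.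

Section DyadicCells.
Context {R : realType}.
Notation mu := (@lebesgue_measure R).

Lemma rademacher_cell i (k : nat) (x : R) :
  k%:R <= 2 ^+ i.+1 * x < k.+1%:R -> rademacher i x = (-1) ^+ odd k.
Proof.
move=> /andP[kx xk]; rewrite /rademacher /rademacher0; set z := 2 ^+ i * x.
have z2 : 2 ^+ i.+1 * x = 2 * z by rewrite exprS mulrA.
rewrite z2 in kx xk.
have kE : (k%:R : R) = (odd k)%:R + 2 * (k./2)%:R.
  by rewrite -natrM -natrD mul2n odd_double_half.
rewrite -natr1 in xk.
have o01 : (odd k)%:R = 0 :> R \/ (odd k)%:R = 1 :> R by case: (odd k); [right|left].
have fz : Num.floor z = (k./2)%:Z.
  by apply: Num.Theory.floor_def; rewrite intrD -pmulrn; case: o01; lra.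
rewrite fz -pmulrn; move: kE {o01}; case: (odd k) => kE; rewrite ?expr1 ?expr0.
  rewrite (_ : true%:R = 1 :> R) // in kE.
  by rewrite ifF //; apply/negbTE; rewrite -leNgt; lra.
rewrite (_ : false%:R = 0 :> R) // in kE.
by rewrite ifT //; lra.
Qed.

Variable N : nat.
Local Notation cube := {ffun 'I_N -> bool}.

(** The digits are read backwards: the [i]-th Rademacher function reads the
    [i.+1]-st binary digit of [x] after the point, which is the digit of weight
    [2 ^ (N - i.+1)] of the number [k] of the cell. *)
Definition cell_bits (k : 'I_(2 ^ N)) : cube := [ffun i : 'I_N => bit k (N - i.+1)].

Lemma cell_bits_bij : bijective cell_bits.
Proof.
apply: inj_card_bij; last by rewrite card_ffun card_bool !card_ord.
move=> k l /ffunP kl; apply/val_inj; apply: (@bit_inj N); [exact: ltn_ord|exact: ltn_ord|move=> i iN].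
have iN' : (N - i.+1 < N)%N by rewrite ltn_subrL /=; case: (N) iN.
have := kl (Ordinal iN'); rewrite !ffunE /=.
by have -> : (N - (N - i.+1).+1 = i)%N by lia.
Qed.

Lemma walsh_cell m (k : 'I_(2 ^ N)) (x : R) : (m < 2 ^ N)%N ->
  k%:R <= 2 ^+ N * x < k.+1%:R -> walsh m x = character R (bit m) (cell_bits k).
Proof.
move=> mN kx; rewrite /walsh /character.
have cell i : (i < N)%N -> rademacher i x = (-1) ^+ bit k (N - i.+1).
  move=> iN; apply: rademacher_cell; rewrite -/(bit _ _).
  set M := (2 ^ (N - i.+1))%N.
  have M0 : (0 < M%:R :> R) by rewrite ltr0n expn_gt0.
  have NE : 2 ^+ N = M%:R * 2 ^+ i.+1 :> R by rewrite natrX -exprD subnK.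
  have /andP[k1 k2] := kx.
  have d1 : ((k %/ M) * M <= k)%N by exact: leq_divM.
  have d2 : (k.+1 <= (k %/ M).+1 * M)%N by rewrite ltn_ceil // expn_gt0.
  rewrite -(ler_pM2l M0) -(ltr_pM2l M0) mulrA -NE -!natrM; apply/andP; split.
    by apply: le_trans k1; rewrite ler_nat mulnC.
  by apply: lt_le_trans k2 _; rewrite ler_nat mulnC.
(* The range [i < m] of the Walsh product and the range [i < N] of the
   character are both compared with [i < m + N]. *)
transitivity (\prod_(i < (m + N)%N | bit m i) rademacher i x).
  rewrite (big_ord_widen_cond (m + N)%N (fun i => bit m i) (fun i => rademacher i x)) ?leq_addr //.
  apply: eq_bigl => i; rewrite -/(bit m i); case: (boolP (bit m i)) => //= bi.
  rewrite ltnNge; apply/negP => mi.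
  by rewrite bit_above // in bi; apply: leq_ltn_trans mi _; exact: ltn_expl.
have -> : \prod_(i < N) (-1) ^+ (bit m i && cell_bits k i) = \prod_(i < N | bit m i) rademacher i x.
  rewrite [RHS]big_mkcond; apply: eq_bigr => i _; rewrite ffunE.
  by case: (bit m i); rewrite /= ?expr0 // cell.
rewrite [RHS](big_ord_widen_cond (m + N)%N (fun i => bit m i) (fun i => rademacher i x)) ?leq_addl //.
apply: eq_bigl => i; case: (boolP (bit m i)) => //= bi.
rewrite ltnNge; apply/esym/negP => Ni; rewrite bit_above // in bi.
by apply: leq_trans mN _; rewrite leq_exp2l.
Qed.

(** Induction on the number of cells. Measurability is part of the induction,
    [Q] being controlled on the cells only. *)
Lemma measure_cells (Q : set R) (q : nat -> bool) (h : R) (K : nat) : 0 < h ->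
  (forall k x, (k < K)%N -> k%:R * h <= x < k.+1%:R * h -> Q x <-> q k) ->
  measurable (Q `&` [set` `[0%R, K%:R * h[]) /\
  mu (Q `&` [set` `[0%R, K%:R * h[]) = (\sum_(k < K) (q k)%:R * h)%:E.
Proof.
move=> h0; elim: K => [|K IH] Qq.
  by rewrite mul0r set_itvco0 setI0 big_ord0 measure0.
have [IH1 IH2] : _ := IH (fun k x kK => Qq k x (ltnW kK)).
set B : set R := [set` `[K%:R * h, K.+1%:R * h[].
have KK : K%:R * h <= K.+1%:R * h by apply: ler_wpM2r; [exact: ltW|rewrite ler_nat].
have split_K : Q `&` [set` `[0%R, K.+1%:R * h[] = (Q `&` [set` `[0%R, K%:R * h[]) `|` (Q `&` B).
  rewrite -setIUr; congr (_ `&` _); apply/seteqP; split => x /=; rewrite /B /= !in_itv /=.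
    by move=> /andP[x0 xK]; have [xK'|xK'] := ltP x (K%:R * h); [left; apply/andP|right; apply/andP].
  case=> /andP[x1 x2]; apply/andP; split => //; first exact: lt_le_trans KK.
  by apply: le_trans x1; rewrite mulr_ge0 // ltW.
have QB : Q `&` B = if q K then B else set0.
  case: ifP => qK; apply/seteqP; split => x //=.
  - by case.
  - by move=> Bx; split => //; apply/(Qq K _ (ltnSn K)); move: Bx; rewrite /B /= in_itv.
  - case=> Qx; rewrite /B /= in_itv /= => Bx.
    by move: ((Qq K x (ltnSn K) Bx).1 Qx); rewrite qK.
have mB : measurable (Q `&` B) by rewrite QB; case: ifP => _ //; exact: measurable_itv.
rewrite split_K; split; first exact: measurableU.
rewrite measureU //; last first.
  rewrite setIACA setIid; suff -> : [set` `[0%R, K%:R * h[] `&` B = set0 by rewrite setI0.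
  apply/seteqP; split => // x []; rewrite /B /= !in_itv /= => /andP[_ x1] /andP[x2 _].
  by move: x1; rewrite ltNge x2.
rewrite big_ord_recr /= EFinD -IH2; congr (_ + _)%E.
rewrite QB; case: ifP => _; last by rewrite measure0 mul0r.
rewrite /B lebesgue_measure_itv /= lte_fin ltr_pM2r // ltr_nat ltnSn -EFinD mul1r.
by congr EFin; rewrite -mulrBl -natrB // subSnn mul1r.
Qed.

(** The uniform law on [0,1] is carried to the uniform law on the cube by the
    first [N] binary digits; the end point 1, which lies in no cell, is a null
    set. *)
Lemma measure_cube_mean (P : R -> R) (p : cube -> R) (t : R) :
  (forall (k : 'I_(2 ^ N)) x, k%:R <= 2 ^+ N * x < k.+1%:R -> P x = p (cell_bits k)) ->
  mu [set x : R | 0 <= x <= 1 /\ P x >= t] =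
    (cube_mean (fun w : cube => ((t <= p w)%R : bool)%:R))%:E.
Proof.
move=> Pp; set h : R := 2 ^- N.
have h0 : 0 < h by rewrite invr_gt0 exprn_gt0.
pose q (k : nat) := if insub k : option 'I_(2 ^ N) is Some i then t <= p (cell_bits i) else false.
pose Q : set R := [set x | P x >= t].
have [|mQ muQ] := @measure_cells Q q h (2 ^ N) h0.
  move=> k x kN; rewrite /q insubT /= => /andP[k1 k2]; rewrite /Q /= (Pp (Ordinal kN)) //=.
  by rewrite mulrC -ler_pdivrMr ?exprn_gt0 // -ltr_pdivlMr ?exprn_gt0 // k1 k2.
have Nh : (2 ^ N)%:R * h = 1 by rewrite natrX mulfV // expf_neq0.
rewrite Nh in mQ muQ.
have -> : [set x : R | 0 <= x <= 1 /\ P x >= t] = (Q `&` [set` `[0%R, 1[]) `|` (Q `&` [set 1]).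
  rewrite -setIUr; apply/seteqP; split => x; rewrite /Q /= in_itv /=.
    move=> [/andP[x0 x1] Px]; split => //; have [->|xn1] := eqVneq x 1; [by right|left].
    by apply/andP; split => //; rewrite lt_neqAle xn1.
  move=> [Px [/andP[x0 x1]|x1]]; first by rewrite x0 ltW.
  by rewrite x1 in Px *; rewrite ler01 lexx.
have mu1 : mu (Q `&` [set 1]) = 0%E /\ measurable (Q `&` [set 1]).
  have [Q1|Q1] := pselect (Q 1).
    rewrite (_ : Q `&` [set 1] = [set 1]) ?lebesgue_measure_set1 //; last first.
    by apply/seteqP; split => x; [case|move=> ->].
  rewrite (_ : Q `&` [set 1] = set0) ?measure0 //.
  by apply/seteqP; split => x // [Qx /= x1]; apply: Q1; rewrite -x1.
transitivity (mu (Q `&` [set` `[0%R, 1%R[]) + mu (Q `&` [set 1%R]))%E.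
  apply: measureU => //; first exact: mu1.2.
  apply/seteqP; split => x // [[_]]; rewrite /= in_itv /= => /andP[_ x1] [_ x1'].
  by move: x1; rewrite x1' ltxx.
rewrite mu1.1 adde0 [LHS]muQ; congr EFin.
rewrite /cube_mean (reindex cell_bits) /=; last exact: onW_bij cell_bits_bij.
rewrite mulr_suml; apply: eq_bigr => k _; congr (_ * _).
by rewrite /q valK.
Qed.

End DyadicCells.

(** * Binary digits of lacunary sequences *)

(** By the Bernoulli inequality. *)
Lemma exists_expr_ge (R : realType) (q x : R) : 1 < q -> exists n : nat, x <= q ^+ n.
Proof.
move=> q1; have q1' : 0 < q - 1 by lra.
have bern n : 1 + n%:R * (q - 1) <= q ^+ n.
  elim: n => [|n IH]; first by rewrite mul0r addr0 expr0.
  rewrite exprS -natr1; apply: (@le_trans _ _ (q * (1 + n%:R * (q - 1)))); last first.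
    by rewrite ler_wpM2l //; lra.
  have : 0 <= n%:R * (q - 1) ^+ 2 by rewrite mulr_ge0 // sqr_ge0.
  lra.
exists (Num.truncn `|x / (q - 1)|).+1; apply: le_trans (bern _).
have : `|x / (q - 1)| < (Num.truncn `|x / (q - 1)|).+1%:R by exact: truncnS_gt.
have := ler_norm (x / (q - 1)); set w := `|_|; set v := _%:R => h1 h2.
have : x / (q - 1) <= v by lra.
rewrite ler_pdivrMr // => h; lra.
Qed.

Section TopBits.
Variable m : nat -> nat.
Hypotheses (m_gt0 : forall k : nat, (1 <= k)%N -> (0 < m k)%N)
  (m_incr : forall k : nat, (1 <= k)%N -> (m k < m k.+1)%N).

Definition top_bit k := trunc_log 2 (m k).

Lemma top_bitP k : (1 <= k)%N -> (2 ^ top_bit k <= m k < 2 ^ (top_bit k).+1)%N.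
Proof. by move=> k1; apply: trunc_log_bounds => //; exact: m_gt0. Qed.

Lemma m_mono i j : (1 <= i)%N -> (i < j)%N -> (m i < m j)%N.
Proof.
move=> i1; elim: j => // j IH; rewrite ltnS leq_eqVlt => /orP[/eqP <-|ij]; first exact: m_incr.
by apply: ltn_trans (IH ij) _; apply: m_incr; lia.
Qed.

Lemma top_bit_lt n k : (1 <= k <= n)%N -> (top_bit k < m n)%N.
Proof.
move=> /andP[k1 kn]; have /andP[h _] := top_bitP k1.
apply: leq_trans (ltn_expl _ (ltnSn 1)) _; apply: leq_trans h _.
by move: kn; rewrite leq_eqVlt => /orP[/eqP<-//|/(m_mono k1)/ltnW].
Qed.

Lemma top_bit_mono i j : (1 <= i)%N -> (i <= j)%N -> (top_bit i <= top_bit j)%N.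
Proof.
move=> i1; rewrite leq_eqVlt => /orP[/eqP-> //|ij].
by apply: leq_trunc_log; apply: ltnW; exact: m_mono.
Qed.

Lemma bit_top_bit k : (1 <= k)%N -> bit (m k) (top_bit k).
Proof.
move=> k1; have /andP[h1 h2] := top_bitP k1.
rewrite /bit (_ : m k %/ 2 ^ top_bit k = 1)%N //.
apply/eqP; rewrite eqn_leq -ltnS ltn_divLR ?expn_gt0 // -expnS h2 /=.
by rewrite divn_gt0 ?expn_gt0.
Qed.

Lemma bit_above_top k i : (1 <= k)%N -> (top_bit k < i)%N -> bit (m k) i = false.
Proof.
move=> k1 ki; apply: bit_above; have /andP[_ h] := top_bitP k1.
by apply: leq_trans h _; rewrite leq_exp2l.
Qed.

End TopBits.

Section Lacunary.
Variables (R : realType) (q : R) (m : nat -> nat).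
Hypotheses (q1 : 1 < q)
  (m_gt0 : forall k : nat, (1 <= k)%N -> (0 < m k)%N)
  (m_incr : forall k : nat, (1 <= k)%N -> (m k < m k.+1)%N)
  (m_lac : forall k : nat, (1 <= k)%N -> q <= (m k.+1)%:R / (m k)%:R).

Let q0 : 0 <= q. Proof. exact: ltW (lt_trans ltr01 q1). Qed.
Let q1' : 0 < q - 1. Proof. by rewrite subr_gt0. Qed.

Local Notation top_bit := (top_bit m).
Local Notation top_bitP := (top_bitP m_gt0).
Local Notation m_mono := (m_mono m_incr).

Lemma m_lac_expr i d : (1 <= i)%N -> q ^+ d * (m i)%:R <= (m (i + d))%:R :> R.
Proof.
move=> i1; elim: d => [|d IH]; first by rewrite expr0 mul1r addn0.
have k1 : (1 <= i + d)%N by lia.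
have := m_lac k1; rewrite ler_pdivlMr ?ltr0n ?m_gt0 // -addnS => h.
rewrite exprS -mulrA; apply: le_trans h.
by rewrite ler_wpM2l.
Qed.

Lemma top_bit_increasing : 2 <= q ->
  forall i j, (1 <= i < j)%N -> (top_bit i < top_bit j)%N.
Proof.
move=> q2 i j /andP[i1 ij].
suff : (top_bit i < top_bit i.+1)%N.
  by move=> h; apply: leq_trans h _; apply: top_bit_mono.
have h2 : (2 * m i <= m i.+1)%N.
  rewrite -(ler_nat R) natrM; have := m_lac i1.
  rewrite ler_pdivlMr ?ltr0n ?m_gt0 // => h; apply: le_trans h.
  by rewrite ler_wpM2r.
have /andP[h _] := top_bitP i1; rewrite -ltnS.
have : (2 ^ (top_bit i).+1 <= m i.+1)%N by rewrite expnS; apply: leq_trans h2; rewrite leq_mul2l h orbT.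
by move/(trunc_log_max (ltnSn 1)).
Qed.

(** Indices whose highest digits lie in [[s, s + c]] have their [m] within a
    factor [2 ^ c.+1] of each other, which [q ^ C] exceeds. *)
Lemma top_bit_window c : exists2 C : nat, (0 < C)%N &
  forall i j s, (1 <= i < j)%N -> (s <= top_bit i)%N -> (top_bit j <= s + c)%N -> (j < i + C)%N.
Proof.
have [C hC] := exists_expr_ge (2 ^+ c.+1) q1.
exists C.+1 => // i j s /andP[i1 ij] si js; rewrite ltnNge; apply/negP => Cij.
have j1 : (1 <= j)%N by lia.
have /andP[hi _] := top_bitP i1; have /andP[_ hj] := top_bitP j1.
have mi : (2 ^ s <= m i)%N by apply: leq_trans hi; rewrite leq_exp2l.
have mj : (m j < 2 ^ (s + c).+1)%N by apply: leq_trans hj _; rewrite leq_exp2l.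
have mC : (m (i + C) < m j)%N by apply: m_mono; lia.
have : (m (i + C))%:R < (2 ^ (s + c).+1)%:R :> R by rewrite ltr_nat; exact: ltn_trans mj.
rewrite ltNge => /negP; apply.
apply: le_trans (m_lac_expr C i1).
rewrite -addnS expnD natrM mulrC [X in X * _]natrX.
by apply: ler_pM; rewrite ?exprn_ge0 ?ler0n ?ler_nat.
Qed.

(** If [m i] and [m j] agreed from the digit [t - c] on, [t] being the common
    highest digit, they would differ by less than [2 ^ (t - c)], whereas
    lacunarity makes them differ by at least [(q - 1) * 2 ^ t]. *)
Lemma top_bit_separated : exists c : nat, forall i j, (1 <= i < j)%N ->
  top_bit i = top_bit j ->
  exists p, [/\ (p < top_bit j)%N, (top_bit j <= p + c)%N & bit (m i) p != bit (m j) p].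
Proof.
have lt12 : (1 : R) < 2 by rewrite ltr1n.
have [c hc] := exists_expr_ge (q - 1)^-1 lt12.
exists c => i j /andP[i1 ij] tij.
set t := top_bit j in tij *; pose p0 := (t - c)%N.
have j1 : (1 <= j)%N by lia.
case: (boolP [forall p : 'I_t, (t <= p + c)%N ==> (bit (m i) p == bit (m j) p)]); last first.
  by move=> /forallPn[p]; rewrite negb_imply => /andP[h1 h2]; exists p; split.
move=> /forallP agree.
have eq_bits p : (p0 <= p)%N -> bit (m i) p = bit (m j) p.
  move=> p0p; have [pt|tp|->] := ltngtP p t.
  - have := agree (Ordinal pt); rewrite /= => /implyP h; apply/eqP; apply: h; rewrite /p0 in p0p; lia.
  - by rewrite !bit_above_top // tij.
  - have -> : bit (m i) t by rewrite -tij bit_top_bit.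
    by rewrite /t bit_top_bit.
have quot : (m i %/ 2 ^ p0 = m j %/ 2 ^ p0)%N.
  have lt_pow k : (k <= m i + m j)%N -> (k %/ 2 ^ p0 < 2 ^ (m i + m j))%N.
    move=> h; apply: leq_ltn_trans (leq_div _ _) _.
    by apply: leq_ltn_trans h _; exact: ltn_expl.
  apply: (@bit_inj (m i + m j)); try by apply: lt_pow; lia.
  by move=> r _; rewrite !bit_div; apply: eq_bits; lia.
have mij := m_mono i1 ij.
have close : (m j < m i + 2 ^ p0)%N.
  rewrite {1}(divn_eq (m j) (2 ^ p0)) -quot; apply: (@leq_trans (m i %/ 2 ^ p0 * 2 ^ p0 + 2 ^ p0)).
    by rewrite -addnS leq_add2l ltn_mod expn_gt0.
  by rewrite leq_add2r leq_divM.
have [ct|tc] := leqP c t; last first.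
  by move: close; rewrite /p0 (_ : (t - c = 0)%N) ?expn0; lia.
have /andP[hi _] := top_bitP i1; rewrite tij in hi.
have far : (m i)%:R * (q - 1) <= (m j)%:R - (m i)%:R :> R.
  have := m_lac_expr 1 i1; rewrite expr1 addn1 => h.
  have : (m i.+1)%:R <= (m j)%:R :> R.
    by rewrite ler_nat; move: ij; rewrite leq_eqVlt => /orP[/eqP<-//|h']; apply: ltnW; apply: m_mono.
  lra.
have close' : (m j)%:R - (m i)%:R < 2 ^+ p0 :> R.
  by rewrite -natrX ltrBlDl -natrD ltr_nat.
have : 2 ^+ p0 <= (m i)%:R * (q - 1).
  apply: (@le_trans _ _ (2 ^+ t * (q - 1))); last by rewrite ler_wpM2r ?(ltW q1') // -natrX ler_nat.
  rewrite -(subnK ct) -/p0 exprD -mulrA ler_peMr ?exprn_ge0 //.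
  by rewrite -ler_pdivrMr // div1r.
lra.
Qed.

End Lacunary.

(** * Taylor bounds *)

Section TaylorBounds.
Context {R : realType}.
Implicit Types (x v : R).

(** The mean value theorem. Applied repeatedly, it gives the Taylor bounds of the
    exponential, the sine and the cosine, each from the previous one. *)
Lemma bound_by_derivative (f df : R -> R) (M : R) (n : nat) :
  (forall x, is_derive x 1 f (df x)) -> f 0 = 0 -> 0 <= M ->
  (forall x, `|x| <= 1 -> `|df x| <= M * `|x| ^+ n) ->
  forall x, `|x| <= 1 -> `|f x| <= M * `|x| ^+ n.+1.
Proof.
move=> fd f0 M0 dfM x x1.
have fc : continuous f by move=> z; apply: differentiable_continuous; apply/derivable1_diffP; case: (fd z).
have key c : `|c| <= `|x| -> `|df c * x| <= M * `|x| ^+ n.+1.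
  move=> cx; rewrite normrM exprSr mulrA ler_wpM2r //.
  apply: le_trans (dfM _ (le_trans cx x1)) _.
  by rewrite ler_wpM2l // lerXn2r // nnegrE.
have [x0|x0|->] := ltgtP x 0.
- have [|c /andP[] ] := @MVT R f df x 0 x0 (fun z _ => fd z).
    by apply: continuous_subspaceT.
  rewrite !bnd_simp => xc c0; rewrite f0 !sub0r mulrN => /oppr_inj ->.
  by apply: key; rewrite !ltr0_norm ?lerN2 ?ltW.
- have [|c /andP[] ] := @MVT R f df 0 x x0 (fun z _ => fd z).
    by apply: continuous_subspaceT.
  rewrite !bnd_simp => c0 cx; rewrite f0 !subr0 => ->.
  by apply: key; rewrite !gtr0_norm ?ltW.
- by rewrite f0 normr0 mulr_ge0 // exprn_ge0.
Qed.

Lemma expR_le4 x : `|x| <= 1 -> `|expR x| <= 4.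
Proof.
move=> x1; rewrite ger0_norm ?expR_ge0 //.
have {}x1 : x <= 1 by apply: le_trans (ler_norm _) x1.
have h : expR (2^-1 : R) <= 2.
  have := expR_ge1Dx (- 2^-1 : R); rewrite expRN => h.
  rewrite -(invrK (expR _)) -[leRHS]invrK lef_pV2 ?posrE ?invr_gt0 ?expR_gt0 //.
  by apply: le_trans h; lra.
apply: (@le_trans _ _ (expR (2^-1 + 2^-1))); first by rewrite ler_expR; lra.
rewrite expRD; have := expR_gt0 (2^-1 : R); nra.
Qed.

Lemma expR_taylor1 x : `|x| <= 1 -> `|expR x - 1| <= 4 * `|x| ^+ 1.
Proof.
apply: (@bound_by_derivative (fun x => expR x - 1) expR) => //.
- by move=> z; apply: is_derive_eq; rewrite subr0.
- by rewrite expR0 subrr.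
- by move=> z z1; rewrite expr0 mulr1; exact: expR_le4.
Qed.

Lemma expR_taylor2 x : `|x| <= 1 -> `|expR x - 1 - x| <= 4 * `|x| ^+ 2.
Proof.
apply: (@bound_by_derivative (fun x => expR x - 1 - x) (fun x => expR x - 1)) => //.
- by move=> z; apply: is_derive_eq; rewrite subr0.
- by rewrite expR0 subrr subr0.
- exact: expR_taylor1.
Qed.

Lemma expR_taylor3 x : `|x| <= 1 -> `|expR x - 1 - x - x ^+ 2 / 2| <= 4 * `|x| ^+ 3.
Proof.
apply: (@bound_by_derivative (fun x => expR x - 1 - x - x ^+ 2 / 2) (fun x => expR x - 1 - x)) => //.
- by move=> z; apply: is_derive_eq; rewrite /GRing.scale /=; field.
- by rewrite expR0; field.
- exact: expR_taylor2.
Qed.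

Lemma expR_taylor6 x : `|x| <= 1 ->
  `|expR x - (1 + x + x ^+ 2 / 2 + x ^+ 3 / 6 + x ^+ 4 / 24 + x ^+ 5 / 120)| <= 4 * `|x| ^+ 6.
Proof.
apply: (@bound_by_derivative
  (fun x => expR x - (1 + x + x ^+ 2 / 2 + x ^+ 3 / 6 + x ^+ 4 / 24 + x ^+ 5 / 120))
  (fun x => expR x - (1 + x + x ^+ 2 / 2 + x ^+ 3 / 6 + x ^+ 4 / 24))) => //.
- by move=> z; apply: is_derive_eq; rewrite /GRing.scale /=; field.
- by rewrite expR0; field.
apply: (@bound_by_derivative
  (fun x => expR x - (1 + x + x ^+ 2 / 2 + x ^+ 3 / 6 + x ^+ 4 / 24))
  (fun x => expR x - (1 + x + x ^+ 2 / 2 + x ^+ 3 / 6))) => //.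
- by move=> z; apply: is_derive_eq; rewrite /GRing.scale /=; field.
- by rewrite expR0; field.
apply: (@bound_by_derivative
  (fun x => expR x - (1 + x + x ^+ 2 / 2 + x ^+ 3 / 6))
  (fun x => expR x - 1 - x - x ^+ 2 / 2)) => //.
- by move=> z; apply: is_derive_eq; rewrite /GRing.scale /=; field.
- by rewrite expR0; field.
exact: expR_taylor3.
Qed.

Lemma sin_taylor1 x : `|x| <= 1 -> `|sin x| <= 1 * `|x| ^+ 1.
Proof.
apply: (@bound_by_derivative sin cos) => //; first exact: sin0.
by move=> z _; rewrite expr0 mulr1 cos_max.
Qed.

Lemma cos_taylor2 x : `|x| <= 1 -> `|1 - cos x| <= 1 * `|x| ^+ 2.
Proof.
apply: (@bound_by_derivative (fun x => 1 - cos x) sin) => //.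
- by move=> z; apply: is_derive_eq; rewrite /GRing.scale /=; ring.
- by rewrite cos0 subrr.
- exact: sin_taylor1.
Qed.

Lemma sin_taylor3 x : `|x| <= 1 -> `|x - sin x| <= 1 * `|x| ^+ 3.
Proof.
apply: (@bound_by_derivative (fun x => x - sin x) (fun x => 1 - cos x)) => //.
by rewrite sin0 subrr.
exact: cos_taylor2.
Qed.

Lemma cos_taylor4 x : `|x| <= 1 -> `|cos x - 1 + x ^+ 2 / 2| <= 1 * `|x| ^+ 4.
Proof.
apply: (@bound_by_derivative (fun x => cos x - 1 + x ^+ 2 / 2) (fun x => x - sin x)) => //.
- by move=> z; apply: is_derive_eq; rewrite /GRing.scale /=; field.
- by rewrite cos0; field.
- exact: sin_taylor3.
Qed.

End TaylorBounds.

Section Hyper.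
Context {R : realType}.
Implicit Types (x v : R).

Definition cosh x : R := (expR x + expR (- x)) / 2.
Definition sinh x : R := (expR x - expR (- x)) / 2.
Definition tanh x : R := sinh x / cosh x.

Lemma cosh_ge1 x : 1 <= cosh x.
Proof.
rewrite /cosh expRN; have := expR_gt0 x; set e := expR x => e0.
rewrite ler_pdivlMr // mul1r -subr_ge0.
have -> : e + e^-1 - 2 = (e - 1) ^+ 2 / e by field; lra.
by rewrite divr_ge0 ?sqr_ge0 // ltW.
Qed.

Lemma cosh_gt0 x : 0 < cosh x. Proof. by apply: lt_le_trans (cosh_ge1 x). Qed.

Lemma tanh_taylor3 x : `|x| <= 1 -> `|tanh x - x| <= 9 * `|x| ^+ 3.
Proof.
move=> x1.
have e1 := expR_taylor3 x1; have e2 := @expR_taylor3 R (- x).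
rewrite normrN in e2; move/(_ x1): e2 => e2.
have -> : tanh x - x = (sinh x - x * cosh x) / cosh x.
  by rewrite /tanh; field; rewrite gt_eqF ?cosh_gt0.
rewrite normrM normfV (ger0_norm (ltW (cosh_gt0 x))).
rewrite ler_pdivrMr ?cosh_gt0 //.
apply: (@le_trans _ _ (9 * `|x| ^+ 3)); last first.
  by rewrite ler_peMr ?cosh_ge1 // mulr_ge0 // exprn_ge0.
rewrite /sinh /cosh; move: e1 e2.
set r1 := _ - _ - _ - _; set r2 := expR (- x) - _ - _ - _ => e1 e2.
have -> : (expR x - expR (- x)) / 2 - x * ((expR x + expR (- x)) / 2) =
  (r1 * (1 - x) - r2 * (1 + x) - x ^+ 3) / 2.
  by rewrite /r1 /r2; field.
rewrite normrM [X in _ * X]ger0_norm // ler_pdivrMr //.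
apply: le_trans (ler_normB _ _) _; apply: le_trans (lerD (ler_normB _ _) (lexx _)) _.
have h1 : `|1 - x| <= 2 by apply: le_trans (ler_normB _ _) _; rewrite normr1 -[leRHS]/(1 + 1) lerD2l.
have h2 : `|1 + x| <= 2 by apply: le_trans (ler_normD _ _) _; rewrite normr1 -[leRHS]/(1 + 1) lerD2l.
have m1 : `|r1 * (1 - x)| <= 4 * `|x| ^+ 3 * 2 by rewrite normrM ler_pM.
have m2 : `|r2 * (1 + x)| <= 4 * `|x| ^+ 3 * 2 by rewrite normrM ler_pM.
have x3 : 0 <= `|x| ^+ 3 by rewrite exprn_ge0.
rewrite normrX; lra.
Qed.

(** The error is relative to the Gaussian factor, as it must be to survive in a
    product of many factors. *)
Lemma cos_gauss_taylor x : `|x| <= 1 -> `|cos x * expR (x ^+ 2 / 2) - 1| <= 3 * `|x| ^+ 4.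
Proof.
move=> x1; set w := x ^+ 2 / 2.
have x4 : `|x| ^+ 4 = 4 * w ^+ 2.
  have -> : `|x| ^+ 4 = (x ^+ 2) ^+ 2 by rewrite -(real_normK (num_real x)) -exprM.
  by rewrite /w; field.
have w0 : 0 <= w by rewrite /w divr_ge0 // sqr_ge0.
have w1 : w <= 2^-1.
  rewrite /w ler_pdivrMr // mulVf // -(real_normK (num_real x)).
  by rewrite exprn_ile1.
have := cos_taylor4 x1; have := @expR_taylor2 R w.
rewrite (ger0_norm w0); have -> : w <= 1 by lra.
rewrite -/w x4 => /(_ isT).
set r := _ - _ - w; set s := _ - 1 + w => hr hs.
have -> : cos x * expR w - 1 = - w ^+ 2 + s * (1 + w) + cos x * r.
  by rewrite /r /s; ring.
apply: le_trans (ler_normD _ _) _; apply: le_trans (lerD (ler_normD _ _) (lexx _)) _.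
have m1 : `|s * (1 + w)| <= (4 * w ^+ 2) * (3 / 2).
  rewrite normrM ler_pM //; first by move: hs; rewrite mul1r.
  by rewrite ger0_norm; lra.
have m2 : `|cos x * r| <= 1 * (4 * w ^+ 2) by rewrite normrM ler_pM // cos_max.
have m3 : `|- w ^+ 2| = w ^+ 2 by rewrite normrN ger0_norm // sqr_ge0.
have := sqr_ge0 w; lra.
Qed.

Lemma sin_gauss_taylor x : `|x| <= 1 -> `|sin x * expR (x ^+ 2 / 2) - x| <= 6 * `|x| ^+ 3.
Proof.
move=> x1; set w := x ^+ 2 / 2.
have w2 : w = `|x| ^+ 2 / 2 by rewrite /w real_normK // num_real.
have w0 : 0 <= w by rewrite /w divr_ge0 // sqr_ge0.
have wabs : `|w| <= 1.
  rewrite (ger0_norm w0) w2; have := exprn_ile1 2 (normr_ge0 x) x1; lra.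
have := sin_taylor3 x1; have := expR_taylor1 wabs; have := expR_le4 wabs.
rewrite (ger0_norm w0) expr1 => h4 hr hs.
have -> : sin x * expR w - x = x * (expR w - 1) - (x - sin x) * expR w by ring.
apply: le_trans (ler_normB _ _) _.
have m1 : `|x * (expR w - 1)| <= `|x| * (4 * w) by rewrite normrM ler_wpM2l.
have m2 : `|(x - sin x) * expR w| <= (1 * `|x| ^+ 3) * 4 by rewrite normrM ler_pM.
have : `|x| * (4 * w) = 2 * `|x| ^+ 3 by rewrite w2; field.
lra.
Qed.

(** The expansion [ln (cosh x) = x^2/2 - x^4/12 + O(x^6)] in multiplicative
    form. *)
Lemma cosh_gauss_taylor x : `|x| <= 1 ->
  `|cosh x * expR (- (x ^+ 2 / 2 - x ^+ 4 / 12)) - 1| <= 60 * `|x| ^+ 6.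
Proof.
move=> x1; have e1 := expR_taylor6 x1; have e2 := @expR_taylor6 R (- x).
rewrite normrN in e2; move/(_ x1): e2 => e2.
have -> : cosh x = 1 + x ^+ 2 / 2 + x ^+ 4 / 24 + (cosh x - (1 + x ^+ 2 / 2 + x ^+ 4 / 24)) by ring.
have : `|cosh x - (1 + x ^+ 2 / 2 + x ^+ 4 / 24)| <= 4 * `|x| ^+ 6.
  move: e1 e2; set r1 := _ - _; set r2 := _ - (1 + - x + _ + _ + _ + _) => e1 e2.
  have -> : cosh x - (1 + x ^+ 2 / 2 + x ^+ 4 / 24) = (r1 + r2) / 2.
    by rewrite /r1 /r2 /cosh; field.
  rewrite normrM [X in _ * X]ger0_norm // ler_pdivrMr //.
  by apply: le_trans (ler_normD _ _) _; lra.
set r := cosh x - _ => hr.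
set w := x ^+ 2.
have wE : w = `|x| ^+ 2 by rewrite /w real_normK // num_real.
have w0 : 0 <= w by rewrite sqr_ge0.
have w1 : w <= 1 by rewrite wE exprn_ile1.
have x6 : `|x| ^+ 6 = w ^+ 3 by rewrite wE -exprM.
have -> : x ^+ 4 = w ^+ 2 by rewrite /w -exprM.
rewrite x6 in hr *.
pose D := w / 2 - w ^+ 2 / 12.
have D0 : 0 <= D by rewrite /D; nra.
have Dw : D <= w / 2 by rewrite /D; have := sqr_ge0 w; lra.
have := @expR_taylor3 R (- D); rewrite normrN (ger0_norm D0).
have -> : D <= 1 by lra.
move/(_ isT); set s := _ - _ - _ - _ => hs.
have {}hs : `|s| <= w ^+ 3 / 2.
  apply: le_trans hs _; have : D ^+ 3 <= (w / 2) ^+ 3 by rewrite lerXn2r // nnegrE //; lra.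
  by rewrite expr_div_n; lra.
rewrite -/D.
have -> : expR (- D) = 1 - D + D ^+ 2 / 2 + s by rewrite /s; field.
clearbody s r.
have w3 : 0 <= w ^+ 3 by rewrite exprn_ge0.
have eD : `|1 - D + D ^+ 2 / 2| <= 2.
  apply: le_trans (ler_normD _ _) _; rewrite (ger0_norm (_ : 0 <= D ^+ 2 / 2)); last by rewrite divr_ge0 // sqr_ge0.
  have : `|1 - D| <= 1 by rewrite ler_norml; lra.
  have : D ^+ 2 <= 1 by rewrite exprn_ile1 //; lra.
  lra.
(* The terms in [w] and [w ^+ 2] cancel. *)
have P1 : (1 + w / 2 + w ^+ 2 / 24) * (1 - D + D ^+ 2 / 2) - 1 =
   w ^+ 3 * (1 / 24 - 5 / 576 * w + w ^+ 3 / 6912).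
  by rewrite /D; field.
have -> : (1 + w / 2 + w ^+ 2 / 24 + r) * (1 - D + D ^+ 2 / 2 + s) - 1 =
  w ^+ 3 * (1 / 24 - 5 / 576 * w + w ^+ 3 / 6912) + (1 + w / 2 + w ^+ 2 / 24) * s
   + (r * (1 - D + D ^+ 2 / 2) + r * s).
  by rewrite -P1; ring.
have w3le1 : w ^+ 3 <= 1 by rewrite exprn_ile1.
have w2le1 : w ^+ 2 <= 1 by rewrite exprn_ile1.
have w20 : 0 <= w ^+ 2 by rewrite sqr_ge0.
have m1 : `|w ^+ 3 * (1 / 24 - 5 / 576 * w + w ^+ 3 / 6912)| <= w ^+ 3 * 1.
  rewrite normrM (ger0_norm w3) ler_wpM2l // ler_norml; lra.
have m2 : `|(1 + w / 2 + w ^+ 2 / 24) * s| <= 2 * (w ^+ 3 / 2).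
  rewrite normrM ler_pM // ger0_norm; lra.
have m3 : `|r * (1 - D + D ^+ 2 / 2)| <= 4 * w ^+ 3 * 2 by rewrite normrM ler_pM.
have m4 : `|r * s| <= 4 * w ^+ 3 * 1 by rewrite normrM ler_pM //; lra.
apply: le_trans (ler_normD _ _) _; apply: le_trans (lerD (ler_normD _ _) (ler_normD _ _)) _.
lra.
Qed.

End Hyper.

(** * Integrals by primitives and the Fejer kernel *)

Section FTC.
Context {R : realType}.
Notation mu := (@lebesgue_measure R).
Implicit Types (f F : R -> R).

Lemma derivable_continuous f : (forall x, derivable f x 1) -> continuous f.
Proof. by move=> df x; apply/differentiable_continuous/derivable1_diffP. Qed.

Lemma integral_segment_primitive f F (a b : R) : a < b ->
  (forall x : R, is_derive x 1 F (f x)) -> continuous f ->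
  (\int[mu]_(x in `[a, b]) (f x)%:E = (F b - F a)%:E)%E.
Proof.
move=> ab dF cf; rewrite EFinB.
have cF : continuous F by apply: derivable_continuous => x; case: (dF x).
apply: continuous_FTC2 => //.
- exact: continuous_subspaceT.
- split.
  + by move=> x _; case: (dF x).
  + exact/cvg_at_right_filter/cF.
  + exact/cvg_at_left_filter/cF.
- by move=> x _; rewrite derive1E; case: (dF x).
Qed.

Lemma integral_halfline_primitive f F (a l : R) :
  (forall x : R, is_derive x 1 F (f x)) -> continuous f ->
  (forall x, a <= x -> 0 <= f x) -> F x @[x --> +oo] --> l ->
  (\int[mu]_(x in `[a, +oo[) (f x)%:E = (l - F a)%:E)%E.
Proof.
move=> dF cf f0 Fl; rewrite EFinB.
have cF : continuous F by apply: derivable_continuous => x; case: (dF x).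
apply: ge0_continuous_FTC2y => //.
- exact: continuous_subspaceT.
- exact/cvg_at_right_filter/cF.
- by move=> x _; rewrite derive1E; case: (dF x).
Qed.

Lemma cvgy_le_inv F C : (forall x, 0 < x -> `|F x| <= C / x) -> F x @[x --> +oo] --> 0.
Proof.
move=> FC; apply/cvgr0Pnorm_le => e e0; near=> x.
have x0 : 0 < x by near: x; exact: nbhs_pinfty_gt.
have xC : C / e <= x by near: x; apply: nbhs_pinfty_ge; rewrite num_real.
by apply: le_trans (FC _ x0) _; rewrite ler_pdivrMr // mulrC -ler_pdivrMr.
Unshelve. all: by end_near. Qed.

(** From [expR (z / 2) >= 1 + z / 2]. *)
Lemma expRN_le (z : R) : 0 <= z -> expR (- z) <= ((1 + z / 2) ^+ 2)^-1.
Proof.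
move=> z0; rewrite expRN lef_pV2 ?posrE ?expR_gt0 ?exprn_gt0 //; last lra.
have -> : expR z = expR (z / 2) ^+ 2 by rewrite expr2 -expRD; congr expR; lra.
rewrite lerXn2r // ?nnegrE ?expR_ge0 ?expR_ge1Dx //; lra.
Qed.

Lemma expRN_le_inv (z : R) : 0 < z -> expR (- z) <= 1 / z.
Proof.
move=> z0; apply: le_trans (expRN_le (ltW z0)) _.
by rewrite div1r lef_pV2 ?posrE ?exprn_gt0 //; nra.
Qed.

Lemma expRN_le_inv2 (z : R) : 0 < z -> z * expR (- z) <= 4 / z.
Proof.
move=> z0; apply: (@le_trans _ _ (z * ((1 + z / 2) ^+ 2)^-1)).
  by apply: ler_wpM2l; [exact: ltW|apply: expRN_le; exact: ltW].
rewrite ler_pdivrMr ?exprn_gt0 //; last lra.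
rewrite mulrAC ler_pdivlMr //; nra.
Qed.

End FTC.

Section Fejer.
Context {R : realType}.
Notation mu := (@lebesgue_measure R).
Implicit Types (x v T : R).

(** The Fejer kernel; the value at 0 is the limit. It is nonnegative, has integral
    [pi] over the line, and its Fourier transform is a triangle function, so that
    averages against it only involve bounded frequencies. *)
Definition fejer x : R := if x == 0 then 2^-1 else (1 - cos x) / x ^+ 2.

Lemma fejer_mul_sqr x : fejer x * x ^+ 2 = 1 - cos x.
Proof.
rewrite /fejer; case: eqVneq => [->|x0]; first by rewrite expr0n mulr0 cos0 subrr.
by rewrite divfK // expf_neq0.
Qed.

Lemma fejer_ge0 x : 0 <= fejer x.
Proof.
rewrite /fejer; case: ifP => // _; rewrite ?invr_ge0 //.
by rewrite divr_ge0 ?sqr_ge0 // subr_ge0 cos_le1.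
Qed.

Lemma fejer_symm x : fejer (- x) = fejer x.
Proof. by rewrite /fejer oppr_eq0 cosN sqrrN. Qed.

(** With the next lemma, the two iterated integrals of
    [(1 - cos x) * (t * expR (- (t * x)))]. *)
Lemma integral_laplace_inv_sqr x : 0 < x ->
  (\int[mu]_(t in `[0%R, +oo[) (t * expR (- (t * x)))%:E = (x ^- 2)%:E)%E.
Proof.
move=> x0; have xn0 : x != 0 by rewrite gt_eqF.
pose F t := - (expR (- (t * x)) * (t / x + x ^- 2)).
transitivity (0 - F 0)%:E; last by
  rewrite /F mul0r oppr0 expR0 mul0r !add0r mul1r opprK.
apply: integral_halfline_primitive.
- move=> t; rewrite /F; apply: is_derive_eq; rewrite /GRing.scale /=; field; exact: xn0.
- by apply: derivable_continuous => t; exact: ex_derive.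
- by move=> t t0; rewrite mulr_ge0 // expR_ge0.
- apply: (@cvgy_le_inv _ _ (4 / x ^+ 3 + 1 / x ^+ 3)) => t t0.
  have tx : 0 < t * x by rewrite mulr_gt0.
  rewrite /F normrN ger0_norm ?mulr_ge0 ?expR_ge0 //; last first.
    by rewrite addr_ge0 // ?divr_ge0 ?invr_ge0 ?exprn_ge0 ?ltW.
  have -> : expR (- (t * x)) * (t / x + x ^- 2) = (t * x) * expR (- (t * x)) / x ^+ 2 + expR (- (t * x)) / x ^+ 2.
    by field.
  have -> : (4 / x ^+ 3 + 1 / x ^+ 3) / t = 4 / (t * x) / x ^+ 2 + 1 / (t * x) / x ^+ 2.
    by field; rewrite xn0 (gt_eqF t0).
  by apply: lerD; apply: ler_wpM2r; rewrite ?invr_ge0 ?sqr_ge0 // ?expRN_le_inv2 // expRN_le_inv.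
Qed.

Lemma integral_laplace_oneBcos t : 0 < t ->
  (\int[mu]_(x in `[0%R, +oo[) ((1 - cos x) * (t * expR (- (t * x))))%:E = ((1 + t ^+ 2)^-1)%:E)%E.
Proof.
move=> t0; have tn0 : 1 + t ^+ 2 != 0 by rewrite gt_eqF //; have := sqr_ge0 t; lra.
pose F x := expR (- (t * x)) * (t * (t * cos x - sin x) / (1 + t ^+ 2) - 1).
transitivity (0 - F 0)%:E; last first.
  by rewrite /F mulr0 oppr0 expR0 cos0 sin0; congr EFin; field.
apply: integral_halfline_primitive.
- move=> x; rewrite /F; apply: is_derive_eq; rewrite /GRing.scale /=; field.
  exact: tn0.
- by apply: derivable_continuous => x; exact: ex_derive.
- by move=> x _; apply: mulr_ge0; [rewrite subr_ge0 cos_le1|exact: mulr_ge0 (ltW t0) (expR_ge0 _)].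
apply: (@cvgy_le_inv _ _ ((t * (t + 1) / (1 + t ^+ 2) + 1) / t)) => x x0.
have tx : 0 < t * x by rewrite mulr_gt0.
have t21 : 0 < 1 + t ^+ 2 by have := sqr_ge0 t; lra.
have -> : (t * (t + 1) / (1 + t ^+ 2) + 1) / t / x = 1 / (t * x) * (t * (t + 1) / (1 + t ^+ 2) + 1).
  by field; rewrite tn0 !gt_eqF.
rewrite normrM; apply: ler_pM => //.
  by rewrite ger0_norm ?expR_ge0 // expRN_le_inv.
apply: le_trans (ler_normB _ _) _; rewrite normr1 lerD2r.
rewrite !normrM normfV (gtr0_norm t0) (gtr0_norm t21).
apply: ler_wpM2r; first by rewrite invr_ge0 ltW.
apply: ler_wpM2l; first exact: ltW.
apply: le_trans (ler_normB _ _) _; rewrite normrM (gtr0_norm t0).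
apply: lerD (sin_max _); rewrite -[leRHS]mulr1; apply: ler_wpM2l (cos_max _); exact: ltW.
Qed.

Lemma integral_oneDsqr : (\int[mu]_(t in `[0%R, +oo[) ((1 + t ^+ 2)^-1)%:E = (pi / 2)%:E)%E.
Proof.
transitivity (pi / 2 - @atan R 0)%:E; last by rewrite atan0 subr0.
apply: (@integral_halfline_primitive _ _ atan).
- apply: derivable_continuous => x; apply: derivableV; last exact: ex_derive.
  by rewrite gt_eqF //; have := sqr_ge0 x; lra.
- by move=> x _; rewrite invr_ge0; have := sqr_ge0 x; lra.
- exact: cvgy_atan.
Qed.

End Fejer.

Section FejerTransform.
Context {R : realType}.
Notation mu := (@lebesgue_measure R).
Implicit Types (x v T : R).

(** An explicit primitive; the case [x = 0] has its own. *)
Lemma fejer_cos_transform T x : 0 < T ->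
  (\int[mu]_(u in `[0%R, T]) ((1 - u / T) * cos (u * x))%:E = (T * fejer (T * x))%:E)%E.
Proof.
move=> T0; have Tn0 : T != 0 by rewrite gt_eqF.
have cf : continuous (fun u : R => (1 - u / T) * cos (u * x)).
  by apply: derivable_continuous => u; exact: ex_derive.
have [->|x0] := eqVneq x 0.
  pose F (u : R) := u - u ^+ 2 / (2 * T).
  transitivity (F T - F 0)%:E; last first.
    by rewrite /F /fejer mulr0 eqxx; congr EFin; field; exact: Tn0.
  under eq_integral do rewrite mulr0 cos0 mulr1.
  apply: integral_segment_primitive => //.
    move=> u; rewrite /F; apply: is_derive_eq; rewrite /GRing.scale /=; field; exact: Tn0.
  by apply: derivable_continuous => u; exact: ex_derive.
pose F (u : R) := (1 - u / T) * (sin (u * x) / x) - cos (u * x) / (T * x ^+ 2).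
transitivity (F T - F 0)%:E; last first.
  rewrite /F /fejer mulf_eq0 (negbTE Tn0) (negbTE x0) /= !mul0r sin0 cos0.
  by congr EFin; field; rewrite Tn0 x0.
apply: integral_segment_primitive => //.
by move=> u; rewrite /F; apply: is_derive_eq; rewrite /GRing.scale /=; field; rewrite x0 Tn0.
Qed.

Lemma fejer_continuous : continuous (@fejer R).
Proof.
move=> x; have [->|x0] := eqVneq x 0; last first.
  have : {for x, continuous (fun z : R => (1 - cos z) / z ^+ 2)}.
    apply: differentiable_continuous; apply/derivable1_diffP.
    apply: derivableM; first exact: ex_derive.
    by apply: derivableV; [rewrite expf_neq0|exact: ex_derive].
  move=> h; rewrite /prop_for /continuous_at [fejer x]/fejer (negbTE x0).
  apply: cvg_trans h; apply: near_eq_cvg.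
  near=> z; rewrite /fejer ifF //; apply/negbTE.
  by near: z; apply: (@open_in_nearW _ _ [set z : R | z != 0]); [exact: open_neq|move=> ? /set_mem|exact/mem_set].
rewrite /prop_for /continuous_at; apply/cvgrPdist_le => e e0; near=> z.
rewrite {1}/fejer eqxx.
have [->|z0] := eqVneq z 0; first by rewrite /fejer eqxx subrr normr0 ltW.
have z1 : `|z| <= 1.
  by near: z; apply/nbhs_normP; exists 1 => //= z /=; rewrite sub0r normrN => /ltW.
have ze : `|z| <= e.
  by near: z; apply/nbhs_normP; exists e => //= z /=; rewrite sub0r normrN => /ltW.
have -> : 2^-1 - fejer z = (cos z - 1 + z ^+ 2 / 2) / z ^+ 2.
  by rewrite /fejer (negbTE z0); field.
rewrite normrM normfV normrX ler_pdivrMr ?exprn_gt0 ?normr_gt0 //.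
apply: le_trans (cos_taylor4 z1) _; rewrite mul1r.
have -> : `|z| ^+ 4 = `|z| ^+ 2 * `|z| ^+ 2 by ring.
by rewrite ler_wpM2r ?exprn_ge0 // -[e]mul1r expr2 ler_pM.
Unshelve. all: by end_near. Qed.

Lemma measurable_EFin_continuous (f : R -> R) (D : set R) : continuous f ->
  measurable_fun D (fun x => (f x)%:E).
Proof.
by move=> cf; apply/measurable_funTS/measurable_EFinP; exact: continuous_measurable_fun.
Qed.

Local Notation RR := (measurableTypeR R).

Lemma measurable_comp_fst (h : RR -> R) : measurable_fun setT h ->
  measurable_fun setT (fun z : RR * RR => h z.1).
Proof.
by move=> mh; apply: (@measurableT_comp _ _ _ _ _ _ h _ fst mh); exact: measurable_fst.
Qed.

Lemma measurable_comp_snd (h : RR -> R) : measurable_fun setT h ->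
  measurable_fun setT (fun z : RR * RR => h z.2).
Proof.
by move=> mh; apply: (@measurableT_comp _ _ _ _ _ _ h _ snd mh); exact: measurable_snd.
Qed.

Lemma measurable_laplace_kernel (D : set R) : measurable D ->
  measurable_fun setT (fun z : RR * RR =>
    (\1_D z.1 * (\1_D z.2 * ((1 - cos z.1) * (z.2 * expR (- (z.2 * z.1))))))%:E).
Proof.
move=> mD; apply/measurable_EFinP; apply: measurable_funM.
  by apply: measurable_comp_fst; exact: measurable_indic.
apply: measurable_funM.
  by apply: measurable_comp_snd; exact: measurable_indic.
apply: measurable_funM.
  apply: (@measurable_comp_fst (fun x => 1 - cos x)).
  by apply: continuous_measurable_fun; apply: derivable_continuous => x; exact: ex_derive.
apply: measurable_funM; first exact: measurable_snd.
apply: (@measurableT_comp _ _ _ _ _ _ (expR : RR -> R)); first exact: measurable_expR.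
by apply: measurableT_comp => //; apply: measurable_funM; [exact: measurable_snd|exact: measurable_fst].
Qed.

(** Tonelli for [(1 - cos x) * (t * expR (- (t * x)))] on the quadrant: integrating
    in [t] first gives the kernel, integrating in [x] first gives
    [1 / (1 + t^2)]. *)
Lemma integral_fejer_halfline :
  (\int[mu]_(x in `[0%R, +oo[) (fejer x)%:E = (pi / 2)%:E)%E.
Proof.
pose D : set R := [set` `]0%R, +oo[].
have mD : measurable D by exact: measurable_itv.
pose g x t : R := (1 - cos x) * (t * expR (- (t * x))).
have g0 x t : 0 < t -> 0 <= g x t.
  move=> t0; apply: mulr_ge0; first by rewrite subr_ge0 cos_le1.
  exact: mulr_ge0 (ltW t0) (expR_ge0 _).
pose f (z : RR * RR) := (\1_D z.1 * (\1_D z.2 * g z.1 z.2))%:E.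
have f0 z : (0 <= f z)%E.
  rewrite /f lee_fin mulr_ge0 // /indic.
  have [|] := boolP (z.2 \in D); last by rewrite mul0r.
  by rewrite mul1r inE /D /= in_itv /= andbT => /g0.
have fE x t : f (x, t) = (\1_D x * (\1_D t * g x t))%:E by [].
have fubini : (\int[mu]_x \int[mu]_t f (x, t) = \int[mu]_t \int[mu]_x f (x, t))%E.
  exact: (fubini_tonelli f (measurable_laplace_kernel mD) f0).
have inD z : z \in D = (0 < z) by rewrite mem_setE in_itv /= andbT.
have inner1 x : (\int[mu]_t f (x, t) = ((fun x => (fejer x)%:E) \_ D) x)%E.
  rewrite patchE inD; case: ifP => x0; last first.
    by apply: integral0_eq => t _; rewrite fE indicE inD x0 mul0r.
  transitivity (\int[mu]_(t in D) ((1 - cos x)%:E * (t * expR (- (t * x)))%:E))%E.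
    rewrite [RHS]integral_mkcond; apply: eq_integral => t _.
    by rewrite fE !indicE !inD x0 mul1r patchE inD; case: ifP; rewrite ?mul1r ?mul0r.
  rewrite integral_itv_obnd_cbnd; last first.
    apply: measurable_funeM; apply: measurable_EFin_continuous.
    by apply: derivable_continuous => t; exact: ex_derive.
  transitivity ((1 - cos x)%:E * (x ^- 2)%:E)%E; last by rewrite /fejer gt_eqF.
  rewrite -(integral_laplace_inv_sqr x0); apply: ge0_integralZl_EFin.
  - exact: measurable_itv.
  - move=> t; rewrite /= in_itv /= andbT => t0.
    by rewrite lee_fin mulr_ge0 // expR_ge0.
  - apply: measurable_EFin_continuous.
    by apply: derivable_continuous => t; exact: ex_derive.
  - by rewrite subr_ge0 cos_le1.
have inner2 t : (\int[mu]_x f (x, t) = ((fun t => ((1 + t ^+ 2)^-1)%:E) \_ D) t)%E.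
  rewrite patchE inD; case: ifP => t0; last first.
    by apply: integral0_eq => x _; rewrite fE !indicE !inD t0 mul0r mulr0.
  rewrite -(integral_laplace_oneBcos t0) -integral_itv_obnd_cbnd; last first.
    apply: measurable_EFin_continuous.
    by apply: derivable_continuous => x; exact: ex_derive.
  rewrite [RHS]integral_mkcond; apply: eq_integral => x _.
  by rewrite fE !indicE !inD t0 mul1r patchE inD; case: ifP; rewrite ?mul1r ?mul0r.
move: fubini.
under eq_integral do rewrite inner1.
under [in X in _ = X -> _]eq_integral do rewrite inner2.
rewrite -!integral_mkcond !integral_itv_obnd_cbnd.
- by rewrite integral_oneDsqr.
- apply: measurable_EFin_continuous.
  apply: derivable_continuous => x; apply: derivableV; last exact: ex_derive.
  by rewrite gt_eqF //; have := sqr_ge0 x; lra.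
- by apply: measurable_EFin_continuous; exact: fejer_continuous.
Qed.

End FejerTransform.

(** * The Gaussian window *)

Section GaussianWindow.
Context {R : realType}.
Notation mu := (@lebesgue_measure R).
Variables (A : R).
Hypothesis A0 : 0 < A.
Implicit Types (u T : R).

(** The characteristic function of the normal law of variance [A ^+ 2], multiplied
    by [A] so that its integral does not depend on [A]. *)
Definition gauss_window u : R := A * expR (- (u ^+ 2 * A ^+ 2 / 2)).

Lemma gauss_window_ge0 u : 0 <= gauss_window u.
Proof. by rewrite mulr_ge0 ?expR_ge0 // ltW. Qed.

Lemma gauss_window_continuous : continuous gauss_window.
Proof. by apply: derivable_continuous => u; exact: ex_derive. Qed.

Let sqrt2_gt0 : 0 < Num.sqrt 2 :> R. Proof. by rewrite sqrtr_gt0. Qed.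

Lemma integral_gauss_window :
  (\int[mu]_(u in `[0%R, +oo[) (gauss_window u)%:E = (Num.sqrt (pi / 2))%:E)%E.
Proof.
pose c := A / Num.sqrt 2.
have c0 : 0 < c by rewrite divr_gt0.
have c2 : c ^+ 2 = A ^+ 2 / 2 by rewrite expr_div_n sqr_sqrtr.
pose F u : R := c * u.
have dF (u : R) : is_derive u 1 F c by rewrite /F; apply: is_derive_eq; rewrite /GRing.scale /= mulr1.
have F'E : derive1 F = cst c by apply/funext => u; rewrite derive1E; case: (dF u).
have cF : continuous F by apply: derivable_continuous => u; case: (dF u).
have := @increasing_ge0_integration_by_substitutiony R F (@gauss_fun R) 0.
have F0 : F 0 = 0 by rewrite /F mulr0.
rewrite F'E F0 integral0y_gauss => /(_ _ _ _ _ _ _ _ _) h.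
have {h} : ((Num.sqrt pi / 2)%:E = \int[mu]_(x in `[0%R, +oo[) (((@gauss_fun R \o F) * cst c) x)%:E)%E.
  apply: h.
  - by move=> x z _ _ xz; rewrite /F ltr_pM2l.
  - by move=> x _; exact: cst_continuous.
  - by apply: cvgP; exact: cvg_cst.
  - by apply: cvgP; exact: cvg_cst.
  - split; first by move=> x _; case: (dF x).
    exact/cvg_at_right_filter/cF.
  - rewrite /F; exact: gt0_cvgMry.
  - by apply: continuous_subspaceT; exact: continuous_gauss_fun.
  - by move=> x _; exact: gauss_fun_ge0.
move=> e.
have -> : (Num.sqrt (pi / 2))%:E = ((Num.sqrt 2)%:E * (Num.sqrt pi / 2)%:E)%E :> \bar R.
  rewrite -EFinM; congr EFin.
  rewrite sqrtrM ?pi_ge0 // sqrtrV //.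
  have h : Num.sqrt 2 * Num.sqrt 2 = 2 :> R by rewrite -expr2 sqr_sqrtr.
  by apply: (mulIf (lt0r_neq0 sqrt2_gt0)); rewrite divfK ?lt0r_neq0 //; rewrite mulrAC h; field.
rewrite e -ge0_integralZl_EFin //; last 2 first.
- by move=> u _; rewrite lee_fin mulr_ge0 ?gauss_fun_ge0 // ltW.
- apply: measurable_EFin_continuous => u; apply: cvgM; last exact: cvg_cst.
  by apply: continuous_comp; [exact: cF|exact: continuous_gauss_fun].
apply: eq_integral => u _; rewrite -EFinM; congr EFin.
change (A * expR (- (u ^+ 2 * A ^+ 2 / 2)) = Num.sqrt 2 * (expR (- (c * u) ^+ 2) * c)).
have -> : (c * u) ^+ 2 = u ^+ 2 * A ^+ 2 / 2 by rewrite exprMn c2; ring.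
have sc : Num.sqrt 2 * c = A by rewrite /c [LHS]mulrC divfK // lt0r_neq0.
by rewrite [RHS]mulrCA sc [RHS]mulrC.
Qed.

Lemma integral_id_gauss_window :
  (\int[mu]_(u in `[0%R, +oo[) (u * gauss_window u)%:E = (A^-1)%:E)%E.
Proof.
pose F u := - (expR (- (u ^+ 2 * A ^+ 2 / 2)) / A).
have An0 : A != 0 by rewrite gt_eqF.
transitivity (0 - F 0)%:E; last by rewrite /F expr0n !mul0r oppr0 expR0 mul1r sub0r opprK.
apply: integral_halfline_primitive.
- move=> u; rewrite /F /gauss_window; apply: is_derive_eq; rewrite /GRing.scale /=; field.
  exact: An0.
- by apply: derivable_continuous => u; exact: ex_derive.
- by move=> u u0; rewrite mulr_ge0 ?gauss_window_ge0.
apply: (@cvgy_le_inv _ _ (A ^- 2)) => u u0.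
rewrite /F normrN normrM normfV (gtr0_norm A0) ger0_norm ?expR_ge0 //.
set z := _ / 2.
have z0 : 0 <= z by rewrite divr_ge0 // mulr_ge0 ?sqr_ge0.
have h : expR (- z) <= (u * A)^-1.
  rewrite expRN lef_pV2 ?posrE ?expR_gt0 ?mulr_gt0 //.
  apply: le_trans (expR_ge1Dx _); rewrite /z -exprMn.
  have := sqr_ge0 (u * A - 1); nra.
have -> : A ^- 2 / u = (u * A)^-1 / A by field; rewrite An0 gt_eqF.
by rewrite ler_wpM2r // invr_ge0 ltW.
Qed.

End GaussianWindow.

Section FejerAverage.
Context {R : realType}.
Notation mu := (@lebesgue_measure R).

Lemma integrable_segment (f : R -> R) (a b : R) : continuous f ->
  mu.-integrable `[a, b] (EFin \o f).
Proof.
move=> cf; apply: continuous_compact_integrable; first exact: segment_compact.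
exact: continuous_subspaceT.
Qed.

Lemma integrable_halfline (f : R -> R) (a l : R) : continuous f ->
  (forall u, a <= u -> 0 <= f u) ->
  (\int[mu]_(u in `[a, +oo[) (f u)%:E = l%:E)%E ->
  mu.-integrable `[a, +oo[ (EFin \o f).
Proof.
move=> cf f0 fl; apply/integrableP; split.
  exact: measurable_EFin_continuous.
rewrite (_ : (\int[mu]_(x in _) _)%E = l%:E) ?ltry // -fl.
apply: eq_integral => u; rewrite inE /= in_itv /= andbT => /f0 fu.
by rewrite ger0_norm.
Qed.

Variables (A T : R).
Hypotheses (A0 : 0 < A) (T0 : 0 < T).
Local Notation G := (gauss_window A).

Let G0 u : 0 <= G u. Proof. exact: gauss_window_ge0. Qed.
Let cG : continuous G. Proof. exact: gauss_window_continuous. Qed.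
Let cuG : continuous (fun u : R => u * G u).
Proof. by apply: derivable_continuous => u; rewrite /gauss_window; exact: ex_derive. Qed.

Let iG : mu.-integrable `[0, +oo[ (EFin \o G).
Proof. by apply: integrable_halfline (integral_gauss_window A0). Qed.

Let iuG : mu.-integrable `[0, +oo[ (EFin \o (fun u => u * G u)).
Proof.
apply: integrable_halfline (integral_id_gauss_window A0) => // u u0.
exact: mulr_ge0.
Qed.

(** The window [G] lives at the scale [1 / A]: the integral of [u * G u] is
    [A^-1]. Hence an error [k * u], relative to [G], costs only [k / A], and the
    same first moment bounds what the factor [1 - u / T] and the truncation at [T]
    change. *)
Lemma fejer_average_estimate (Psi : R -> R) (k r : R) : continuous Psi ->
  0 <= k -> 0 <= r ->
  (forall u, 0 <= u <= T -> `|Psi u - G u| <= G u * (k * u + r)) ->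
  `|\int[mu]_(u in `[0, T]) ((1 - u / T) * Psi u) - Num.sqrt (pi / 2)| <=
    r * Num.sqrt (pi / 2) + (k + T^-1) / A.
Proof.
move=> cPsi k0 r0 PsiG.
set X := (\int[mu]_(u in _) _).
pose I0 := \int[mu]_(u in `[0, T]) G u.
pose I1 := \int[mu]_(u in `[0, T]) (u * G u).
pose J0 := \int[mu]_(u in `]T, +oo[) G u.
pose J1 := \int[mu]_(u in `]T, +oo[) (u * G u).
have TT : (BRight T <= +oo%O)%O by [].
have T0' : (BLeft 0 <= BRight T :> itv_bound R)%O by rewrite bnd_simp ltW.
have IJ0 : Num.sqrt (pi / 2) - I0 = J0.
  by rewrite /J0 -(Rintegral_itvB iG T0' TT) [in RHS]/Rintegral integral_gauss_window.
have IJ1 : A^-1 - I1 = J1.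
  by rewrite /J1 -(Rintegral_itvB iuG T0' TT) [in RHS]/Rintegral integral_id_gauss_window.
have sub : ([set` `]T, +oo[] : set R) `<=` [set` `[0, +oo[].
  by move=> u /=; rewrite !in_itv /= !andbT => Tu; exact: le_trans (ltW T0) (ltW Tu).
have iG' : mu.-integrable `]T, +oo[ (EFin \o G) by apply: integrableS iG.
have iuG' : mu.-integrable `]T, +oo[ (EFin \o (fun u => u * G u)) by apply: integrableS iuG.
(* Beyond [T] the first moment dominates [T] times the mass. *)
have J01 : J0 <= T^-1 * J1.
  rewrite /J1 -RintegralZl //; apply: le_Rintegral => //.
    by apply: (@eq_integrable _ _ _ mu _ _ (fun u => (T^-1)%:E * (u * G u)%:E)%E) => //; apply: integrableZl.
  move=> u /=; rewrite in_itv /= andbT => Tu.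
  by rewrite mulrA ler_peMl // mulrC ler_pdivlMr // mul1r ltW.
have J1_ge0 : 0 <= J1.
  apply: Rintegral_ge0 => u /=; rewrite in_itv /= andbT => Tu.
  by rewrite mulr_ge0 // ltW // (lt_trans T0).
have J0_ge0 : 0 <= J0 by apply: Rintegral_ge0.
have I1_ge0 : 0 <= I1.
  by apply: Rintegral_ge0 => u /=; rewrite in_itv /= => /andP[u0 _]; rewrite mulr_ge0.
have I0_ge0 : 0 <= I0 by apply: Rintegral_ge0.
have lin a b : \int[mu]_(u in `[0, T]) (a * G u + b * (u * G u)) = a * I0 + b * I1.
  rewrite RintegralD //; try by apply: integrable_segment => u; apply: cvgM; [exact: cvg_cst|exact: cG || exact: cuG].
  by congr (_ + _); apply: RintegralZl => //; apply: integrable_segment.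
have ilin a b : mu.-integrable `[0, T] (EFin \o (fun u => a * G u + b * (u * G u))).
  by apply: integrable_segment => u; apply: cvgD; apply: cvgM; try exact: cvg_cst; [exact: cG|exact: cuG].
have iX : mu.-integrable `[0, T] (EFin \o (fun u => (1 - u / T) * Psi u)).
  apply: integrable_segment => u; apply: cvgM; last exact: cPsi.
  have : continuous (fun u : R => 1 - u / T) by apply: derivable_continuous => ?; exact: ex_derive.
  exact.
have key u : 0 <= u <= T -> (1 - r) * G u + (- (k + T^-1)) * (u * G u) <= (1 - u / T) * Psi u
    <= (1 + r) * G u + k * (u * G u).
  move=> uT; have /andP[u0 u1] := uT.
  have := PsiG _ uT; rewrite ler_norml => /andP[h1 h2].
  have t0 : 0 <= u / T by rewrite divr_ge0 // ltW.
  have t1 : 0 <= 1 - u / T by rewrite subr_ge0 ler_pdivrMr // mul1r.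
  have g := G0 u; set t := u / T in t0 t1 *.
  have kr : 0 <= G u * (k * u + r) by rewrite mulr_ge0 // addr_ge0 // mulr_ge0.
  apply/andP; split.
    have e : (1 - r) * G u + - (k + T^-1) * (u * G u) = G u - t * G u - G u * (k * u + r).
      by rewrite /t; ring.
    rewrite e; apply: (@le_trans _ _ ((1 - t) * (G u - G u * (k * u + r)))); last by rewrite ler_wpM2l //; lra.
    nra.
  have e : (1 + r) * G u + k * (u * G u) = G u + G u * (k * u + r) by ring.
  rewrite e; apply: (@le_trans _ _ ((1 - t) * (G u + G u * (k * u + r)))); first by rewrite ler_wpM2l //; lra.
  nra.
have lo : (1 - r) * I0 + (- (k + T^-1)) * I1 <= X.
  rewrite -lin; apply: le_Rintegral => // u /=; rewrite in_itv /= => uT.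
  by case/andP: (key _ uT).
have hi : X <= (1 + r) * I0 + k * I1.
  rewrite -lin; apply: le_Rintegral => // u /=; rewrite in_itv /= => uT.
  by case/andP: (key _ uT).
have Ti : 0 < T^-1 by rewrite invr_gt0.
set s := Num.sqrt _ in IJ0 *.
have -> : (k + T^-1) / A = (k + T^-1) * (I1 + J1) by rewrite -IJ1; ring.
have p1 : 0 <= k * J1 by rewrite mulr_ge0.
have p2 : 0 <= r * J0 by rewrite mulr_ge0.
have p3 : 0 <= T^-1 * I1 by rewrite mulr_ge0 // ltW.
have p4 : 0 <= T^-1 * J1 by rewrite mulr_ge0 // ltW.
have sE : s = I0 + J0 by rewrite -IJ0; ring.
rewrite sE ler_norml; apply/andP; split; lra.
Qed.

End FejerAverage.

(** * Smoothing the one-sided exponential *)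

Section FejerMass.
Context {R : realType}.
Notation mu := (@lebesgue_measure R).
Implicit Types (x T s c d : R).

Lemma fejer_le2 x : fejer x <= 2.
Proof.
have [x1|x1] := leP `|x| 1.
  rewrite /fejer; case: eqVneq => [_|x0]; first lra.
  rewrite ler_pdivrMr ?exprn_even_gt0 //.
  have := cos_taylor2 x1; rewrite mul1r real_normK ?num_real // => h.
  by apply: le_trans (ler_norm _) _; have := sqr_ge0 x; lra.
have x0 : x != 0 by rewrite -normr_gt0 (lt_trans ltr01).
rewrite /fejer (negbTE x0) ler_pdivrMr ?exprn_even_gt0 //.
rewrite -(real_normK (num_real x)).
have : 1 <= `|x| ^+ 2 by rewrite exprn_ege1 // ltW.
have := cos_geN1 x; lra.
Qed.

Lemma oneBcos_le x : `|cos x - 1| <= 2 * `|x|.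
Proof.
rewrite distrC; have [x1|x1] := leP `|x| 1.
  apply: le_trans (cos_taylor2 x1) _; rewrite mul1r expr2.
  by rewrite ler_wpM2r //; lra.
apply: le_trans (ler_normB _ _) _; rewrite normr1; have := cos_max x; lra.
Qed.

Definition fejer_mass B : R := \int[mu]_(x in `[- B, B]) fejer x.

Lemma Rintegral_fejer_half B : 0 <= B ->
  \int[mu]_(x in `[- B, 0]) fejer x = \int[mu]_(x in `[0, B]) fejer x.
Proof.
move=> B0; rewrite /Rintegral; congr fine.
have := @integration_by_substitution_oppr R (@fejer R) 0 B B0.
rewrite oppr0 => ->; last by apply: continuous_subspaceT; exact: fejer_continuous.
by apply: eq_integral => x _; rewrite /= fejer_symm.
Qed.

Lemma fejer_massE B : 0 <= B -> fejer_mass B = 2 * \int[mu]_(x in `[0, B]) fejer x.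
Proof.
move=> B0; rewrite /fejer_mass.
have ifj : mu.-integrable `[- B, B] (EFin \o @fejer R).
  by apply: integrable_segment; exact: fejer_continuous.
have h1 : (BLeft (- B) <= BRight 0 :> itv_bound R)%O by rewrite bnd_simp lerNl oppr0.
have h2 : (BRight 0 <= BRight B :> itv_bound R)%O by rewrite bnd_simp.
have := Rintegral_itvB ifj h1 h2.
rewrite (Rintegral_fejer_half B0) Rintegral_itv_obnd_cbnd; last first.
  apply: integrableS ifj => //= x /=; rewrite !in_itv /= => /andP[x0 ->]; rewrite andbT.
  by apply: le_trans (ltW x0); rewrite lerNl oppr0.
by move=> h; rewrite mulr_natl mulr2n -{2}h addrC subrK.
Qed.

Lemma fejer_mass_le_pi B : 0 <= B -> fejer_mass B <= pi.
Proof.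
move=> B0; rewrite fejer_massE // -ler_pdivlMl // mulrC -lee_fin.
rewrite -integral_fejer_halfline fineK; last first.
  apply: integrable_fin_num => //; apply: integrable_segment; exact: fejer_continuous.
apply: ge0_subset_integral => //.
- by apply: measurable_EFin_continuous; exact: fejer_continuous.
- by move=> x _; rewrite lee_fin fejer_ge0.
- by move=> x /=; rewrite !in_itv /= => /andP[->].
Qed.

Lemma fejer_mass_near_pi (e : R) : 0 < e -> \forall B \near +oo, pi - e <= fejer_mass B.
Proof.
move=> e0.
have aux (p a b : R) : p / 2 - e / 2 < a -> a <= b -> p - e <= 2 * b by lra.
have := @ge0_cvgn_integral R mu (@fejer R) (@fejer_ge0 R) (continuous_measurable_fun (@fejer_continuous R)).
rewrite integral_fejer_halfline => /fine_cvgP[_] h.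
have lt : pi / 2 - e / 2 < pi / 2 :> R by lra.
have [N _ hN] := cvgr_gt _ h _ lt.
near=> B.
have NB : N%:R <= B by near: B; apply: nbhs_pinfty_ge; rewrite num_real.
have B0 : 0 <= B by apply: le_trans NB.
rewrite fejer_massE //.
have hN' : pi / 2 - e / 2 < \int[mu]_(x in `[0, N%:R]) fejer x by apply: (hN N) => /=.
apply: aux hN' _.
have ifj b : mu.-integrable `[0, b] (EFin \o @fejer R).
  by apply: integrable_segment; exact: fejer_continuous.
rewrite /Rintegral fine_le //; try exact: integrable_fin_num.
apply: ge0_subset_integral => //.
- by apply: measurable_EFin_continuous; exact: fejer_continuous.
- by move=> x _; rewrite lee_fin fejer_ge0.
- by move=> x /=; rewrite !in_itv /= => /andP[-> xN]; exact: le_trans NB.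
Unshelve. all: by end_near. Qed.

Lemma fejer_mass_shift T c d : 0 < T -> 0 <= d ->
  \int[mu]_(s in `[c - d, c + d]) (T * fejer (T * (c - s))) = fejer_mass (d * T).
Proof.
move=> T0 d0; rewrite /fejer_mass /Rintegral; congr fine.
pose F s := T * (c - s).
have dF (s : R) : is_derive s 1 F (- T).
  by rewrite /F; apply: is_derive_eq; rewrite /GRing.scale /=; ring.
have F'E : derive1 F = cst (- T) by apply/funext => s; rewrite derive1E; case: (dF s).
have cF : continuous F by apply: derivable_continuous => s; case: (dF s).
have le : c - d <= c + d by lra.
have := @integration_by_substitution_decreasing R F (@fejer R) _ _ le.
rewrite F'E.
have -> : F (c + d) = - (d * T) by rewrite /F; ring.
have -> : F (c - d) = d * T by rewrite /F; ring.
move=> h; rewrite h; last 6 first.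
- by move=> s t _ _ st; rewrite /F ltr_pM2l //; lra.
- by move=> s _; exact: cst_continuous.
- by apply: cvgP; exact: cvg_cst.
- by apply: cvgP; exact: cvg_cst.
- split; first by move=> s _; case: (dF s).
    exact/cvg_at_right_filter/cF.
  exact/cvg_at_left_filter/cF.
- by apply: continuous_subspaceT; exact: fejer_continuous.
apply: eq_integral => s _; congr EFin.
change (T * fejer (T * (c - s)) = fejer (T * (c - s)) * - - T); rewrite opprK; ring.
Qed.

End FejerMass.

Section ExponentialSmoothing.
Context {R : realType}.
Notation mu := (@lebesgue_measure R).
Variable y : R.
Hypothesis y0 : 0 < y.
Implicit Types (x z T s d : R).

Lemma integral_expRN : (\int[mu]_(s in `[0%R, +oo[) (expR (- (s * y)))%:E = (y^-1)%:E)%E.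
Proof.
have yn0 : y != 0 by rewrite gt_eqF.
pose F s := - (expR (- (s * y)) / y).
transitivity (0 - F 0)%:E; last by rewrite /F mul0r oppr0 expR0 mul1r sub0r opprK.
apply: integral_halfline_primitive.
- by move=> s; rewrite /F; apply: is_derive_eq; rewrite /GRing.scale /=; field; exact: yn0.
- by apply: derivable_continuous => s; exact: ex_derive.
- by move=> s _; exact: expR_ge0.
apply: (@cvgy_le_inv _ _ (y ^- 2)) => s s0.
rewrite /F normrN normrM normfV (gtr0_norm y0) ger0_norm ?expR_ge0 //.
have sy : 0 < s * y by rewrite mulr_gt0.
have -> : y ^- 2 / s = (1 / (s * y)) / y by field; rewrite yn0 gt_eqF.
by apply: ler_wpM2r (expRN_le_inv sy); rewrite invr_ge0 ltW.
Qed.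

(** Integrating in [s] gives the convolution of the one-sided exponential with the
    Fejer kernel of width [1 / T]. *)
Definition expo_fejer T z s : R := expR (- (s * y)) * (T * fejer (T * (z - s))).

Definition smoothed_expo T z : R := \int[mu]_(s in `[0, +oo[) expo_fejer T z s.

Lemma scaled_fejer_continuous T z : continuous (fun s : R => T * fejer (T * (z - s))).
Proof.
move=> s; apply: cvgM; first exact: cvg_cst.
have c : continuous (fun s : R => T * (z - s)).
  by apply: derivable_continuous => ?; exact: ex_derive.
by apply: (@continuous_comp _ _ _ (fun s => T * (z - s)) fejer); [exact: c|exact: fejer_continuous].
Qed.

Lemma expo_fejer_continuous T z : continuous (expo_fejer T z).
Proof.
move=> s; rewrite /expo_fejer; apply: cvgM.
  have : continuous (fun s : R => expR (- (s * y))).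
    by apply: derivable_continuous => ?; exact: ex_derive.
  exact.
exact: scaled_fejer_continuous.
Qed.

Lemma expo_fejer_ge0 T z s : 0 < T -> 0 <= expo_fejer T z s.
Proof. by move=> T0; rewrite mulr_ge0 ?expR_ge0 // mulr_ge0 ?fejer_ge0 // ltW. Qed.

Lemma integrable_expRN : mu.-integrable `[0, +oo[ (EFin \o (fun s => expR (- (s * y)))).
Proof.
apply: integrable_halfline integral_expRN.
  by apply: derivable_continuous => ?; exact: ex_derive.
by move=> s _; exact: expR_ge0.
Qed.

Lemma integrable_id_expRN : mu.-integrable `[0, +oo[ (EFin \o (fun s => s * expR (- (s * y)))).
Proof.
apply: integrable_halfline (integral_laplace_inv_sqr y0).
  by apply: derivable_continuous => ?; exact: ex_derive.
by move=> s s0; rewrite mulr_ge0 // expR_ge0.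
Qed.

Lemma integrable_expo_fejer T z : 0 < T ->
  mu.-integrable `[0, +oo[ (EFin \o expo_fejer T z).
Proof.
move=> T0.
apply: (@le_integrable _ _ _ mu _ _ _ (fun s => (T * 2)%:E * (expR (- (s * y)))%:E)%E) => //.
- by apply: measurable_EFin_continuous; exact: expo_fejer_continuous.
- move=> s _; rewrite /= lee_fin ger0_norm ?expo_fejer_ge0 // ger0_norm; last first.
    by rewrite mulr_ge0 ?expR_ge0 // mulr_ge0 // ltW.
  rewrite /expo_fejer mulrC; apply: ler_wpM2r; first exact: expR_ge0.
  by apply: ler_wpM2l; [exact: ltW|exact: fejer_le2].
- by apply: integrableZl => //; exact: integrable_expRN.
Qed.

Lemma smoothed_expo_ge0 T z : 0 < T -> 0 <= smoothed_expo T z.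
Proof. by move=> T0; apply: Rintegral_ge0 => s _; exact: expo_fejer_ge0. Qed.

(** Keeping only the part of the convolution within [d] of its centre [z + d],
    where the exponential is at least [expR (- (y * (z + 2 * d)))]. *)
Lemma smoothed_expo_lower T z d : 0 < T -> 0 <= d -> 0 <= z ->
  expR (- (y * (z + 2 * d))) * fejer_mass (d * T) <= smoothed_expo T (z + d).
Proof.
move=> T0 d0 z0; rewrite -(fejer_mass_shift (z + d) T0 d0).
have -> : z + d - d = z by ring.
have -> : z + d + d = z + 2 * d by ring.
have cf := @scaled_fejer_continuous T (z + d).
rewrite -RintegralZl //; last exact: integrable_segment.
apply: (@le_trans _ _ (\int[mu]_(s in `[z, z + 2 * d]) expo_fejer T (z + d) s)).
  apply: le_Rintegral => //.
  - apply: integrable_segment => s; apply: cvgM; [exact: cvg_cst|exact: cf].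
  - by apply: integrable_segment; exact: expo_fejer_continuous.
  - move=> s /=; rewrite in_itv /= => /andP[zs sz].
    rewrite /expo_fejer; apply: ler_wpM2r.
      by rewrite mulr_ge0 ?fejer_ge0 // ltW.
    by rewrite ler_expR lerN2 mulrC ler_wpM2l // ltW.
rewrite /smoothed_expo /Rintegral fine_le //.
- by apply: integrable_fin_num => //; apply: integrable_segment; exact: expo_fejer_continuous.
- by apply: integrable_fin_num => //; exact: integrable_expo_fejer.
apply: ge0_subset_integral => //.
- by apply: measurable_EFin_continuous; exact: expo_fejer_continuous.
- by move=> s _; rewrite lee_fin expo_fejer_ge0.
- by move=> s /=; rewrite !in_itv /= => /andP[zs _]; rewrite (le_trans z0 zs).
Qed.

(** A narrow kernel is, away from the origin, at most [2 / (T * x ^+ 2)]. The wide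
    kernel [fejer x] decays at the same rate but has zeros, where [cos x = 1];
    adding the translate by [pi], for which the cosine has the opposite sign, the
    numerators add up to 2. *)
Lemma fejer_tail T d x : 0 < T -> 0 < d -> d < `|x| ->
  T * fejer (T * x) <= (1 + pi / d) ^+ 2 / T * (fejer x + fejer (x - pi)).
Proof.
move=> T0 d0 dx.
have x0 : 0 < `|x| by apply: lt_trans dx.
have xn0 : x != 0 by rewrite -normr_gt0.
have x2 : 0 < x ^+ 2 by rewrite exprn_even_gt0.
have Tx2 : 0 < T * x ^+ 2 by exact: mulr_gt0.
have h1 : T * fejer (T * x) <= 2 / (T * x ^+ 2).
  rewrite ler_pdivlMr //.
  have -> : T * fejer (T * x) * (T * x ^+ 2) = fejer (T * x) * (T * x) ^+ 2 by ring.
  rewrite fejer_mul_sqr; have := cos_geN1 (T * x); lra.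
have pi0 := @pi_ge0 R.
have xpi0 : 0 <= `|x| + pi by exact: addr_ge0.
have h2 : 2 <= (fejer x + fejer (x - pi)) * (`|x| + pi) ^+ 2.
  have e1 : x ^+ 2 <= (`|x| + pi) ^+ 2.
    by rewrite -(real_normK (num_real x)) lerXn2r ?nnegrE // lerDl.
  have e2 : (x - pi) ^+ 2 <= (`|x| + pi) ^+ 2.
    rewrite -(real_normK (num_real (x - pi))) lerXn2r ?nnegrE //.
    by apply: le_trans (ler_normB _ _) _; rewrite (ger0_norm pi0).
  have f1 := fejer_mul_sqr x; have f2 := fejer_mul_sqr (x - pi).
  have c2 : cos (x - pi) = - cos x by rewrite cosB cospi sinpi; ring.
  rewrite c2 in f2.
  have g1 : fejer x * x ^+ 2 <= fejer x * (`|x| + pi) ^+ 2 by rewrite ler_wpM2l ?fejer_ge0.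
  have g2 : fejer (x - pi) * (x - pi) ^+ 2 <= fejer (x - pi) * (`|x| + pi) ^+ 2.
    by rewrite ler_wpM2l ?fejer_ge0.
  rewrite mulrDl; lra.
have h3 : (`|x| + pi) ^+ 2 <= (1 + pi / d) ^+ 2 * x ^+ 2.
  rewrite -(real_normK (num_real x)) -exprMn.
  have h : `|x| + pi <= (1 + pi / d) * `|x|.
    by rewrite mulrDl mul1r lerD2l mulrAC ler_pdivlMr // ler_wpM2l // ltW.
  by rewrite lerXn2r ?nnegrE // (le_trans xpi0 h).
apply: le_trans h1 _.
have F0 : 0 <= fejer x + fejer (x - pi) by rewrite addr_ge0 // fejer_ge0.
rewrite ler_pdivrMr //.
have -> : (1 + pi / d) ^+ 2 / T * (fejer x + fejer (x - pi)) * (T * x ^+ 2) =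
  (fejer x + fejer (x - pi)) * ((1 + pi / d) ^+ 2 * x ^+ 2) by field; rewrite !gt_eqF.
by apply: le_trans h2 _; rewrite ler_wpM2l.
Qed.

(** Within [d] of the centre [z - d] the exponential is at most
    [expR (- (y * (z - 2 * d)))], and the interval meets the half-line only if
    [0 <= z]. Elsewhere [fejer_tail] reduces the integral to two smoothings of
    fixed width with a coefficient that is small for large [T]. *)
Lemma smoothed_expo_upper T z d : 0 < T -> 0 < d ->
  smoothed_expo T (z - d) <= pi * expR (2 * y * d) * (if 0 <= z then expR (- (y * z)) else 0)
   + (1 + pi / d) ^+ 2 / T * (smoothed_expo 1 (z - d) + smoothed_expo 1 (z - d - pi)).
Proof.
move=> T0 d0; set C := _ / T.
have C0 : 0 <= C by rewrite divr_ge0 ?sqr_ge0 // ltW.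
pose J : set R := [set` `[z - 2 * d, z]].
pose D : set R := [set` `[0, +oo[].
have mJ : measurable J by exact: measurable_itv.
have mD : measurable D by exact: measurable_itv.
rewrite -lee_fin EFinD.
have finE S w : 0 < S -> ((smoothed_expo S w)%:E = \int[mu]_(s in D) (expo_fejer S w s)%:E)%E.
  move=> S0; rewrite /smoothed_expo /Rintegral fineK //.
  by apply: integrable_fin_num => //; exact: integrable_expo_fejer.
have mE S w (B : set R) : measurable_fun B (fun s => (expo_fejer S w s)%:E).
  by apply: measurable_EFin_continuous; exact: expo_fejer_continuous.
have E0 S w s : 0 < S -> (0 <= (expo_fejer S w s)%:E)%E.
  by move=> S0; rewrite lee_fin expo_fejer_ge0.
(* The interval [J] is the [d]-neighbourhood of the centre. *)
have -> : ((smoothed_expo T (z - d))%:E = \int[mu]_(s in D `&` J) (expo_fejer T (z - d) s)%:E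
    + \int[mu]_(s in D `\` J) (expo_fejer T (z - d) s)%:E)%E.
  rewrite finE // -[in LHS](setUIDK D J); apply: ge0_integral_setU.
  - exact: measurableI.
  - exact: measurableD.
  - exact: mE.
  - by move=> s _; exact: E0.
  - by rewrite disj_set2E; apply/eqP/seteqP; split => // s [[_ ?] []].
apply: leeD.
- case: ifPn => z0; last first.
    rewrite mulr0 (_ : D `&` J = set0) ?integral_set0 //.
    apply/seteqP; split => // s [Ds Js]; move: Ds Js; rewrite /D /J /= !in_itv /= andbT => s0 /andP[_ sz].
    by move: z0; rewrite (le_trans s0 sz).
  apply: (@le_trans _ _ (\int[mu]_(s in J) (expo_fejer T (z - d) s)%:E)%E).
    by apply: ge0_subset_integral; [exact: measurableI|exact: mJ|exact: mE|move=> s _; exact: E0|move=> s []].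
  have iJ : mu.-integrable J (EFin \o expo_fejer T (z - d)).
    by apply: integrable_segment; exact: expo_fejer_continuous.
  rewrite -[leLHS]fineK; last exact: integrable_fin_num.
  rewrite lee_fin.
  have cf := @scaled_fejer_continuous T (z - d).
  apply: (@le_trans _ _ (expR (- (y * (z - 2 * d))) * fejer_mass (d * T))).
    rewrite -(fejer_mass_shift (z - d) T0 (ltW d0)).
    have -> : z - d - d = z - 2 * d by ring.
    have -> : z - d + d = z by ring.
    rewrite -RintegralZl //; last exact: integrable_segment.
    apply: le_Rintegral => //.
    - apply: integrable_segment => s; apply: cvgM; [exact: cvg_cst|exact: cf].
    - move=> s; rewrite /J /= in_itv /= => /andP[zs sz].
      rewrite /expo_fejer; apply: ler_wpM2r.
        by rewrite mulr_ge0 ?fejer_ge0 // ltW.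
      by rewrite ler_expR lerN2 mulrC ler_wpM2r // ltW.
  have -> : pi * expR (2 * y * d) * expR (- (y * z)) = expR (- (y * (z - 2 * d))) * pi.
    rewrite -mulrA -expRD mulrC; congr (expR _ * _); ring.
  apply: ler_wpM2l; first exact: expR_ge0.
  by apply: fejer_mass_le_pi; rewrite mulr_ge0 // ltW.
- rewrite EFinM EFinD !finE // -ge0_integralD //; last 4 first.
  + by move=> s _; exact: E0.
  + exact: mE.
  + by move=> s _; exact: E0.
  + exact: mE.
  rewrite -ge0_integralZl_EFin //; last 2 first.
  + by move=> s _; rewrite adde_ge0 // E0.
  + by apply: emeasurable_funD; exact: mE.
  have mS : measurable_fun D (fun s => (C%:E * ((expo_fejer 1 (z - d) s)%:E + (expo_fejer 1 (z - d - pi) s)%:E))%E).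
    by apply: measurable_funeM; apply: emeasurable_funD; exact: mE.
  apply: (@le_trans _ _ (\int[mu]_(s in D `\` J) (C%:E * ((expo_fejer 1 (z - d) s)%:E + (expo_fejer 1 (z - d - pi) s)%:E)))%E).
    apply: ge0_le_integral.
    + exact: measurableD.
    + by move=> s _; exact: E0.
    + exact: mE.
    + by apply: measurable_funS mS => // s [].
    + move=> s [Ds Js]; rewrite -EFinD -EFinM lee_fin /expo_fejer !mul1r.
      rewrite -[in leRHS]mulrDr [leRHS]mulrCA; apply: ler_wpM2l; first exact: expR_ge0.
      have -> : z - d - pi - s = z - d - s - pi by ring.
      apply: fejer_tail => //; rewrite ltNge; apply/negP => h; apply: Js.
      move: h; rewrite ler_norml /J /= in_itv /= => /andP[h1 h2].
      by apply/andP; split; lra.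
  apply: ge0_subset_integral.
  + exact: measurableD.
  + exact: mD.
  + exact: mS.
  + by move=> s _; apply: mule_ge0; [rewrite lee_fin|apply: adde_ge0; exact: E0].
  + by move=> s [].
Qed.

End ExponentialSmoothing.

(** * Smoothed sums over atoms *)

Section AtomicMeasure.
Context {R : realType}.
Notation mu := (@lebesgue_measure R).

Lemma integrable_lin_comb (D : set (measurableTypeR R)) (I : Type) (r : seq I) (c : I -> R) (f : I -> R -> R) :
  measurable D -> (forall i, mu.-integrable D (EFin \o f i)) ->
  mu.-integrable D (EFin \o (fun u => \sum_(i <- r) c i * f i u)) /\
  \int[mu]_(u in D) (\sum_(i <- r) c i * f i u) = \sum_(i <- r) c i * \int[mu]_(u in D) f i u.
Proof.
move=> mD fi; elim: r => [|i r [IH1 IH2]].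
  split; first by apply: (@eq_integrable _ _ _ mu D mD (cst 0%E)); [move=> u _; rewrite /= big_nil|exact: integrable0].
  rewrite big_nil; transitivity (\int[mu]_(u in D) (0 * 1 : R)).
    by apply: eq_Rintegral => u _; rewrite big_nil mul0r.
  by rewrite mul0r /Rintegral integral0.
have ci : mu.-integrable D (EFin \o (fun u => c i * f i u)).
  by apply: (@eq_integrable _ _ _ mu D mD (fun u => (c i)%:E * (f i u)%:E)%E); [move=> u _; rewrite /= EFinM|exact: (@integrableZl _ _ _ mu D mD (c i) _ (fi i))].
split.
  pose g u := \sum_(j <- r) c j * f j u.
  apply: (@eq_integrable _ _ _ mu D mD ((EFin \o (fun u => c i * f i u)) \+ (EFin \o g))).
    by move=> u _; rewrite /= big_cons.
  exact: integrableD.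
transitivity (\int[mu]_(u in D) (c i * f i u + \sum_(i <- r) c i * f i u)).
  by apply: eq_Rintegral => u _; rewrite big_cons.
by rewrite big_cons RintegralD // IH2; congr (_ + _); exact: RintegralZl.
Qed.

Lemma continuous_lin_comb (I : Type) (r : seq I) (c : I -> R) (f : I -> R -> R) :
  (forall i, continuous (f i)) -> continuous (fun u => \sum_(i <- r) c i * f i u).
Proof.
move=> cf; elim: r => [|i r IH].
  have -> : (fun u : R => \sum_(i <- [::]) c i * f i u) = cst 0.
    by apply/funext => u; rewrite big_nil.
  exact: cst_continuous.
have -> : (fun u : R => \sum_(j <- i :: r) c j * f j u) =
    (fun u => c i * f i u + \sum_(j <- r) c j * f j u).
  by apply/funext => u; rewrite big_cons.
move=> u; apply: cvgD; last exact: IH.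
by apply: cvgM; [exact: cvg_cst|exact: cf].
Qed.

Variables (I : finType) (c x : I -> R) (A K rho : R).
Hypotheses (A0 : 0 < A) (K0 : 0 <= K) (rho0 : 0 <= rho).
Local Notation G := (gauss_window A).

Section Width.
Variable T : R.
Hypothesis T0 : 0 < T.
Hypothesis cosG : forall u, 0 <= u <= T ->
  `|\sum_i c i * cos (u * x i) - G u| <= G u * (K * u + rho).
Hypothesis sinG : forall u, 0 <= u <= T ->
  `|\sum_i c i * sin (u * x i)| <= G u * (K * u + rho).

Local Notation kappa := (Num.sqrt (pi / 2) : R).

(** The sum on the left is the [fejer_average_estimate] average of the transform
    of the measure with atoms [c i] at [x i - s]. The shift by [s] is a rotation
    of the transform by the angle [u * s], at distance at most [2 * u * `|s|]
    from the identity. *)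
Lemma fejer_sum_estimate s :
  `|\sum_i c i * (T * fejer (T * (x i - s))) - kappa| <=
   2 * rho * kappa + (2 * K + 2 * `|s| + T^-1) / A.
Proof.
pose Psi u := \sum_i c i * cos (u * (x i - s)).
have cPsi : continuous Psi.
  apply: (@continuous_lin_comb I (index_enum I) c (fun i u => cos (u * (x i - s)))) => i.
  by apply: derivable_continuous => u; exact: ex_derive.
have PsiE : \int[mu]_(u in `[0, T]) ((1 - u / T) * Psi u) = \sum_i c i * (T * fejer (T * (x i - s))).
  have h i : mu.-integrable `[0, T] (EFin \o (fun u => (1 - u / T) * cos (u * (x i - s)))).
    by apply: integrable_segment; apply: derivable_continuous => u; exact: ex_derive.
  have mT : measurable (`[0, T]%classic : set R) by exact: measurable_itv.
  have [_ E] := integrable_lin_comb (index_enum I) c mT h.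
  transitivity (\int[mu]_(u in `[0, T]) \sum_i c i * ((1 - u / T) * cos (u * (x i - s)))).
    by apply: eq_Rintegral => u _; rewrite /Psi mulr_sumr; apply: eq_bigr => i _; ring.
  rewrite E; apply: eq_bigr => i _; congr (_ * _).
  by rewrite /Rintegral fejer_cos_transform.
rewrite -PsiE.
have K2 : 0 <= 2 * K + 2 * `|s| by rewrite addr_ge0 // mulr_ge0.
have r2 : 0 <= 2 * rho by rewrite mulr_ge0.
apply: fejer_average_estimate => // u uT.
have u0 : 0 <= u by case/andP: uT.
have G0 : 0 <= G u by exact: gauss_window_ge0.
have -> : Psi u = cos (u * s) * (\sum_i c i * cos (u * x i)) + sin (u * s) * \sum_i c i * sin (u * x i).
  rewrite /Psi !mulr_sumr -big_split; apply: eq_bigr => i _ /=.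
  by rewrite mulrBr cosB; ring.
set C := \sum_i _; set S := \sum_i _.
have -> : cos (u * s) * C + sin (u * s) * S - G u = cos (u * s) * (C - G u) + sin (u * s) * S + G u * (cos (u * s) - 1).
  by ring.
have h1 : `|cos (u * s) * (C - G u)| <= 1 * (G u * (K * u + rho)).
  by rewrite normrM ler_pM // ?cos_max // cosG.
have h2 : `|sin (u * s) * S| <= 1 * (G u * (K * u + rho)).
  by rewrite normrM ler_pM // ?sin_max // sinG.
have h3 : `|G u * (cos (u * s) - 1)| <= G u * (2 * (u * `|s|)).
  rewrite normrM (ger0_norm G0) ler_wpM2l //; apply: le_trans (oneBcos_le _) _.
  by rewrite normrM (ger0_norm u0).
apply: le_trans (ler_normD _ _) _; apply: le_trans (lerD (ler_normD _ _) (lexx _)) _.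
have -> : G u * ((2 * K + 2 * `|s|) * u + 2 * rho) = G u * (K * u + rho) + G u * (K * u + rho) + G u * (2 * (u * `|s|)).
  by ring.
by rewrite !lerD // -[leRHS]mul1r.
Qed.

Variable y : R.
Hypothesis y0 : 0 < y.

(** The estimate of [fejer_sum_estimate] grows linearly in the shift, so it can be
    integrated against the exponential. *)
Lemma smoothed_sum_estimate v :
  `|\sum_i c i * smoothed_expo y T (x i - v) - kappa / y| <=
   (2 * rho * kappa + (2 * K + 2 * `|v| + T^-1) / A) / y + 2 / A / y ^+ 2.
Proof.
pose M s := \sum_i c i * (T * fejer (T * (x i - (v + s)))).
pose D : set R := [set` `[0, +oo[].
have mD : measurable D by exact: measurable_itv.
have h i : mu.-integrable D (EFin \o expo_fejer y T (x i - v)) by exact: integrable_expo_fejer.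
have [iM E] := integrable_lin_comb (index_enum I) c mD h.
rewrite -E.
have ME s : \sum_i c i * expo_fejer y T (x i - v) s = expR (- (s * y)) * M s.
  rewrite /M mulr_sumr; apply: eq_bigr => i _; rewrite /expo_fejer.
  have -> : x i - v - s = x i - (v + s) by ring.
  by ring.
have ie : mu.-integrable D (EFin \o (fun s => expR (- (s * y)))) by exact: integrable_expRN.
have iid : mu.-integrable D (EFin \o (fun s => s * expR (- (s * y)))) by exact: integrable_id_expRN.
have lin a b : mu.-integrable D (EFin \o (fun s => a * expR (- (s * y)) + b * (s * expR (- (s * y))))) /\
   \int[mu]_(s in D) (a * expR (- (s * y)) + b * (s * expR (- (s * y)))) = a / y + b / y ^+ 2.
  have [] := @integrable_lin_comb D bool [:: true; false] (fun t => if t then a else b)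
     (fun t s => if t then expR (- (s * y)) else s * expR (- (s * y))) mD _.
    by case.
  move=> i1 i2; split.
    apply: eq_integrable i1 => // s _; by rewrite /= !big_cons big_nil addr0.
  transitivity (\int[mu]_(s in D) \sum_(t <- [:: true; false]) (if t then a else b) * (if t then expR (- (s * y)) else s * expR (- (s * y)))).
    by apply: eq_Rintegral => s _; rewrite !big_cons big_nil addr0.
  rewrite i2 !big_cons big_nil addr0; congr (_ * _ + _ * _).
    by rewrite /Rintegral integral_expRN.
  by rewrite /Rintegral integral_laplace_inv_sqr.
set eta := 2 * rho * kappa + (2 * K + 2 * `|v| + T^-1) / A.
have bound s : 0 <= s -> (kappa - eta) * expR (- (s * y)) + (- (2 / A)) * (s * expR (- (s * y)))
   <= \sum_i c i * expo_fejer y T (x i - v) s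
   <= (kappa + eta) * expR (- (s * y)) + (2 / A) * (s * expR (- (s * y))).
  move=> s0; rewrite ME.
  have := fejer_sum_estimate (v + s); rewrite -/(M s) => hM.
  have vs : `|v + s| <= `|v| + s by apply: le_trans (ler_normD _ _) _; rewrite (ger0_norm s0).
  have {hM} : `|M s - kappa| <= eta + 2 / A * s.
    apply: le_trans hM _; rewrite /eta.
    have -> : 2 * rho * kappa + (2 * K + 2 * `|v| + T^-1) / A + 2 / A * s =
      2 * rho * kappa + (2 * K + 2 * (`|v| + s) + T^-1) / A by ring.
    rewrite lerD2l; apply: ler_wpM2r; first by rewrite invr_ge0 ltW.
    by rewrite !lerD2r lerD2l ler_wpM2l.
  rewrite ler_distl => /andP[m1 m2].
  have e0 := expR_ge0 (- (s * y)).
  set e := expR _ in e0 *.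
  have -> : (kappa - eta) * e + - (2 / A) * (s * e) = e * (kappa - (eta + 2 / A * s)) by ring.
  have -> : (kappa + eta) * e + 2 / A * (s * e) = e * (kappa + (eta + 2 / A * s)) by ring.
  by apply/andP; split; apply: ler_wpM2l.
rewrite ler_distl; apply/andP; split.
  have [i1 e1] := lin (kappa - eta) (- (2 / A)).
  have -> : kappa / y - (eta / y + 2 / A / y ^+ 2) = (kappa - eta) / y + - (2 / A) / y ^+ 2 by ring.
  rewrite -e1; apply: le_Rintegral => // s; rewrite /D /= in_itv /= andbT => s0.
  by case/andP: (bound s s0).
have [i1 e1] := lin (kappa + eta) (2 / A).
have -> : kappa / y + (eta / y + 2 / A / y ^+ 2) = (kappa + eta) / y + (2 / A) / y ^+ 2 by ring.
rewrite -e1; apply: le_Rintegral => // s; rewrite /D /= in_itv /= andbT => s0.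
by case/andP: (bound s s0).
Qed.

End Width.
End AtomicMeasure.

(** * A local limit theorem *)

Section LocalLimit.
Context {R : realType}.
Variables (y : R) (I : nat -> finType) (c x : forall n, I n -> R) (A : nat -> R).
Arguments c : clear implicits.
Arguments x : clear implicits.
Hypotheses (y0 : 0 < y) (c0 : forall n i, 0 <= c n i).
Hypothesis A_oo : A n @[n --> \oo] --> +oo.
(* The measure with atoms [c n i] at [x n i] looks, on bounded frequencies, like
   a normal law of variance [A n ^+ 2] and total mass [A n]; its density near 0 is
   then about [(2 * pi) ^ (- 1 / 2)]. *)
Hypothesis fourier : forall T : R, 0 < T -> exists K : R, exists rho : nat -> R,
  [/\ 0 <= K, forall n, 0 <= rho n, rho n @[n --> \oo] --> (0 : R) &
   \forall n \near \oo, forall u, 0 <= u <= T ->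
     `|\sum_i c n i * cos (u * x n i) - gauss_window (A n) u| <=
        gauss_window (A n) u * (K * u + rho n) /\
     `|\sum_i c n i * sin (u * x n i)| <=
        gauss_window (A n) u * (K * u + rho n)].

Lemma A_gt0 : \forall n \near \oo, 0 < A n.
Proof. by move/cvgryPgt : A_oo; apply. Qed.

Lemma invA_cvg0 : (A n)^-1 @[n --> \oo] --> (0 : R).
Proof. by apply/gtr0_cvgV0; [exact: A_gt0|exact: A_oo]. Qed.

Lemma smoothed_sum_cvg T v : 0 < T ->
  (\sum_i c n i * smoothed_expo y T (x n i - v)) @[n --> \oo] --> Num.sqrt (pi / 2) / y.
Proof.
move=> T0; have [K [rho [K0 rho0 rho_cvg est]]] := fourier T0.
set kappa := Num.sqrt _.
pose e n := (2 * rho n * kappa + (2 * K + 2 * `|v| + T^-1) * (A n)^-1) / y + 2 * (A n)^-1 / y ^+ 2.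
have e_cvg : e n @[n --> \oo] --> (0 : R).
  have -> : 0 = (2 * 0 * kappa + (2 * K + 2 * `|v| + T^-1) * 0) / y + 2 * 0 / y ^+ 2 :> R by ring.
  apply: cvgD; last by apply: cvgMl; apply: cvgMr; exact: invA_cvg0.
  apply: cvgMl; apply: cvgD; last by apply: cvgMr; exact: invA_cvg0.
  by apply: cvgMl; apply: cvgMr; exact: rho_cvg.
apply/cvgrPdist_le => eps eps0.
have e_small : \forall n \near \oo, `|e n| <= eps by move/cvgr0Pnorm_le : e_cvg; apply.
near=> n.
have A0 : 0 < A n by near: n; exact: A_gt0.
have est_n : forall u, 0 <= u <= T ->
     `|\sum_i c n i * cos (u * x n i) - gauss_window (A n) u| <=
        gauss_window (A n) u * (K * u + rho n) /\
     `|\sum_i c n i * sin (u * x n i)| <=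
        gauss_window (A n) u * (K * u + rho n) by near: n.
have en : `|e n| <= eps by near: n.
rewrite distrC; apply: le_trans (le_trans (ler_norm _) en).
exact: (smoothed_sum_estimate A0 K0 (rho0 n) T0 (fun u uT => (est_n u uT).1) (fun u uT => (est_n u uT).2) y0 v).
Unshelve. all: by end_near. Qed.

Definition halfline_expo (z : R) : R := if 0 <= z then expR (- (y * z)) else 0.

Lemma halfline_expo_ge0 z : 0 <= halfline_expo z.
Proof. by rewrite /halfline_expo; case: ifP => // _; exact: expR_ge0. Qed.

Lemma sum_le_smoothed T d n : 0 < T -> 0 <= d ->
  expR (- (2 * y * d)) * fejer_mass (d * T) * (\sum_i c n i * halfline_expo (x n i))
  <= \sum_i c n i * smoothed_expo y T (x n i - - d).
Proof.
move=> T0 d0; rewrite mulr_sumr; apply: ler_sum => i _.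
rewrite mulrCA; apply: ler_wpM2l; first exact: c0.
rewrite /halfline_expo opprK; case: ifP => [x0|_]; last by rewrite mulr0; exact: smoothed_expo_ge0.
apply: le_trans (smoothed_expo_lower y0 T0 d0 x0).
rewrite mulrAC -expRD le_eqVlt; apply/orP; left; apply/eqP; congr (expR _ * _); ring.
Qed.

Lemma smoothed_le_sum T d n : 0 < T -> 0 < d ->
  \sum_i c n i * smoothed_expo y T (x n i - d) <=
  pi * expR (2 * y * d) * (\sum_i c n i * halfline_expo (x n i)) +
  (1 + pi / d) ^+ 2 / T *
    (\sum_i c n i * smoothed_expo y 1 (x n i - d) +
     \sum_i c n i * smoothed_expo y 1 (x n i - (d + pi))).
Proof.
move=> T0 d0; rewrite -big_split /= !mulr_sumr -big_split /=; apply: ler_sum => i _.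
have -> : x n i - (d + pi) = x n i - d - pi by ring.
have := ler_wpM2l (c0 i) (smoothed_expo_upper y0 (x n i) T0 d0).
rewrite -/(halfline_expo _) => h; apply: le_trans h _.
by rewrite le_eqVlt; apply/orP; left; apply/eqP; ring.
Qed.

(** The bookkeeping of [local_limit]: [L] is the sum to be estimated, [U] and [V]
    its smoothings shifted by [- d] and [d], [p] is [pi], [P] the part of the
    mass of the kernel within [d] of its centre, [E] the exponential of
    [2 * y * d], and [C], [W1], [W2] account for the tail of the kernel. *)
Lemma squeeze_algebra (eta l L U V W1 W2 P E Ei C p : R) :
  0 < eta -> eta <= 2^-1 -> 0 < l -> 0 < p -> 0 <= L -> E * Ei = 1 -> 1 <= E -> E <= 1 + eta ->
  p <= (1 + eta) * P -> 0 <= C -> 4 * C <= eta ->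
  Ei * P * L <= U -> V <= p * E * L + C * (W1 + W2) ->
  U <= p * l * (1 + eta) -> p * l * (1 - eta) <= V ->
  W1 <= 2 * (p * l) -> W2 <= 2 * (p * l) -> `|L - l| <= 7 * eta * l.
Proof.
move=> eta0 eta1 l0 p0 L0 EEi E1 Eeta pP C0 Ceta hU hV U1 V1 W1p W2p.
have pl0 : 0 < p * l by exact: mulr_gt0.
have up : L <= (1 + eta) ^+ 3 * l.
  have h1 : P * L <= E * (p * l * (1 + eta)).
    have : E * (Ei * P * L) <= E * (p * l * (1 + eta)).
      by apply: ler_wpM2l; [lra|exact: le_trans U1].
    by rewrite !mulrA EEi mul1r.
  have h2 : p * L <= (1 + eta) * (P * L) by rewrite mulrA ler_wpM2r.
  have h3 : E * (p * l * (1 + eta)) <= (1 + eta) * (p * l * (1 + eta)).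
    by apply: ler_wpM2r => //; apply: mulr_ge0; [exact: ltW|lra].
  have h4 : p * L <= p * ((1 + eta) ^+ 3 * l).
    apply: le_trans h2 _; have -> : p * ((1 + eta) ^+ 3 * l) = (1 + eta) * ((1 + eta) * (p * l * (1 + eta))) by ring.
    by apply: ler_wpM2l; [lra|exact: le_trans h3].
  by rewrite -(ler_pM2l p0).
have lo : l * (1 - 2 * eta) <= (1 + eta) * L.
  have h1 : C * (W1 + W2) <= p * l * eta.
    apply: (@le_trans _ _ (C * (4 * (p * l)))).
      by apply: ler_wpM2l => //; lra.
    have -> : C * (4 * (p * l)) = p * l * (4 * C) by ring.
    by apply: ler_wpM2l => //; exact: ltW.
  have h2 : p * E * L <= p * ((1 + eta) * L).
    by rewrite -mulrA ler_wpM2l ?(ltW p0) // ler_wpM2r.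
  rewrite -(ler_pM2l p0).
  have -> : p * (l * (1 - 2 * eta)) = p * l * (1 - eta) - p * l * eta by ring.
  lra.
have e3 : (1 + eta) ^+ 3 <= 1 + 7 * eta by nra.
have up2 : (1 + eta) ^+ 3 * l <= (1 + 7 * eta) * l by apply: ler_wpM2r => //; exact: ltW.
rewrite ler_distl; apply/andP; split; last by lra.
have : (1 + eta) * (l - 7 * eta * l) <= l * (1 - 2 * eta).
  have -> : (1 + eta) * (l - 7 * eta * l) = l * (1 - 6 * eta - 7 * eta ^+ 2) by ring.
  by apply: ler_wpM2l; [exact: ltW|nra].
move=> h; have {h} := le_trans h lo; rewrite ler_pM2l //; lra.
Qed.

(** Smoothing and shifting by [d] sandwiches the sum between two smoothed sums,
    whose limits are known. The loss is the factor [expR (2 * y * d)], close to 1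
    for small [d], and the mass of the kernel outside the [d]-neighbourhood of
    its centre, small for large [T]. *)
Lemma local_limit :
  (\sum_i c n i * halfline_expo (x n i)) @[n --> \oo] --> (y * Num.sqrt (2 * pi))^-1.
Proof.
set l := _^-1.
have s0 : 0 < Num.sqrt (2 * pi) :> R by rewrite sqrtr_gt0 mulr_gt0 // pi_gt0.
have l0 : 0 < l by rewrite invr_gt0 mulr_gt0.
have kl : Num.sqrt (pi / 2) / y = pi * l.
  have -> : Num.sqrt (pi / 2) = pi / Num.sqrt (2 * pi) :> R.
    apply: (mulIf (lt0r_neq0 s0)); rewrite divfK ?lt0r_neq0 // -sqrtrM ?divr_ge0 ?pi_ge0 //.
    have -> : pi / 2 * (2 * pi) = pi ^+ 2 :> R by field.
    by rewrite sqrtr_sqr ger0_norm ?pi_ge0.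
  by rewrite /l; field; rewrite !gt_eqF.
have pi0 := @pi_gt0 R.
apply/cvgrPdist_le => eps eps0.
pose eta := Num.min (2^-1) (eps / (7 * l)).
have eta0 : 0 < eta by rewrite lt_min invr_gt0 ltr0n /= divr_gt0 // mulr_gt0.
have eta1 : eta <= 2^-1 by rewrite ge_min lexx.
have eta_eps : 7 * eta * l <= eps.
  have : eta <= eps / (7 * l) by rewrite ge_min lexx orbT.
  by rewrite ler_pdivlMr ?mulr_gt0 //; lra.
(* The shift for which the loss [expR (2 * y * d)] is exactly [1 + eta]. *)
pose d := ln (1 + eta) / (2 * y).
have d0 : 0 < d by rewrite divr_gt0 ?ln_gt0 ?mulr_gt0 //; lra.
have Ed : expR (2 * y * d) = 1 + eta.
  rewrite (_ : 2 * y * d = ln (1 + eta)) ?lnK ?posrE //; first lra.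
  by rewrite /d; field; rewrite gt_eqF.
have [T [T0 PT CT]] : exists T, [/\ 0 < T, pi <= (1 + eta) * fejer_mass (d * T) & 4 * ((1 + pi / d) ^+ 2 / T) <= eta].
  have e1 : 0 < pi * eta / (1 + eta) by rewrite divr_gt0 ?mulr_gt0 //; lra.
  have := fejer_mass_near_pi e1 => /= near_pi.
  have : \forall B \near +oo, [/\ 0 < B, pi <= (1 + eta) * fejer_mass B & 4 * ((1 + pi / d) ^+ 2 / (B / d)) <= eta].
    near=> B.
    have B0 : 0 < B by near: B; exact: nbhs_pinfty_gt.
    have hB : pi - pi * eta / (1 + eta) <= fejer_mass B by near: B.
    split => //.
      have : (1 + eta) * (pi - pi * eta / (1 + eta)) <= (1 + eta) * fejer_mass B.
        by rewrite ler_wpM2l //; lra.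
      by apply: le_trans; rewrite le_eqVlt; apply/orP; left; apply/eqP; field; rewrite gt_eqF //; lra.
    have : 4 * (1 + pi / d) ^+ 2 * d / eta <= B by near: B; apply: nbhs_pinfty_ge; rewrite num_real.
    rewrite ler_pdivrMr // => h.
    have -> : 4 * ((1 + pi / d) ^+ 2 / (B / d)) = 4 * (1 + pi / d) ^+ 2 * d / B.
      by field; rewrite ?(gt_eqF d0) ?(gt_eqF B0).
    by rewrite ler_pdivrMr // [leRHS]mulrC.
  case/filter_ex => B [B0 P1 C1]; exists (B / d); split => //; first exact: divr_gt0.
  by rewrite mulrCA divff ?mulr1 // gt_eqF.
have V_cvg := smoothed_sum_cvg d T0.
have U_cvg := smoothed_sum_cvg (- d) T0.
have W1_cvg := smoothed_sum_cvg d ltr01.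
have W2_cvg := smoothed_sum_cvg (d + pi) ltr01.
rewrite kl in V_cvg U_cvg W1_cvg W2_cvg.
have pl0 : 0 < pi * l by rewrite mulr_gt0.
have lt1 : pi * l * (1 - eta) < pi * l by rewrite -[ltRHS]mulr1 ltr_pM2l //; lra.
have lt2 : pi * l < pi * l * (1 + eta) by rewrite -[ltLHS]mulr1 ltr_pM2l //; lra.
have lt3 : pi * l < 2 * (pi * l) by lra.
pose sm n S v := \sum_i c n i * smoothed_expo y S (x n i - v).
near=> n.
rewrite distrC; apply: le_trans eta_eps.
apply: (@squeeze_algebra eta l _ (sm n T (- d)) (sm n T d) (sm n 1 d) (sm n 1 (d + pi)) (fejer_mass (d * T)) (expR (2 * y * d)) (expR (- (2 * y * d))) ((1 + pi / d) ^+ 2 / T) pi) => //.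
- by apply: sumr_ge0 => i _; rewrite mulr_ge0 ?halfline_expo_ge0.
- by rewrite -expRD subrr expR0.
- by rewrite Ed; lra.
- by rewrite Ed.
- by rewrite divr_ge0 ?sqr_ge0 // ltW.
- exact: (sum_le_smoothed n T0 (ltW d0)).
- exact: (smoothed_le_sum n T0 d0).
- by near: n; exact: (cvgr_le _ U_cvg _ lt2).
- by near: n; exact: (cvgr_ge _ V_cvg _ lt1).
- by near: n; exact: (cvgr_le _ W1_cvg _ lt3).
- by near: n; exact: (cvgr_le _ W2_cvg _ lt3).
Unshelve. all: by end_near. Qed.

End LocalLimit.

(** * Tilted exponentials of a sign *)

Section ComplexBounds.
Local Open Scope complex_scope.
Context {R : realType}.
Implicit Types (x y r : R) (z : R[i]).

Definition cis x : R[i] := cos x +i* sin x.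

Lemma cisD x y : cis (x + y) = cis x * cis y.
Proof. by rewrite /cis sinD cosD; apply/eqP; rewrite eq_complex /= eqxx /= addrC. Qed.

Lemma Re_le_norm z r : `|z| <= r%:C -> `|complex.Re z| <= r.
Proof. by move=> zr; rewrite -lecR; apply: le_trans (normc_ge_Re z) zr. Qed.

Lemma norm_imag : `|'i : R[i]| = 1.
Proof. by rewrite normc_def /= expr0n /= add0r expr1n sqrtr1. Qed.

Lemma Im_le_norm z r : `|z| <= r%:C -> `|complex.Im z| <= r.
Proof.
move=> zr; rewrite -normrN -ReiNIm; apply: Re_le_norm.
by rewrite normrM norm_imag mulr1.
Qed.

Lemma norm_real_complex x : `|x%:C| = `|x|%:C.
Proof. by rewrite normc_def /= expr0n /= addr0 sqrtr_sqr. Qed.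

Lemma norm_le_Re_Im z : `|z| <= (`|complex.Re z| + `|complex.Im z|)%:C.
Proof.
rewrite {1}(complexE z) rmorphD /=; apply: le_trans (ler_normD _ _) _.
rewrite normrM norm_real_complex norm_real_complex.
by rewrite norm_imag mul1r.
Qed.

Lemma Re_sum (I : Type) (r : seq I) (F : I -> R[i]) :
  complex.Re (\sum_(i <- r) F i) = \sum_(i <- r) complex.Re (F i).
Proof.
elim: r => [|i r IH]; first by rewrite !big_nil.
by rewrite !big_cons -IH; case: (F i) => ? ?; case: (\sum_(_ <- _) _).
Qed.

Lemma Im_sum (I : Type) (r : seq I) (F : I -> R[i]) :
  complex.Im (\sum_(i <- r) F i) = \sum_(i <- r) complex.Im (F i).
Proof.
elim: r => [|i r IH]; first by rewrite !big_nil.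
by rewrite !big_cons -IH; case: (F i) => ? ?; case: (\sum_(_ <- _) _).
Qed.

End ComplexBounds.

(** Induction, carrying along that the product itself is bounded by the right-hand
    product. *)
Lemma norm_prod_sub1 (K : numDomainType) (I : Type) (r : seq I) (P : pred I)
    (F : I -> K) :
  `|\prod_(i <- r | P i) F i - 1| <= \prod_(i <- r | P i) (1 + `|F i - 1|) - 1.
Proof.
rewrite -lerBlDr opprK.
suff [] : `|\prod_(i <- r | P i) F i - 1| + 1 <= \prod_(i <- r | P i) (1 + `|F i - 1|)
   /\ `|\prod_(i <- r | P i) F i| <= \prod_(i <- r | P i) (1 + `|F i - 1|) by [].
elim/big_rec2 : _ => [|i p q _ [IH1 IH2]]; first by rewrite subrr normr0 add0r normr1.
have F1 : `|F i| <= 1 + `|F i - 1|.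
  by rewrite -{1}(subrK 1 (F i)) addrC -[X in _ <= X + _]normr1; exact: ler_normD.
split; last by rewrite normrM ler_pM.
have -> : F i * q - 1 = (F i - 1) * q + (q - 1) by ring.
have : `|(F i - 1) * q + (q - 1)| <= `|F i - 1| * p + `|q - 1|.
  by apply: le_trans (ler_normD _ _) _; rewrite lerD2r normrM ler_wpM2l.
move=> h; apply: le_trans (lerD h (lexx _)) _.
by rewrite -addrA mulrDl mul1r addrC lerD2r.
Qed.

Section TiltedFactor.
Local Open Scope complex_scope.
Context {R : realType}.
Implicit Types (u y x a : R).

(** With [tilted_sin], the even and odd parts in [e = 1, -1] of the exponential of
    [(y + 'i * u) * a * e], divided by [cosh (y * a)]. *)
Definition tilted_cos u y a : R[i] :=
  cos (u * a) +i* (tanh (y * a) * sin (u * a)).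
Definition tilted_sin u y a : R[i] :=
  (tanh (y * a) * cos (u * a)) +i* sin (u * a).

Lemma tilted_factor u y a (e : R) : e = 1 \/ e = -1 ->
  (expR (y * (a * e)))%:C * cis (u * (a * e)) =
  (cosh (y * a))%:C * (tilted_cos u y a + e%:C * tilted_sin u y a).
Proof.
have h : tanh (y * a) * cosh (y * a) = sinh (y * a).
  by rewrite /tanh divfK // gt_eqF // cosh_gt0.
have h1 : expR (y * a) = cosh (y * a) + sinh (y * a) by rewrite /cosh /sinh; field.
have h2 : expR (- (y * a)) = cosh (y * a) - sinh (y * a) by rewrite /cosh /sinh; field.
case=> ->; rewrite ?mulr1 ?mulrN1 ?mulrN /cis /tilted_cos /tilted_sin.
  by rewrite h1 -h; apply/eqP; rewrite eq_complex /=; apply/andP; split; apply/eqP; ring.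
rewrite h2 sinN cosN -h; apply/eqP; rewrite eq_complex /=; apply/andP; split; apply/eqP; ring.
Qed.

(** The tilted mean [y * a ^+ 2] and the Gaussian factor absorb the expansion up to
    order three in [a]. That the error vanishes with [u] is what makes it
    harmless in [fejer_average_estimate]. *)
Lemma tilted_cos_gauss (M u y a : R) : 1 <= M -> `|u| <= M -> `|y| <= M -> M * `|a| <= 1 ->
  `|tilted_cos u y a * cis (- (u * (y * a ^+ 2))) * (expR ((u * a) ^+ 2 / 2))%:C - 1|
     <= (300 * M ^+ 3 * `|u| * a ^+ 4)%:C.
Proof.
move=> M1 uM yM Ma; apply: le_trans (norm_le_Re_Im _) _; rewrite lecR.
rewrite /tilted_cos /cis /=.
set E := expR _; set al := u * a; set b := tanh _.
have -> : u * (y * a ^+ 2) = y * a * al by rewrite /al; ring.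
set th := y * a * al.
rewrite cosN sinN.
(* Each term in which a remainder [p1], [q1], [c1] or [s1] enters is bounded by a
   multiple of [X]. *)
pose p1 := cos al * E - 1; pose q1 := sin al * E - al.
pose c1 := 1 - cos th; pose s1 := th - sin th.
set X := M ^+ 3 * `|u| * a ^+ 4.
have M0 : 0 <= M by lra.
have a4 : a ^+ 4 = `|a| ^+ 4.
  by rewrite -[RHS](normrX 4) ger0_norm // (_ : a ^+ 4 = (a ^+ 2) ^+ 2) ?sqr_ge0 // -exprM.
have u0 := normr_ge0 u; have y0 := normr_ge0 y; have a0 := normr_ge0 a.
set U := `|u| in uM u0 X *; set h := `|a| in Ma a4 a0 *.
have al_abs : `|al| = U * h by rewrite normrM.
have hX : X = M ^+ 3 * U * h ^+ 4 by rewrite /X a4.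
have X0 : 0 <= X by rewrite hX !mulr_ge0 // exprn_ge0.
have U3 : U ^+ 3 <= M ^+ 3 by rewrite lerXn2r // nnegrE.
have U2 : U ^+ 2 <= M ^+ 2 by rewrite lerXn2r // nnegrE.
have al1 : `|al| <= 1 by rewrite al_abs; apply: le_trans Ma; rewrite ler_wpM2r.
have ya : `|y * a| <= M * h by rewrite normrM ler_wpM2r.
have ya1 : `|y * a| <= 1 by apply: le_trans Ma.
have th_abs : `|th| <= M * U * h ^+ 2.
  rewrite /th normrM al_abs; apply: (@le_trans _ _ (M * h * (U * h))).
    by rewrite ler_wpM2r // mulr_ge0.
  by rewrite le_eqVlt; apply/orP; left; apply/eqP; ring.
have th1 : `|th| <= 1.
  by rewrite /th normrM mulr_ile1.
have thX : `|th| ^+ 2 <= X.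
  apply: (@le_trans _ _ ((M * U * h ^+ 2) ^+ 2)).
    by rewrite lerXn2r // nnegrE // !mulr_ge0 // exprn_ge0.
  have -> : (M * U * h ^+ 2) ^+ 2 = M ^+ 2 * U * h ^+ 4 * U by ring.
  have -> : X = M ^+ 2 * U * h ^+ 4 * M by rewrite hX; ring.
  by rewrite ler_wpM2l // !mulr_ge0 // exprn_ge0.
have alX : `|al| ^+ 4 <= X.
  rewrite al_abs hX; have -> : (U * h) ^+ 4 = U ^+ 3 * (U * h ^+ 4) by ring.
  by rewrite -mulrA ler_wpM2r // mulr_ge0 // exprn_ge0.
have p1X : `|p1| <= 3 * X.
  by apply: le_trans (cos_gauss_taylor al1) _; rewrite ler_wpM2l.
have c1X : `|c1| <= X by apply: le_trans (cos_taylor2 th1) _; rewrite mul1r.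
have b_ya : `|b - y * a| <= 9 * `|y * a| ^+ 3 by exact: tanh_taylor3.
have bX : `|b| <= 10 * (M * h).
  rewrite -(subrK (y * a) b); apply: le_trans (ler_normD _ _) _.
  have : `|y * a| ^+ 3 <= `|y * a| by rewrite exprS ler_piMr // exprn_ile1.
  lra.
have sE : `|sin al * E| <= 7 * `|al|.
  rewrite -(subrK al (sin al * E)); apply: le_trans (ler_normD _ _) _.
  have := sin_gauss_taylor al1; rewrite -/E.
  have : `|al| ^+ 3 <= `|al| by rewrite exprS ler_piMr // exprn_ile1.
  lra.
have sth : `|sin th| <= `|th| by apply: le_trans (sin_taylor1 th1) _; rewrite mul1r.
have Q1 : `|b * (sin al * E)| <= 70.
  rewrite normrM (_ : 70 = 10 * 7); last by ring.
  apply: ler_pM => //; [apply: le_trans bX _|apply: le_trans sE _]; lra.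
have QsX : `|b * (sin al * E) * sin th| <= 70 * X.
  rewrite normrM; apply: (@le_trans _ _ ((10 * (M * h) * (7 * (U * h))) * (M * U * h ^+ 2))).
    apply: ler_pM => //; last exact: le_trans sth th_abs.
    by rewrite normrM; apply: ler_pM => //; rewrite -al_abs.
  have -> : 10 * (M * h) * (7 * (U * h)) * (M * U * h ^+ 2) = 70 * (M ^+ 2 * U * h ^+ 4 * U) by ring.
  have -> : X = M ^+ 2 * U * h ^+ 4 * M by rewrite hX; ring.
  by rewrite ler_wpM2l // ler_wpM2l // !mulr_ge0 // exprn_ge0.
have bth : `|b * al - th| <= 9 * X.
  have -> : b * al - th = (b - y * a) * al by rewrite /th; ring.
  rewrite normrM al_abs; apply: (@le_trans _ _ ((9 * (M * h) ^+ 3) * (U * h))).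
    rewrite ler_wpM2r ?mulr_ge0 //; apply: le_trans b_ya _.
    by rewrite ler_wpM2l // lerXn2r // nnegrE mulr_ge0.
  by rewrite hX le_eqVlt; apply/orP; left; apply/eqP; ring.
have bq : `|b * q1| <= 60 * X.
  rewrite normrM; apply: (@le_trans _ _ ((10 * (M * h)) * (6 * (U * h) ^+ 3))).
    by apply: ler_pM => //; rewrite -al_abs; apply: sin_gauss_taylor.
  have -> : 10 * (M * h) * (6 * (U * h) ^+ 3) = 60 * (M * U * h ^+ 4 * U ^+ 2) by ring.
  have -> : X = M * U * h ^+ 4 * M ^+ 2 by rewrite hX; ring.
  by rewrite ler_wpM2l // ler_wpM2l // !mulr_ge0 // exprn_ge0.
have s1X : `|s1| <= X.
  apply: le_trans (sin_taylor3 th1) _; rewrite mul1r; apply: le_trans thX.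
  by rewrite exprSr ler_piMr // exprn_ge0.
have pc : `|cos al * E * c1| <= 4 * X.
  have -> : cos al * E * c1 = p1 * c1 + c1 by rewrite /p1; ring.
  have c12 : `|c1| <= 1 by apply: le_trans (cos_taylor2 th1) _; rewrite mul1r exprn_ile1.
  apply: le_trans (ler_normD _ _) _; rewrite normrM.
  have : `|p1| * `|c1| <= 3 * X * 1 by apply: ler_pM.
  lra.
have Qc : `|b * (sin al * E) * c1| <= 70 * X by rewrite normrM ler_pM.
have ps : `|p1 * sin th| <= 3 * X.
  rewrite normrM -[leRHS]mulr1 ler_pM // sin_max //.
have -> : (cos al * cos th - b * sin al * - sin th) * E - (cos al * - sin th + b * sin al * cos th) * 0 - 1
   = p1 - cos al * E * c1 + b * (sin al * E) * sin th.
  by rewrite /p1 /c1; ring.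
have -> : (cos al * cos th - b * sin al * - sin th) * 0 + (cos al * - sin th + b * sin al * cos th) * E - 0
   = (b * al - th) + b * q1 - b * (sin al * E) * c1 - p1 * sin th + s1.
  by rewrite /p1 /c1 /q1 /s1; ring.
have r1 : `|p1 - cos al * E * c1 + b * (sin al * E) * sin th| <= 77 * X.
  apply: le_trans (ler_normD _ _) _; apply: le_trans (lerD (ler_normB _ _) (lexx _)) _; lra.
have r2 : `|(b * al - th) + b * q1 - b * (sin al * E) * c1 - p1 * sin th + s1| <= 143 * X.
  apply: le_trans (ler_normD _ _) _; apply: le_trans (lerD (ler_normB _ _) (lexx _)) _.
  apply: le_trans (lerD (lerD (ler_normB _ _) (lexx _)) (lexx _)) _.
  apply: le_trans (lerD (lerD (lerD (ler_normD _ _) (lexx _)) (lexx _)) (lexx _)) _; lra.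
have -> : 300 * M ^+ 3 * U * a ^+ 4 = 300 * X by rewrite /X; ring.
lra.
Qed.

End TiltedFactor.

(** * The tilted characteristic function *)

Section TiltedSum.
Local Open Scope complex_scope.
Context {R : realType}.
Variables (N n : nat) (b : nat -> nat -> bool) (a : nat -> R) (y : R).

Local Notation cube := {ffun 'I_N -> bool}.

Lemma real_character f (w : cube) : (character R f w)%:C = character R[i] f w.
Proof.
by rewrite /character rmorph_prod; apply: eq_bigr => i _; rewrite rmorphXn rmorphN1.
Qed.

Definition char_sum (w : cube) : R := \sum_(1 <= k < n.+1) a k * character R (b k) w.
Definition energy : R := \sum_(1 <= k < n.+1) a k ^+ 2.
Definition tilt_const : R := \prod_(1 <= k < n.+1) cosh (y * a k).
(** The coefficients of the Riesz product that is left when each factor of the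
    tilted exponential is divided by its even part. *)
Definition tilted_coef (u : R) (k : nat) : R[i] :=
  tilted_sin u y (a k) / tilted_cos u y (a k).

Lemma tilt_const_gt0 : 0 < tilt_const.
Proof. by apply: prodr_gt0 => k _; apply: cosh_gt0. Qed.

Lemma cis0 : cis 0 = 1 :> R[i].
Proof. by rewrite /cis cos0 sin0. Qed.

Lemma cis_sum (I : Type) (r : seq I) (F : I -> R) :
  cis (\sum_(i <- r) F i) = \prod_(i <- r) cis (F i).
Proof.
elim: r => [|i r IH]; first by rewrite !big_nil cis0.
by rewrite !big_cons cisD IH.
Qed.

Definition tilted_char (u : R) : R[i] := cube_mean (fun w : cube =>
  (expR (y * char_sum w))%:C * cis (u * (char_sum w - y * energy))).

(** The exponential of a sum of signs times coefficients is a product of binomials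
    ([tilted_factor]); pulling out the even parts leaves a Riesz product. *)
Lemma tilted_charE u :
  (forall k, (1 <= k <= n)%N -> tilted_cos u y (a k) != 0) ->
  tilted_char u = tilt_const%:C *
    (\prod_(1 <= k < n.+1) (tilted_cos u y (a k) * cis (- (u * (y * a k ^+ 2)))))
    * riesz N (tilted_coef u) b n (fun=> false).
Proof.
move=> c0; rewrite /tilted_char /riesz /cube_mean mulrA; congr (_ / _).
rewrite [RHS]mulr_sumr; apply: eq_bigr => w _.
rewrite character_eq1 // mul1r.
have -> : u * (char_sum w - y * energy) = \sum_(1 <= k < n.+1)
    (u * (a k * character R (b k) w) + (- (u * (y * a k ^+ 2)))).
  have e1 : u * char_sum w = \sum_(1 <= k < n.+1) u * (a k * character R (b k) w).
    by rewrite /char_sum mulr_sumr.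
  have e2 : u * (y * energy) = \sum_(1 <= k < n.+1) u * (y * a k ^+ 2).
    by rewrite /energy !mulr_sumr.
  by rewrite mulrBr e1 e2 -sumrB.
rewrite cis_sum /char_sum mulr_sumr expR_sum rmorph_prod /tilt_const rmorph_prod.
rewrite -!big_split /=; apply: eq_big_nat => k kn.
rewrite cisD [LHS]mulrA tilted_factor; last exact: characterV.
rewrite real_character /tilted_coef.
have {}c0 := c0 k kn; field; exact: c0.
Qed.

Variables (M u B rho : R).
Hypothesis M1 : 1 <= M.
Hypothesis uM : `|u| <= M.
Hypothesis yM : `|y| <= M.
Hypothesis Ma : forall k, (1 <= k <= n)%N -> M * `|a k| <= 2^-1.

Let M0 : 0 <= M. Proof. exact: le_trans ler01 M1. Qed.

Lemma norm_tilted_cos_ge x : M * `|x| <= 2^-1 -> (2^-1)%:C <= `|tilted_cos u y x|.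
Proof.
move=> Mx; apply: le_trans (normc_ge_Re _); rewrite lecR /=.
have ux : `|u * x| <= 2^-1 by rewrite normrM; apply: le_trans Mx; rewrite ler_wpM2r.
have ux1 : `|u * x| <= 1 by lra.
have := cos_taylor2 ux1; rewrite mul1r => h.
have h2 : `|u * x| ^+ 2 <= 2^-1 ^+ 2 by rewrite lerXn2r // nnegrE; lra.
have : (2^-1 : R) ^+ 2 = 1 / 4 by field.
have h3 := ler_norm (1 - cos (u * x)); have := ler_norm (cos (u * x)); lra.
Qed.

Lemma tilted_cos_neq0 x : M * `|x| <= 2^-1 -> tilted_cos u y x != 0.
Proof.
move=> /norm_tilted_cos_ge h; rewrite -normr_gt0; apply: lt_le_trans h.
by rewrite ltcR; lra.
Qed.

Lemma norm_tilted_coef_le k : (1 <= k <= n)%N ->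
  `|tilted_coef u k| <= (22 * M * `|a k|)%:C.
Proof.
move=> kn; have Mx := Ma kn.
have ux : `|u * a k| <= M * `|a k| by rewrite normrM ler_wpM2r.
have yx : `|y * a k| <= M * `|a k| by rewrite normrM ler_wpM2r.
have ux1 : `|u * a k| <= 1 by lra.
have yx1 : `|y * a k| <= 1 by lra.
rewrite /tilted_coef normrM normfV.
have c0 := norm_tilted_cos_ge Mx.
have c1 : 0 < `|tilted_cos u y (a k)| by apply: lt_le_trans c0; rewrite ltcR; lra.
rewrite ler_pdivrMr //.
apply: le_trans (norm_le_Re_Im _) _.
apply: (@le_trans _ _ ((22 * M * `|a k|)%:C * (2^-1)%:C)); last first.
  by rewrite ler_wpM2l // ler0c !mulr_ge0.
rewrite -rmorphM /= lecR /=.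
have s1 : `|sin (u * a k)| <= M * `|a k|.
  by apply: le_trans (sin_taylor1 ux1) _; rewrite mul1r.
have t1 : `|tanh (y * a k)| <= 10 * (M * `|a k|).
  rewrite -(subrK (y * a k) (tanh _)); apply: le_trans (ler_normD _ _) _.
  have := tanh_taylor3 yx1.
  have : `|y * a k| ^+ 3 <= `|y * a k| by rewrite exprS ler_piMr // exprn_ile1.
  lra.
have : `|tanh (y * a k) * cos (u * a k)| <= 10 * (M * `|a k|) * 1.
  by rewrite normrM ler_pM // cos_max.
lra.
Qed.

Hypothesis sum4 : \sum_(1 <= k < n.+1) a k ^+ 4 <= B.
Hypothesis riesz_rho :
  `|riesz N (tilted_coef u) b n (fun=> false) - 1| <= rho%:C.

Local Notation delta := (expR (300 * M ^+ 3 * `|u| * B) * (1 + rho) - 1).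

(** The three factors of [tilted_charE]: the tilting constant, scalars that are
    Gaussian up to a fourth-order error each, and a Riesz product close to 1. *)
Lemma tilted_char_gauss :
  `|tilted_char u - (tilt_const * expR (- (u ^+ 2 * energy / 2)))%:C|
   <= (tilt_const * expR (- (u ^+ 2 * energy / 2)) * delta)%:C.
Proof.
rewrite tilted_charE; last by move=> k kn; apply: tilted_cos_neq0; apply: Ma.
set Q := riesz _ _ _ _ _.
pose F k := tilted_cos u y (a k) * cis (- (u * (y * a k ^+ 2))) * (expR ((u * a k) ^+ 2 / 2))%:C.
have PF : \prod_(1 <= k < n.+1) F k = \prod_(1 <= k < n.+1)
   (tilted_cos u y (a k) * cis (- (u * (y * a k ^+ 2)))) * (expR (u ^+ 2 * energy / 2))%:C.
  rewrite /F big_split /= -rmorph_prod -expR_sum; congr (_ * (expR _)%:C).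
  by rewrite /energy mulr_sumr mulr_suml; apply: eq_bigr => k _; rewrite exprMn.
set P := \prod_(1 <= k < n.+1) (tilted_cos u y (a k) * _) in PF *.
set g := expR (- _).
(* Errors are measured relative to the Gaussian factor [g]. *)
have gE : g%:C * (expR (u ^+ 2 * energy / 2))%:C = 1 :> R[i].
  by rewrite -rmorphM /= /g -expRD addNr expR0.
have g0 : 0 <= g by apply: expR_ge0.
have -> : tilt_const%:C * P * Q - (tilt_const * g)%:C =
   (tilt_const * g)%:C * ((P * (expR (u ^+ 2 * energy / 2))%:C) * Q - 1).
  have -> : tilt_const%:C * P * Q = tilt_const%:C * P * Q * (g%:C * (expR (u ^+ 2 * energy / 2))%:C).
    by rewrite gE mulr1.
  by rewrite rmorphM; ring.
have tg0 : 0 <= tilt_const * g by rewrite mulr_ge0 // ltW // tilt_const_gt0.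
rewrite normrM [X in X * _]norm_real_complex (ger0_norm tg0).
rewrite [leRHS]rmorphM /=; apply: ler_wpM2l.
  by rewrite ler0c mulr_ge0 // ltW // tilt_const_gt0.
rewrite -PF.
set G := \prod_(1 <= k < n.+1) F k.
pose x k := 300 * M ^+ 3 * `|u| * a k ^+ 4.
have a40 k : 0 <= a k ^+ 4 by rewrite (_ : a k ^+ 4 = (a k ^+ 2) ^+ 2) ?sqr_ge0 // -exprM.
have K0 : 0 <= 300 * M ^+ 3 * `|u|.
  by apply: mulr_ge0 => //; apply: mulr_ge0 => //; apply: exprn_ge0.
have x0 k : 0 <= x k by apply: mulr_ge0.
have G1 : `|G - 1| <= (expR (300 * M ^+ 3 * `|u| * B) - 1)%:C.
  apply: le_trans (norm_prod_sub1 _ _ _) _.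
  rewrite rmorphB rmorph1 lerD2r.
  apply: (@le_trans _ _ (\prod_(1 <= k < n.+1) (expR (x k))%:C)).
    rewrite big_nat [leRHS]big_nat; apply: ler_prod => k kn; apply/andP; split.
      by rewrite addr_ge0.
    have Mk : M * `|a k| <= 1 by have := Ma kn; lra.
    apply: le_trans (lerD (lexx _) (tilted_cos_gauss M1 uM yM Mk)) _.
    by rewrite -(rmorph1 (real_complex R)) -rmorphD lecR; apply: expR_ge1Dx.
  rewrite -rmorph_prod -expR_sum lecR ler_expR /x -mulr_sumr ler_wpM2l //.
have Q1 : `|Q| <= (1 + rho)%:C.
  rewrite -(subrK 1 Q) rmorphD rmorph1 addrC; apply: le_trans (ler_normD _ _) _.
  by rewrite normr1 lerD2l.
have -> : G * Q - 1 = (G - 1) * Q + (Q - 1) by ring.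
apply: le_trans (ler_normD _ _) _.
have -> : delta = (expR (300 * M ^+ 3 * `|u| * B) - 1) * (1 + rho) + rho by ring.
by rewrite rmorphD rmorphM lerD // normrM ler_pM.
Qed.

Local Notation gauss := (tilt_const * expR (- (u ^+ 2 * energy / 2))).

Lemma real_cube_mean (F : cube -> R[i]) :
  complex.Re (cube_mean F) = cube_mean (fun w => complex.Re (F w)) /\
  complex.Im (cube_mean F) = cube_mean (fun w => complex.Im (F w)).
Proof.
rewrite /cube_mean.
have -> : (2 ^+ N : R[i])^-1 = ((2 ^+ N)^-1 : R)%:C.
  by rewrite fmorphV rmorphXn rmorph_nat.
rewrite -Re_sum -Im_sum; case: (\sum_w F w) => p q /=.
by split; ring.
Qed.

Lemma tilted_cos_mean :
  `|cube_mean (fun w => expR (y * char_sum w) * cos (u * (char_sum w - y * energy))) - gauss|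
   <= gauss * delta.
Proof.
have := Re_le_norm tilted_char_gauss.
have -> z r : complex.Re (z - r%:C) = complex.Re z - r :> R by case: z.
rewrite (real_cube_mean _).1; congr (`|_ - _| <= _).
by congr cube_mean; apply/funext => w /=; ring.
Qed.

Lemma tilted_sin_mean :
  `|cube_mean (fun w => expR (y * char_sum w) * sin (u * (char_sum w - y * energy)))|
   <= gauss * delta.
Proof.
have := Im_le_norm tilted_char_gauss.
have -> z r : complex.Im (z - r%:C) = complex.Im z :> R by case: z => ? ? /=; ring.
rewrite (real_cube_mean _).2; congr (`|_| <= _).
by congr cube_mean; apply/funext => w /=; ring.
Qed.

End TiltedSum.

(** * The tilting constant *)

Section Norms.
Context {R : realType}.
Variable a : nat -> nat -> R.

Lemma le_max_coef n k : (1 <= k <= n)%N -> `|a k n| <= max_coef a n.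
Proof.
move=> kn; rewrite /max_coef.
have : k \in index_iota 1 n.+1 by rewrite mem_index_iota ltnS.
elim: (index_iota _ _) => // i r IH; rewrite inE big_cons le_max.
by case/predU1P => [<-|/IH ->]; rewrite ?lexx ?orbT.
Qed.

Lemma max_coef_ge0 n : 0 <= max_coef a n.
Proof. exact: bigmax_ge_id. Qed.

Lemma ell2_norm_sqr n : ell2_norm a n ^+ 2 = energy n (a ^~ n).
Proof. by rewrite /ell2_norm sqr_sqrtr // sumr_ge0 // => k _; exact: sqr_ge0. Qed.

End Norms.

Section TiltConstant.
Context {R : realType}.
Variables (a : nat -> nat -> R) (y kappa : R).
Hypothesis d_cvg : max_coef a n @[n --> \oo] --> (0 : R).
Hypothesis sum4_cvg : (\sum_(1 <= k < n.+1) a k n ^+ 4) @[n --> \oo] --> kappa.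

(** Each factor is [expR ((y a)^2/2 - (y a)^4/12)] up to a relative error of
    [60 (y a)^6], and the sum of the sixth powers is at most the square of the
    largest coefficient times the bounded sum of the fourth powers. *)
Lemma tilt_const_cvg :
  tilt_const n (a ^~ n) y * expR (- (y ^+ 2 * energy n (a ^~ n) / 2)) @[n --> \oo]
    --> expR (- (y ^+ 4 / 12 * kappa)).
Proof.
pose F n k := cosh (y * a k n) * expR (- ((y * a k n) ^+ 2 / 2 - (y * a k n) ^+ 4 / 12)).
pose P n := \prod_(1 <= k < n.+1) F n k.
pose s4 n := \sum_(1 <= k < n.+1) a k n ^+ 4.
have E n : tilt_const n (a ^~ n) y * expR (- (y ^+ 2 * energy n (a ^~ n) / 2)) =
    P n * expR (- (y ^+ 4 / 12 * s4 n)).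
  have -> : P n = tilt_const n (a ^~ n) y * expR (- (y ^+ 2 * energy n (a ^~ n) / 2 - y ^+ 4 / 12 * s4 n)).
    have e1 : y ^+ 2 * energy n (a ^~ n) / 2 = \sum_(1 <= k < n.+1) (y * a k n) ^+ 2 / 2.
      by rewrite /energy mulr_sumr mulr_suml; apply: eq_bigr => k _; rewrite exprMn.
    have e2 : y ^+ 4 / 12 * s4 n = \sum_(1 <= k < n.+1) (y * a k n) ^+ 4 / 12.
      by rewrite /s4 mulr_sumr; apply: eq_bigr => k _; rewrite exprMn mulrAC.
    rewrite e1 e2 -sumrB -sumrN expR_sum /tilt_const -big_split.
    by apply: eq_bigr.
  by rewrite -[RHS]mulrA -expRD; congr (_ * expR _); ring.
have s4_0 n : 0 <= s4 n.
  by apply: sumr_ge0 => k _; rewrite (_ : _ ^+ 4 = (a k n ^+ 2) ^+ 2) ?sqr_ge0 // -exprM.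
pose e n := 60 * y ^+ 6 * (max_coef a n ^+ 2 * s4 n).
have e_cvg : e n @[n --> \oo] --> (0 : R).
  have -> : 0 = 60 * y ^+ 6 * (0 ^+ 2 * kappa) :> R by ring.
  apply: cvgMr; apply: cvgM => //; rewrite expr2.
  under eq_fun do rewrite expr2.
  exact: cvgM.
have P1 : P n @[n --> \oo] --> (1 : R).
  have b_cvg : expR (e n) - 1 @[n --> \oo] --> (0 : R).
    have -> : 0 = expR 0 - 1 :> R by rewrite expR0 subrr.
    apply: cvgB; last exact: cvg_cst.
    by apply: (@continuous_cvg _ _ _ _ _ e expR) => //; exact: continuous_expR.
  apply/cvgrPdist_le => eps eps0.
  have y1 : 0 < `|y| + 1 by rewrite ltr_wpDl.
  have d_small : \forall n \near \oo, max_coef a n <= (`|y| + 1)^-1.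
    have := cvgr_le _ d_cvg _ (_ : 0 < (`|y| + 1)^-1).
    by apply; rewrite invr_gt0.
  have b_small : \forall n \near \oo, expR (e n) - 1 <= eps by exact: (cvgr_le _ b_cvg _ eps0).
  near=> n.
  have dn : max_coef a n <= (`|y| + 1)^-1 by near: n.
  have bn : expR (e n) - 1 <= eps by near: n.
  rewrite distrC; apply: le_trans bn.
  apply: le_trans (norm_prod_sub1 _ _ _) _; rewrite lerD2r.
  apply: (@le_trans _ _ (\prod_(1 <= k < n.+1) expR (60 * y ^+ 6 * (max_coef a n ^+ 2 * a k n ^+ 4)))); last first.
    by rewrite -expR_sum ler_expR -!mulr_sumr.
  rewrite big_nat [leRHS]big_nat; apply: ler_prod => k kn; rewrite addr_ge0 //=.
  apply: le_trans (expR_ge1Dx _); rewrite lerD2l.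
  have ad := le_max_coef a kn.
  have ya1 : `|y * a k n| <= 1.
    rewrite normrM; apply: (@le_trans _ _ ((`|y| + 1) * (`|y| + 1)^-1)); last by rewrite mulfV // gt_eqF.
    by apply: ler_pM => //; [rewrite lerDl|exact: le_trans dn].
  apply: le_trans (cosh_gauss_taylor ya1) _.
  have -> : `|y * a k n| ^+ 6 = y ^+ 6 * (`|a k n| ^+ 2 * a k n ^+ 4).
    rewrite -normrX ger0_norm; last by rewrite (_ : _ ^+ 6 = ((y * a k n) ^+ 3) ^+ 2) ?sqr_ge0 // -exprM.
    by rewrite real_normK ?num_real //; ring.
  rewrite [leLHS]mulrA; apply: ler_wpM2l.
    by rewrite mulr_ge0 // (_ : y ^+ 6 = (y ^+ 3) ^+ 2) ?sqr_ge0 // -exprM.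
  apply: ler_wpM2r; first by rewrite (_ : _ ^+ 4 = (a k n ^+ 2) ^+ 2) ?sqr_ge0 // -exprM.
  by rewrite lerXn2r // nnegrE // max_coef_ge0.
under eq_fun do rewrite E.
have -> : expR (- (y ^+ 4 / 12 * kappa)) = 1 * expR (- (y ^+ 4 / 12 * kappa)) by rewrite mul1r.
apply: cvgM => //.
apply: continuous_cvg; first exact: continuous_expR.
apply: cvgN; apply: cvgMr; exact: sum4_cvg.
Unshelve. all: by end_near. Qed.

End TiltConstant.

(** * Tail asymptotics *)

Section TailAsymptotics.
Local Open Scope complex_scope.
Context {R : realType}.
Variables (m : nat -> nat) (a : nat -> nat -> R) (y kappa : R).
Local Notation A := (ell2_norm a).
Local Notation bits := (fun k => bit (m k)).
Hypotheses (y0 : 0 < y)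
  (m_le : forall k n, (1 <= k <= n)%N -> (m k <= m n)%N)
  (A_oo : A n @[n --> \oo] --> +oo)
  (d_cvg : max_coef a n @[n --> \oo] --> (0 : R))
  (sum4_cvg : (\sum_(1 <= k < n.+1) a k n ^+ 4) @[n --> \oo] --> kappa).
(* Apart from monotonicity, all that is asked of the frequencies [m k]. *)
Hypothesis riesz_cvg : forall M : R, 1 <= M -> `|y| <= M -> exists rho : nat -> R,
  [/\ forall n, 0 <= rho n, rho n @[n --> \oo] --> (0 : R) &
   \forall n \near \oo, forall u, `|u| <= M ->
     `|riesz (m n) (tilted_coef (a ^~ n) y u) bits n (fun=> false) - 1| <= (rho n)%:C].

Local Notation S n w := (char_sum n bits (a ^~ n) w).
Local Notation V n := (energy n (a ^~ n)).
Local Notation Z n := (tilt_const n (a ^~ n) y).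

(** The exponentially tilted law, multiplied by [A n]: the centered sum spreads over
    the scale [A n], and this normalization gives it a density of order 1 near
    0. *)
Definition tilted_weight n (w : {ffun 'I_(m n) -> bool}) : R :=
  A n * expR (y * S n w) / (2 ^+ m n * Z n).
Definition centered_sum n (w : {ffun 'I_(m n) -> bool}) : R := S n w - y * V n.
Arguments tilted_weight : clear implicits.
Arguments centered_sum : clear implicits.

Let Z0 n : 0 < Z n. Proof. exact: tilt_const_gt0. Qed.

Let pow0 n : 0 < 2 ^+ m n :> R. Proof. by rewrite exprn_gt0. Qed.

Lemma sum_tilted n (f : R -> R) :
  \sum_w tilted_weight n w * f (centered_sum n w) =
  A n / Z n * cube_mean (fun w : {ffun 'I_(m n) -> bool} => expR (y * S n w) * f (S n w - y * V n)).
Proof.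
rewrite /cube_mean mulrA mulr_sumr mulr_suml; apply: eq_bigr => w _.
by rewrite /tilted_weight /centered_sum; field; rewrite !gt_eqF.
Qed.

(** The relative error [expR (L * u) * (1 + rho n) - 1] of [tilted_char_gauss] is at
    most a multiple of [u + rho n] on bounded frequencies. *)
Lemma tilted_fourier (T : R) : 0 < T -> exists K : R, exists rho : nat -> R,
  [/\ 0 <= K, forall n, 0 <= rho n, rho n @[n --> \oo] --> (0 : R) &
   \forall n \near \oo, forall u, 0 <= u <= T ->
     `|\sum_w tilted_weight n w * cos (u * centered_sum n w) - gauss_window (A n) u| <=
        gauss_window (A n) u * (K * u + rho n) /\
     `|\sum_w tilted_weight n w * sin (u * centered_sum n w)| <=
        gauss_window (A n) u * (K * u + rho n)].
Proof.
move=> T0; pose M := Num.max 1 (Num.max T y).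
have M1 : 1 <= M by rewrite le_max lexx.
have TM : T <= M by rewrite !le_max lexx orbT.
have yM : `|y| <= M by rewrite ger0_norm ?(ltW y0) // !le_max lexx !orbT.
have M0 : 0 < M := lt_le_trans ltr01 M1.
have [rho [rho0 rho_cvg rieszP]] := riesz_cvg M1 yM.
pose B := `|kappa| + 1.
have B0 : 0 <= B by rewrite addr_ge0.
pose L := 300 * M ^+ 3 * B.
have L0 : 0 <= L by rewrite !mulr_ge0 ?exprn_ge0 // ltW.
pose E := expR (L * T).
have E0 : 0 <= E by exact: expR_ge0.
exists (E * L), (fun n => E * rho n); split.
- exact: mulr_ge0.
- by move=> n; exact: mulr_ge0.
- by rewrite -(mulr0 E); apply: cvgMr.
have d_small : \forall n \near \oo, max_coef a n <= (2 * M)^-1.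
  by have := cvgr_le _ d_cvg _ (_ : 0 < (2 * M)^-1); apply; rewrite invr_gt0 mulr_gt0.
have s4_small : \forall n \near \oo, \sum_(1 <= k < n.+1) a k n ^+ 4 <= B.
  by apply: (cvgr_le _ sum4_cvg); rewrite /B (le_lt_trans (ler_norm _)) // ltrDl.
near=> n => u /andP[u0 uT].
have An0 : 0 < A n by near: n; move/cvgryPgt : A_oo; apply.
have dn : max_coef a n <= (2 * M)^-1 by near: n.
have s4n : \sum_(1 <= k < n.+1) a k n ^+ 4 <= B by near: n.
have rn : forall u, `|u| <= M ->
     `|riesz (m n) (tilted_coef (a ^~ n) y u) bits n (fun=> false) - 1| <= (rho n)%:C by near: n.
have uM : `|u| <= M by rewrite ger0_norm // (le_trans uT).
have Ma k : (1 <= k <= n)%N -> M * `|a k n| <= 2^-1.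
  move=> kn; apply: (@le_trans _ _ (M * (2 * M)^-1)).
    by rewrite ler_wpM2l ?(ltW M0) // (le_trans (le_max_coef a kn)).
  by rewrite invfM mulrCA divff ?mulr1 // gt_eqF.
pose g := expR (- (u ^+ 2 * V n / 2)).
have gE : gauss_window (A n) u = A n * g by rewrite /gauss_window ell2_norm_sqr.
pose delta := expR (300 * M ^+ 3 * `|u| * B) * (1 + rho n) - 1.
have delta_le : delta <= E * L * u + E * rho n.
  have x_le : 300 * M ^+ 3 * `|u| * B <= L * T.
    rewrite /L (ger0_norm u0) mulrAC; apply: ler_wpM2l => //.
  rewrite /delta; set x := 300 * M ^+ 3 * `|u| * B in x_le *.
  have xE : x = L * u by rewrite /x /L (ger0_norm u0); ring.
  have x0 : 0 <= x by rewrite xE mulr_ge0.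
  have eE : expR x <= E by rewrite ler_expR.
  have ex : expR x - 1 <= x * expR x.
    have := expR_ge1Dx (- x); rewrite expRN => h.
    have e0 := expR_gt0 x.
    have : (1 - x) * expR x <= 1 by rewrite -ler_pdivlMr // div1r.
    lra.
  have -> : expR x * (1 + rho n) - 1 = (expR x - 1) + expR x * rho n by ring.
  apply: lerD; last by apply: ler_wpM2r.
  apply: le_trans ex _; have -> : E * L * u = x * E by rewrite xE; ring.
  exact: ler_wpM2l.
have AZ0 : 0 <= A n / Z n by rewrite divr_ge0 ?ltW.
have scale (X : R) : `|X| <= Z n * g * delta -> `|A n / Z n * X| <= gauss_window (A n) u * (E * L * u + E * rho n).
  move=> hX; rewrite normrM (ger0_norm AZ0).
  apply: (@le_trans _ _ (A n / Z n * (Z n * g * delta))); first exact: ler_wpM2l.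
  have -> : A n / Z n * (Z n * g * delta) = A n * g * delta by field; rewrite gt_eqF.
  by rewrite gE; apply: ler_wpM2l => //; rewrite mulr_ge0 ?expR_ge0 // ltW.
split.
  rewrite (sum_tilted n (fun z => cos (u * z))).
  have -> : gauss_window (A n) u = A n / Z n * (Z n * g) by rewrite gE; field; rewrite gt_eqF.
  rewrite -mulrBr; apply: (le_trans (scale _ _)).
    exact: (tilted_cos_mean M1 uM yM Ma s4n (rn u uM)).
  by rewrite gE le_eqVlt; apply/orP; left; apply/eqP; field; rewrite gt_eqF.
rewrite (sum_tilted n (fun z => sin (u * z))); apply: scale.
exact: (tilted_sin_mean M1 uM yM Ma s4n (rn u uM)).
Unshelve. all: by end_near. Qed.

Lemma walsh_sum_cell n (k : 'I_(2 ^ m n)) (x : R) :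
  k%:R <= 2 ^+ m n * x < k.+1%:R -> walsh_sum m a n x = S n (cell_bits k).
Proof.
move=> kx; apply: eq_big_nat => j jn; congr (_ * _); apply: walsh_cell kx.
by apply: leq_ltn_trans (m_le jn) _; exact: ltn_expl.
Qed.

(** Undoing the tilt: on the tail event the density of the uniform law with respect
    to the tilted one is an exponential of the centered sum. *)
Lemma measure_tail n : 0 < A n ->
  lebesgue_measure [set x : R | 0 <= x <= 1 /\ walsh_sum m a n x >= A n ^+ 2 * y] =
  (Z n / A n * expR (- (y ^+ 2 * V n)) *
     \sum_w tilted_weight n w * halfline_expo y (centered_sum n w))%:E.
Proof.
move=> A0; rewrite (measure_cube_mean _ (@walsh_sum_cell n)); congr EFin.
rewrite sum_tilted mulrA.
have -> : Z n / A n * expR (- (y ^+ 2 * V n)) * (A n / Z n) = expR (- (y ^+ 2 * V n)).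
  by field; rewrite !gt_eqF.
rewrite /cube_mean mulrA; congr (_ / _); rewrite mulr_sumr; apply: eq_bigr => w _.
rewrite /halfline_expo subr_ge0 ell2_norm_sqr mulrC [y * V n]mulrC.
case: ifP => _; last by rewrite !mulr0.
rewrite mulrC -!expRD.
rewrite (_ : _ + _ = 0) ?expR0 //; ring.
Qed.

(** The factors of [measure_tail] are handled by [tilt_const_cvg] and
    [local_limit]. *)
Lemma tail_asymptotics : eq_mul_1o1
  (fun n => lebesgue_measure [set x : R | 0 <= x <= 1 /\ walsh_sum m a n x >= A n ^+ 2 * y])
  (fun n => expR (- (A n ^+ 2 * (y ^+ 2 / 2))) / (`|y| * A n * Num.sqrt (2 * pi))
     * expR (- (y ^+ 4 / 12 * kappa))).
Proof.
set psi := expR (- (y ^+ 4 / 12 * kappa)).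
have psi0 : 0 < psi by exact: expR_gt0.
have s0 : 0 < Num.sqrt (2 * pi) :> R by rewrite sqrtr_gt0 mulr_gt0 // pi_gt0.
have weight_ge0 n w : 0 <= tilted_weight n w.
  rewrite divr_ge0 ?mulr_ge0 ?expR_ge0 ?sqrtr_ge0 //; exact: ltW.
pose L n := \sum_w tilted_weight n w * halfline_expo y (centered_sum n w).
have L_cvg : L n @[n --> \oo] --> (y * Num.sqrt (2 * pi))^-1.
  exact: (@local_limit R y (fun n => {ffun 'I_(m n) -> bool}) tilted_weight centered_sum A y0 weight_ge0 A_oo tilted_fourier).
pose zeta n := Z n * expR (- (y ^+ 2 * V n / 2)).
have zeta_cvg : zeta n @[n --> \oo] --> psi by exact: tilt_const_cvg.
exists (fun n => zeta n / psi * (y * Num.sqrt (2 * pi) * L n) - 1).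
  have -> : 0 = psi / psi * (y * Num.sqrt (2 * pi) * (y * Num.sqrt (2 * pi))^-1) - 1 :> R.
    by field; rewrite !gt_eqF.
  apply: cvgB; last exact: cvg_cst.
  by apply: cvgM; [apply: cvgMl|apply: cvgMr].
near=> n.
have A0 : 0 < A n by near: n; move/cvgryPgt : A_oo; apply.
rewrite measure_tail // -/(L n); congr EFin.
rewrite ell2_norm_sqr (ger0_norm (ltW y0)) /zeta.
have -> : expR (- (y ^+ 2 * V n)) = expR (- (V n * (y ^+ 2 / 2))) * expR (- (y ^+ 2 * V n / 2)).
  by rewrite -expRD; congr expR; field.
field; rewrite !gt_eqF.
Unshelve. all: by end_near. Qed.

End TailAsymptotics.

(** * The two lacunarity regimes *)

Section Sequences.
Context {R : realType}.
Implicit Types u v d : nat -> R.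

Lemma cvg0_le u v : (\forall n \near \oo, 0 <= u n <= v n) ->
  v n @[n --> \oo] --> (0 : R) -> u n @[n --> \oo] --> (0 : R).
Proof. by move=> uv v0; apply: (squeeze_cvgr uv _ v0); exact: cvg_cst. Qed.

Lemma cvg0_expr_inv d p : (forall n, 0 <= d n) -> (0 < p)%N ->
  d n ^+ p @[n --> \oo] --> (0 : R) -> d n @[n --> \oo] --> (0 : R).
Proof.
move=> d0 p0 dp; apply/cvgr0Pnorm_le => e e0.
have ep : 0 < e ^+ p by rewrite exprn_gt0.
near=> n.
have h : d n ^+ p <= e ^+ p by near: n; exact: (cvgr_le _ dp _ ep).
by rewrite ger0_norm // -(@ler_pXn2r _ p) // nnegrE // ltW.
Unshelve. all: by end_near. Qed.

End Sequences.

Section Cases.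
Local Open Scope complex_scope.
Context {R : realType}.
Variables (q : R) (m : nat -> nat) (a : nat -> nat -> R) (y : R).
Hypotheses (q1 : 1 < q)
  (m_gt0 : forall k : nat, (1 <= k)%N -> (0 < m k)%N)
  (m_incr : forall k : nat, (1 <= k)%N -> (m k < m k.+1)%N)
  (m_lac : forall k : nat, (1 <= k)%N -> q <= (m k.+1)%:R / (m k)%:R)
  (y0 : 0 < y)
  (A_oo : ell2_norm a n @[n --> \oo] --> +oo).

Let m_le k n : (1 <= k <= n)%N -> (m k <= m n)%N.
Proof.
move=> /andP[k1]; rewrite leq_eqVlt => /orP[/eqP->//|kn].
by apply: ltnW; exact: (m_mono m_incr).
Qed.

Local Notation target kappa := (eq_mul_1o1
  (fun n => lebesgue_measure
     [set x : R | 0 <= x <= 1 /\ walsh_sum m a n x >= ell2_norm a n ^+ 2 * y])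
  (fun n => expR (- (ell2_norm a n ^+ 2 * (y ^+ 2 / 2)))
     / (`|y| * ell2_norm a n * Num.sqrt (2 * pi)) * expR (- (y ^+ 4 / 12 * kappa)))).

(** A ratio of at least 2 makes the highest digits strictly increasing, and the
    Riesz product has mean exactly 1. *)
Lemma tail_asymptotics_independent (kappa : R) : 2 <= q ->
  (\sum_(1 <= k < n.+1) a k n ^+ 4) @[n --> \oo] --> kappa ->
  n%:R * max_coef a n ^+ 5 @[n --> \oo] --> (0 : R) -> target kappa.
Proof.
move=> q2 s4 nd5.
have d_cvg : max_coef a n @[n --> \oo] --> (0 : R).
  apply: (@cvg0_expr_inv _ _ 5) => //; first by move=> n; exact: max_coef_ge0.
  apply: cvg0_le nd5; near=> n.
  have n1 : (1 <= n)%N by near: n; exact: nbhs_infty_ge.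
  rewrite exprn_ge0 ?max_coef_ge0 //= ler_peMl ?exprn_ge0 ?max_coef_ge0 //.
  by rewrite ler1n.
apply: tail_asymptotics => // M M1 _; exists (fun=> 0); split => //; first exact: cvg_cst.
near=> n => u uM.
rewrite (@riesz_free _ (m n) _ _ (top_bit m) n) ?subrr ?normr0 //.
- by move=> k; exact: (top_bit_lt m_gt0 m_incr).
- by move=> k; exact: (bit_top_bit m_gt0).
- by move=> k i; exact: (bit_above_top m_gt0).
- exact: (top_bit_increasing m_gt0 m_incr m_lac q2).
Unshelve. all: by end_near. Qed.

(** Since [n * d ^+ 3] tends to 0, so do the sum of the fourth powers and the bound
    of [riesz_near1] for coefficients of size [tau = 22 * M * d]. *)
Lemma tail_asymptotics_lacunary (eps : R) : 0 < eps ->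
  n%:R `^ (1 + eps) * max_coef a n ^+ 3 @[n --> \oo] --> (0 : R) -> target 0.
Proof.
move=> eps0 h.
pose d n := max_coef a n.
have d0 n : 0 <= d n by exact: max_coef_ge0.
have nd3 : n%:R * d n ^+ 3 @[n --> \oo] --> (0 : R).
  apply: cvg0_le h; near=> n.
  have n1 : (1 <= n)%N by near: n; exact: nbhs_infty_ge.
  have d3 : 0 <= d n ^+ 3 by rewrite exprn_ge0.
  rewrite mulr_ge0 //=; apply: ler_wpM2r => //.
  rewrite -[leLHS]powRr1 //; apply: ler_powR; first by rewrite ler1n.
  by rewrite lerDl ltW.
have d_cvg : d n @[n --> \oo] --> (0 : R).
  apply: (@cvg0_expr_inv _ _ 3) => //; apply: cvg0_le nd3; near=> n.
  have n1 : (1 <= n)%N by near: n; exact: nbhs_infty_ge.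
  by rewrite exprn_ge0 //= ler_peMl ?exprn_ge0 // ler1n.
have s4 : (\sum_(1 <= k < n.+1) a k n ^+ 4) @[n --> \oo] --> (0 : R).
  apply: (@cvg0_le _ _ (fun n => n%:R * d n ^+ 3 * d n)); last first.
    by rewrite -(mulr0 0); apply: cvgM.
  near=> n.
  have a4 k : a k n ^+ 4 = `|a k n| ^+ 4.
    by rewrite -normrX ger0_norm // (_ : a k n ^+ 4 = (a k n ^+ 2) ^+ 2) ?sqr_ge0 // -exprM.
  apply/andP; split; first by apply: sumr_ge0 => k _; rewrite a4 exprn_ge0.
  apply: (@le_trans _ _ (\sum_(1 <= k < n.+1) d n ^+ 4)).
    rewrite big_nat [leRHS]big_nat; apply: ler_sum => k kn.
    by rewrite a4 lerXn2r ?nnegrE //; exact: le_max_coef.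
  by rewrite sumr_const_nat subn1 -[leLHS]mulr_natl -mulrA -exprSr.
have [c sep] := top_bit_separated q1 m_gt0 m_incr m_lac.
have [C C0 win] := top_bit_window q1 m_gt0 m_incr m_lac c.
apply: tail_asymptotics => // M M1 yM.
pose tau n := 22 * M * d n.
have M0 : 0 <= M by apply: le_trans M1.
have tau0 n : 0 <= tau n by rewrite !mulr_ge0.
pose x n := n%:R * (C%:R ^+ 2 * tau n ^+ 3).
have x_cvg : x n @[n --> \oo] --> (0 : R).
  have E n : x n = C%:R ^+ 2 * (22 * M) ^+ 3 * (n%:R * d n ^+ 3) by rewrite /x /tau; ring.
  under eq_fun do rewrite E.
  by rewrite -(mulr0 (C%:R ^+ 2 * (22 * M) ^+ 3)); apply: cvgMr.
exists (fun n => 2 * x n); split.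
- by move=> n; rewrite !mulr_ge0 ?exprn_ge0.
- by rewrite -(mulr0 2); apply: cvgMr.
have tau_cvg : C%:R * tau n @[n --> \oo] --> (0 : R).
  rewrite -(mulr0 C%:R); apply: cvgMr; rewrite -(mulr0 (22 * M)); exact: cvgMr.
have q4 : 0 < 4^-1 :> R by rewrite invr_gt0.
have s1 := cvgr_le _ tau_cvg _ q4.
have s3 := cvgr_le _ x_cvg _ q4.
have q2 : 0 < (2 * M)^-1 by rewrite invr_gt0 mulr_gt0 // (lt_le_trans ltr01).
have sd := cvgr_le _ d_cvg _ q2.
near=> n => u uM; set t := tilted_coef _ _ _.
have dn : d n <= (2 * M)^-1 by near: n; exact: sd.
have h1 : C%:R * tau n <= 4^-1 by near: n; exact: s1.
have h3 : x n <= 4^-1 by near: n; exact: s3.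
have CE k : (k%:R : R[i]) = (k%:R)%:C by rewrite rmorph_nat.
have Ma k : (1 <= k <= n)%N -> M * `|a k n| <= 2^-1.
  move=> kn; apply: (@le_trans _ _ (M * (2 * M)^-1)).
    by rewrite ler_wpM2l // (le_trans (le_max_coef a kn)).
  by rewrite invfM mulrCA divff ?mulr1 // gt_eqF // (lt_le_trans ltr01).
have := @riesz_near1 _ (m n) t (fun k => bit (m k)) (top_bit m) n c C (tau n)%:C.
have -> : (2 * x n)%:C = 2 * (n%:R * (C%:R ^+ 2 * (tau n)%:C ^+ 3)) :> R[i].
  have -> v w : (2 * (v * (w ^+ 2 * tau n ^+ 3)))%:C = 2 * (v%:C * (w%:C ^+ 2 * (tau n)%:C ^+ 3)).
    by rewrite (rmorphM _ 2) rmorph_nat (rmorphM _ v) (rmorphM _ (w ^+ 2)) !rmorphXn.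
  by rewrite !rmorph_nat.
apply => //.
- by move=> k; exact: (top_bit_lt m_gt0 m_incr).
- by move=> i j; exact: (top_bit_mono m_incr).
- by move=> k; exact: (bit_top_bit m_gt0).
- by move=> k i; exact: (bit_above_top m_gt0).
- move=> k kn; apply: le_trans (norm_tilted_coef_le M1 uM yM Ma kn) _.
  by rewrite lecR /tau ler_wpM2l ?mulr_ge0 //; exact: le_max_coef.
- by rewrite ler0c.
- rewrite !CE -!rmorphM -(rmorph1 (real_complex R)) lecR.
  by rewrite mulrC -ler_pdivlMr // div1r.
- rewrite !CE -!(rmorphXn (real_complex R)) -!rmorphM -(rmorph1 (real_complex R)) lecR.
  by rewrite -/(x n) mulrC -ler_pdivlMr // div1r.
Unshelve. all: by end_near. Qed.

End Cases.

(** * Both tails *)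

Section Opposite.
Context {R : realType}.
Variables (m : nat -> nat) (a : nat -> nat -> R).
Local Notation opp_a := (fun k n => - a k n).

Lemma walsh_sumN n x : walsh_sum m opp_a n x = - walsh_sum m a n x.
Proof. by rewrite /walsh_sum -sumrN; apply: eq_bigr => k _; rewrite mulNr. Qed.

Lemma ell2_normN n : ell2_norm opp_a n = ell2_norm a n.
Proof. by congr Num.sqrt; apply: eq_bigr => k _; rewrite sqrrN. Qed.

Lemma max_coefN n : max_coef opp_a n = max_coef a n.
Proof. by apply: eq_bigr => k _; rewrite normrN. Qed.

Lemma sum4N n : \sum_(1 <= k < n.+1) (- a k n) ^+ 4 = \sum_(1 <= k < n.+1) a k n ^+ 4.
Proof. by apply: eq_bigr => k _; rewrite exprNn -signr_odd mul1r. Qed.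

End Opposite.

Lemma upper_tail (R : realType) (q : R) (m : nat -> nat)
    (a : nat -> nat -> R) (kappa4 : R)
    (hq : 1 < q)
    (m_gt0 : forall k : nat, (1 <= k)%N -> (0 < m k)%N)
    (m_incr : forall k : nat, (1 <= k)%N -> (m k < m k.+1)%N)
    (m_lac : forall k : nat, (1 <= k)%N -> q <= (m k.+1)%:R / (m k)%:R)
    (A_infty : ell2_norm a n @[n --> \oo] --> +oo)
    (h_ge2 : 2 <= q ->
       (\sum_(1 <= k < n.+1) a k n ^+ 4) @[n --> \oo] --> kappa4 /\
       n%:R * max_coef a n ^+ 5 @[n --> \oo] --> (0 : R))
    (h_lt2 : q < 2 ->
       exists2 eps : R, 0 < eps &
         n%:R `^ (1 + eps) * max_coef a n ^+ 3 @[n --> \oo] --> (0 : R))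
    (y : R) (y_gt0 : 0 < y) :
  eq_mul_1o1
    (fun n => lebesgue_measure
       [set x : R | 0 <= x <= 1 /\ walsh_sum m a n x >= ell2_norm a n ^+ 2 * y])
    (gauss_tail a q kappa4 y).
Proof.
rewrite /gauss_tail /psi; have [q2|q2] := lerP 2 q.
  have [sum4 nd5] := h_ge2 q2.
  exact: (tail_asymptotics_independent m_gt0 m_incr m_lac y_gt0 A_infty q2 sum4 nd5).
have [eps eps0 nd3] := h_lt2 q2.
have := tail_asymptotics_lacunary hq m_gt0 m_incr m_lac y_gt0 A_infty eps0 nd3.
by rewrite [y ^+ 4 / 12 * 0]mulr0 oppr0 expR0.
Qed.

Theorem theorem2p7 (R : realType) (q : R) (m : nat -> nat)
    (a : nat -> nat -> R) (kappa4 : R)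
    (hq : 1 < q)
    (m_gt0 : forall k : nat, (1 <= k)%N -> (0 < m k)%N)
    (m_incr : forall k : nat, (1 <= k)%N -> (m k < m k.+1)%N)
    (m_lac : forall k : nat, (1 <= k)%N -> q <= (m k.+1)%:R / (m k)%:R)
    (A_infty : ell2_norm a n @[n --> \oo] --> +oo)
    (h_ge2 : 2 <= q ->
       (\sum_(1 <= k < n.+1) a k n ^+ 4) @[n --> \oo] --> kappa4 /\
       n%:R * max_coef a n ^+ 5 @[n --> \oo] --> (0 : R))
    (h_lt2 : q < 2 ->
       exists2 eps : R, 0 < eps &
         n%:R `^ (1 + eps) * max_coef a n ^+ 3 @[n --> \oo] --> (0 : R)) :
  (forall y : R, 0 < y ->
     eq_mul_1o1
       (fun n => lebesgue_measure
          [set x : R | 0 <= x <= 1 /\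
                       walsh_sum m a n x >= ell2_norm a n ^+ 2 * y])
       (gauss_tail a q kappa4 y)) /\
  (forall y : R, y < 0 ->
     eq_mul_1o1
       (fun n => lebesgue_measure
          [set x : R | 0 <= x <= 1 /\
                       walsh_sum m a n x <= ell2_norm a n ^+ 2 * y])
       (gauss_tail a q kappa4 y)).
Proof.
split=> y hy; first exact: (upper_tail hq).
have normE : ell2_norm (fun k n => - a k n) = ell2_norm a by apply/funext => n; exact: ell2_normN.
have maxE : max_coef (fun k n => - a k n) = max_coef a by apply/funext => n; exact: max_coefN.
have := @upper_tail R q m (fun k n => - a k n) kappa4 hq m_gt0 m_incr m_lac.
rewrite /gauss_tail normE maxE => /(_ A_infty) upperN.
have {}upperN := upperN _ h_lt2 (- y).
have -> : (fun n => lebesgue_measure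
    [set x : R | 0 <= x <= 1 /\ walsh_sum m a n x <= ell2_norm a n ^+ 2 * y]) =
  (fun n => lebesgue_measure
    [set x : R | 0 <= x <= 1 /\
                 walsh_sum m (fun k n => - a k n) n x >= ell2_norm a n ^+ 2 * - y]).
  apply/funext => n; congr lebesgue_measure; apply/seteqP.
  by split=> x /=; rewrite walsh_sumN mulrN lerN2.
move: upperN; rewrite /psi normrN sqrrN (_ : (- y) ^+ 4 = y ^+ 4); last first.
  by rewrite exprNn -signr_odd mul1r.
apply; last by rewrite oppr_gt0.
move=> /h_ge2[sum4 nd5]; split=> //.
by under eq_fun do rewrite sum4N.
Qed.
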